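(* Let $A\in\mathrm{Mat}_{d\times n}(\mathbb Z)$ have rank $d$, let $\beta\in\mathbb C^{d}$, put $L=\mathrm{Ker}_{\mathbb Z}(A)$, and fix an $L$-generic direction $w\in\mathbb R^{n}$. Then the following statements hold (all notation is defined in the context). (1) For every exponent lattice $\Lambda\in\mathfrak L_\beta$ and every reference vector $\lambda\in\Lambda$, normalization $(r_\gamma)_{\gamma\in\Lambda}\mapsto(c_{\Lambda,I})_{I\in\mathrm{NS}(\Lambda)}$, where $c_{\Lambda,I}$ is the common value of the normalized coefficients $c^{(\lambda)}_\gamma$ for $\gamma\in\Lambda_I$, together with evaluation on the generators $\overline e^{*}_{\Lambda,I}$, induces $\mathbb C$-linear isomorphisms $$\mathrm{Sol}^{\mathrm{dir}}_{w,\Lambda}(H_A(\beta))\cong\mathrm{Coeff}^{\mathrm{dir}}_w(\Lambda)\cong\mathrm{Hom}_S\bigl(M^{\mathrm{dir}}_{\Lambda,w},\mathbb C[y]\bigr).$$ (2) For $\Lambda\in\mathfrak L_\beta$ one has $\mathrm{Sol}^{\mathrm{dir}}_{w,\Lambda}(H_A(\beta))\neq0$ if and only if $\mathcal M_w(\Lambda)\neq\emptyset$; moreover, for every $I\in\mathcal M_w(\Lambda)$ the stratum minimum $v_{\Lambda,I}$ is the lowest exponent $\mathrm{lexp}_w(\varphi)$ of some nonzero $\varphi\in\mathrm{Sol}^{\mathrm{dir}}_{w,\Lambda}(H_A(\beta))$. (3) Only finitely many $\Lambda\in\mathfrak L_\beta$ satisfy $\mathrm{Sol}^{\mathrm{dir}}_{w,\Lambda}(H_A(\beta))\neq0$;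 that is, $\mathfrak L^{\mathrm{adm}}_{\beta,w}$ is finite. (4) For every $\Lambda\in\mathfrak L^{\mathrm{adm}}_{\beta,w}$ the $S$-module $M^{\mathrm{dir}}_{\Lambda,w}$ has finite length, and the $S$-module $M^{\mathrm{dir,all}}_{\beta,w}$ has finite length. (5) One has $$\dim_{\mathbb C}\mathrm{Sol}^{\mathrm{dir,all}}_{\beta,w}(H_A(\beta))=\mathrm{length}_S\bigl(M^{\mathrm{dir,all}}_{\beta,w}\bigr)=\sum_{\Lambda\in\mathfrak L^{\mathrm{adm}}_{\beta,w}}\mathrm{length}_S\bigl(M^{\mathrm{dir}}_{\Lambda,w}\bigr),$$ and every normalized coefficient family $(c_{\Lambda,I})_{I}\in\mathrm{Coeff}^{\mathrm{dir}}_w(\Lambda)$ (with $\Lambda\in\mathfrak L^{\mathrm{adm}}_{\beta,w}$ and reference vector $\lambda\in\Lambda$) is realized by the formal logarithmic series $$\sum_{I\in\mathrm{NS}(\Lambda)}\sum_{\gamma\in\Lambda_I}x^\gamma r_\gamma(\log x)\in\mathrm{Sol}^{\mathrm{dir}}_{w,\Lambda}(H_A(\beta)),\qquad r_\gamma=(\widetilde d_{\lambda\leftarrow\gamma}\bullet)^{-1}\bigl(\widetilde d_{\gamma\leftarrow\lambda}\bullet c_{\Lambda,I}\bigr)\quad(\gamma\in\Lambda_I).$$ (6) For every $\Lambda\in\mathfrak L_\beta$ the set $\mathrm{Rexp}_w(\Lambda)$ of realizable lowest exponents is $$\mathrm{Rexp}_w(\Lambda)=\{v_{\Lambda,K}\mid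 K\in\mathcal A_w(\Lambda),\ \mathrm{Ker}(\pi_{\Lambda,<K})\not\subset\mathrm{Ker}(\pi_{\Lambda,K})\}=\{v_{\Lambda,K}\mid K\in\mathcal A_w(\Lambda),\ \mathfrak Q^{<K}_{\Lambda,w}:\partial_y^{K}\neq S\}.$$
   Context: Basics. $\mathbb N=\{0,1,2,\dots\}$, $[n]=\{1,\dots,n\}$. $A=(a_{ij})\in\mathrm{Mat}_{d\times n}(\mathbb Z)$ has rank $d$ (no homogeneity, pointedness or positivity is assumed), $\beta\in\mathbb C^d$, $L=\mathrm{Ker}_{\mathbb Z}(A)$. An exponent lattice is a coset $\Lambda=\lambda+L$ with $\lambda\in\mathbb C^n$, $A\lambda=\beta$; $\mathfrak L_\beta$ is the set of all exponent lattices. Hypergeometric ideal. $D=\mathbb C\langle x_1,\dots,x_n,\partial_{x_1},\dots,\partial_{x_n}\rangle$ is the Weyl algebra, $\theta_{x_j}=x_j\partial_{x_j}$, $(A\theta_x)_i=\sum_j a_{ij}\theta_{x_j}$. For $u\in\mathbb Z^n$ write $u=u_+-u_-$ with $u_\pm\in\mathbb N^n$ of disjoint support. $I_A=\langle\partial_x^{u_+}-\partial_x^{u_-}\mid u\in L\rangle\subset\mathbb C[\partial_x]$ and $H_A(\beta)=DI_A+\sum_{i=1}^dD((A\theta_x)_i-\beta_i)$. Formal series. $S=\mathbb C[\partial_{y_1},\dots,\partial_{y_n}]$ acts on $\mathbb C[y]=\mathbb C[y_1,\dots,y_n]$ by differentiation, written $\bullet$; $(A\partial_y)_i=\sum_ja_{ij}\partial_{y_j}$;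 $\partial_y^K=\prod_{j\in K}\partial_{y_j}$ for $K\subset[n]$. For $\Lambda\in\mathfrak L_\beta$ put $\widetilde\Lambda=\Lambda+\mathbb Z^n$. $\mathscr F^{\log}_{\widetilde\Lambda}$ is the space of all formal (possibly infinite) sums $\sum_{\gamma\in\widetilde\Lambda}x^\gamma p_\gamma(\log x)$, $p_\gamma\in\mathbb C[y]$, with coefficientwise equality; $D$ acts on it coefficientwise by $x_j\bullet(x^\gamma p(\log x))=x^{\gamma+e_j}p(\log x)$ and $\partial_{x_j}\bullet(x^\gamma p(\log x))=x^{\gamma-e_j}((\gamma_j+\partial_{y_j})\bullet p)(\log x)$. $\mathrm{Supp}(\varphi)=\{\gamma\mid p_\gamma\neq0\}$. Negative supports. $\mathrm{nsupp}(\gamma)=\{j\in[n]\mid\gamma_j\in\mathbb Z_{<0}\}$ for $\gamma\in\mathbb C^n$; $\Lambda_I=\{\gamma\in\Lambda\mid\mathrm{nsupp}(\gamma)=I\}$; $\mathrm{NS}(\Lambda)=\{I\subset[n]\mid\Lambda_I\ne\emptyset\}$; $\mathrm{MinNS}(\Lambda)$ is the set of inclusion-minimal elements of $\mathrm{NS}(\Lambda)$. Direction. $w\in\mathbb R^n$ is $L$-generic if $w\cdot u\ne0$ for all $u\in L\setminus\{0\}$. On each $\Lambda$, $\gamma\le_w\gamma'$ iff $w\cdot(\gamma'-\gamma)\ge0$ (a total order). A nonempty $\Omega\subset\Lambda$ is $w$-bounded below if $\{w\cdot(\gamma-\lambda)\mid\gamma\in\Omega\}$ is bounded below in $\mathbb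 R$ for one (equivalently any) $\lambda\in\Lambda$. $\mathcal B_w(\Lambda)=\{I\in\mathrm{NS}(\Lambda)\mid\Lambda_I\text{ is }w\text{-bounded below}\}$, $\mathcal U_w(\Lambda)=\mathrm{NS}(\Lambda)\setminus\mathcal B_w(\Lambda)$. For $I\in\mathcal B_w(\Lambda)$, $v_{\Lambda,I}$ is the (existing, unique) $\le_w$-minimum of $\Lambda_I$. $\mathcal M_w(\Lambda)=\mathrm{MinNS}(\Lambda)\cap\mathcal B_w(\Lambda)$; $\mathfrak L^{\mathrm{adm}}_{\beta,w}=\{\Lambda\in\mathfrak L_\beta\mid\mathcal M_w(\Lambda)\ne\emptyset\}$. $\mathcal A_w(\Lambda)$ (acceptable supports) is the set of $I\in\mathrm{NS}(\Lambda)$ such that every $J\in\mathrm{NS}(\Lambda)$ with $J\subset I$ lies in $\mathcal B_w(\Lambda)$. Solutions. $\mathrm{Sol}^{\mathrm{dir}}_{w,\Lambda}(H_A(\beta))$ is the set of $\varphi\in\mathscr F^{\log}_{\widetilde\Lambda}$ with $\mathrm{Supp}(\varphi)\subset\Lambda$ and $H_A(\beta)\bullet\varphi=0$ such that $\varphi=0$ or $\mathrm{Supp}(\varphi)$ has a $\le_w$-minimum; for $\varphi\neq0$ this minimum is $\mathrm{lexp}_w(\varphi)$. $\mathrm{Sol}^{\mathrm{dir,all}}_{\beta,w}(H_A(\beta))=\bigoplus_{\Lambda\in\mathfrak L_\beta}\mathrm{Sol}^{\mathrm{dir}}_{w,\Lambda}(H_A(\beta))$. $\mathrm{Rexp}_w(\Lambda)=\{\mathrm{lexp}_w(\varphi)\mid0\ne\varphi\in\mathrm{Sol}^{\mathrm{dir}}_{w,\Lambda}(H_A(\beta))\}$.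 Normalization. For $\alpha\in\mathbb C^n$, $\nu\in\mathbb N^n$: $[\partial_y+\alpha]_\nu=\prod_{j=1}^n\prod_{k=0}^{\nu_j-1}(\partial_{y_j}+\alpha_j-k)\in S$. For $\gamma,\gamma'\in\Lambda$: $d_{\gamma'\leftarrow\gamma}=[\partial_y+\gamma]_{(\gamma-\gamma')_+}$, which is divisible by $\partial_y^{\mathrm{nsupp}(\gamma')\setminus\mathrm{nsupp}(\gamma)}$ in $S$; $\widetilde d_{\gamma'\leftarrow\gamma}=d_{\gamma'\leftarrow\gamma}/\partial_y^{\mathrm{nsupp}(\gamma')\setminus\mathrm{nsupp}(\gamma)}$, which acts bijectively on $\mathbb C[y]$. Given a reference vector $\lambda\in\Lambda$ and $\varphi=\sum_{\gamma\in\Lambda}x^\gamma r_\gamma(\log x)$, the normalized coefficients are $c^{(\lambda)}_\gamma=(\widetilde d_{\gamma\leftarrow\lambda}\bullet)^{-1}(\widetilde d_{\lambda\leftarrow\gamma}\bullet r_\gamma)$. For $\varphi\in\mathrm{Sol}^{\mathrm{dir}}_{w,\Lambda}(H_A(\beta))$ they depend only on $\mathrm{nsupp}(\gamma)$. Coefficient space and module. $\mathrm{Coeff}^{\mathrm{dir}}_w(\Lambda)$ is the space of families $(c_{\Lambda,I})_{I\in\mathrm{NS}(\Lambda)}$ in $\mathbb C[y]$ with $(A\partial_y)_i\bullet c_{\Lambda,I}=0$ for all $I,i$; $\partial_y^{J\setminus I}\bullet c_{\Lambda,I}=\partial_y^{I\setminus J}\bullet c_{\Lambda,J}$ for all $I,J\in\mathrm{NS}(\Lambda)$;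 and $c_{\Lambda,I}=0$ for $I\notin\mathcal A_w(\Lambda)$. $M^{\mathrm{dir}}_{\Lambda,w}$ is the quotient of the free $S$-module $F_\Lambda=\bigoplus_{I\in\mathrm{NS}(\Lambda)}Se^*_{\Lambda,I}$ by the submodule generated by all $(A\partial_y)_ie^*_{\Lambda,I}$, all $\partial_y^{J\setminus I}e^*_{\Lambda,I}-\partial_y^{I\setminus J}e^*_{\Lambda,J}$, and all $e^*_{\Lambda,K}$ with $K\in\mathrm{NS}(\Lambda)\setminus\mathcal A_w(\Lambda)$; $\overline e^*_{\Lambda,I}$ is the class of $e^*_{\Lambda,I}$. $M^{\mathrm{dir,all}}_{\beta,w}=\bigoplus_{\Lambda\in\mathfrak L_\beta}M^{\mathrm{dir}}_{\Lambda,w}$. Realizability data. For $K\in\mathcal A_w(\Lambda)$: $\pi_{\Lambda,K}:\mathrm{Coeff}^{\mathrm{dir}}_w(\Lambda)\to\mathbb C[y]$, $(c_{\Lambda,J})_J\mapsto c_{\Lambda,K}$; $\mathcal A^{<K}_w(\Lambda)=\{J\in\mathcal A_w(\Lambda)\mid v_{\Lambda,J}<_wv_{\Lambda,K}\}$; $\pi_{\Lambda,<K}=\bigoplus_{J\in\mathcal A^{<K}_w(\Lambda)}\pi_{\Lambda,J}$ (the zero map to the zero space if the index set is empty). $\mathfrak e_A=\langle(A\partial_y)_i\mid1\le i\le d\rangle\subset S$, $\mathfrak M_\Lambda=\langle\partial_y^I\mid I\in\mathrm{NS}(\Lambda)\rangle\subset S$, $\mathfrak P^{<K}_{\Lambda,w}=\langle\partial_y^J\mid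 J\in(\mathrm{NS}(\Lambda)\setminus\mathcal A_w(\Lambda))\cup\mathcal A^{<K}_w(\Lambda)\rangle\subset S$, $\mathfrak Q^{<K}_{\Lambda,w}=\mathfrak e_A\mathfrak M_\Lambda+\mathfrak P^{<K}_{\Lambda,w}$. *)

(* Defs.v *)
From HB Require Import structures.
From mathcomp Require Import all_boot all_order all_algebra.
From mathcomp Require Import boolp classical_sets functions cardinality fsbigop.
From mathcomp Require Import reals complex mpoly.

Set Implicit Arguments.
Unset Strict Implicit.
Unset Printing Implicit Defensive.

Import Order.TTheory GRing.Theory Num.Theory.

Local Open Scope classical_set_scope.
Local Open Scope quotient_scope.
Local Open Scope ring_scope.

Definition submodule (R : pzRingType) (U : lmodType R) (N : set U) : Prop :=
  submod_closed (mem N).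

Definition lspan (R : pzRingType) (U : lmodType R) (G : set U) : set U :=
  smallest (@submodule R U) G.

Lemma lspan_submodule (R : pzRingType) (U : lmodType R) (G : set U) :
  submodule (lspan G).
Proof.
split; first by rewrite inE => N [[/set_mem]].
move=> a u v /set_mem uG /set_mem vG; rewrite inE => N [sN GN].
by apply/set_mem; apply: (sN.2); apply/mem_set; [exact: uG | exact: vG].
Qed.

Section QuotientModule.
Variables (R : nzRingType) (U : lmodType R) (G : set U).

Definition lspan_pred : {pred U} := mem (lspan G).

HB.instance Definition _ :=
  GRing.isSubmodClosed.Build R U lspan_pred
    (GRing.submod_closed_semi (@lspan_submodule R U G)).

(* The quotient of U by the submodule generated by G. *)
Definition quotmod := Quotient.quot lspan_pred.
HB.instance Definition _ := GRing.Zmodule.on quotmod.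
Definition to_quotmod (u : U) : quotmod := \pi_(Quotient.quot lspan_pred) u.

Definition quotmod_scale (a : R) (x : quotmod) : quotmod :=
  to_quotmod (a *: (repr x : U)).

Lemma to_quotmodK (x : quotmod) : to_quotmod (repr x) = x.
Proof. exact: reprK. Qed.

Lemma to_quotmodD : {morph to_quotmod : u v / u + v}.
Proof. exact: raddfD. Qed.

Lemma to_quotmodP u v : to_quotmod u = to_quotmod v <-> lspan G (u - v).
Proof.
have -> : lspan G (u - v) <-> (u - v) \in lspan_pred.
  by split=> [/mem_set|/set_mem].
rewrite /to_quotmod (Quotient.idealrBE lspan_pred).
by split=> [->|/eqP].
Qed.

Lemma to_quotmodZ a u : to_quotmod (a *: u) = quotmod_scale a (to_quotmod u).
Proof.
apply/to_quotmodP; rewrite -scalerBr.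
have /to_quotmodP/mem_set h : to_quotmod u = to_quotmod (repr (to_quotmod u)).
  by rewrite to_quotmodK.
by apply/set_mem; apply: (@rpredZ _ _ lspan_pred).
Qed.

Fact quotmod_scaleA a b x :
  quotmod_scale a (quotmod_scale b x) = quotmod_scale (a * b) x.
Proof. by rewrite -(to_quotmodK x) -!to_quotmodZ scalerA. Qed.

Fact quotmod_scale1 : left_id 1 quotmod_scale.
Proof. by move=> x; rewrite -(to_quotmodK x) -to_quotmodZ scale1r. Qed.

Fact quotmod_scaleDr : right_distributive quotmod_scale +%R.
Proof.
move=> a x y; rewrite -(to_quotmodK x) -(to_quotmodK y).
by rewrite -to_quotmodD -!to_quotmodZ scalerDr to_quotmodD.
Qed.

Fact quotmod_scaleDl x : {morph quotmod_scale^~ x : a b / a + b}.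
Proof.
by move=> a b; rewrite -(to_quotmodK x) -!to_quotmodZ scalerDl to_quotmodD.
Qed.

HB.instance Definition _ := GRing.Zmodule_isLmodule.Build R quotmod
  quotmod_scaleA quotmod_scale1 quotmod_scaleDr quotmod_scaleDl.

End QuotientModule.

Section DirectSum.
Variables (R : pzRingType) (J : Type) (M : J -> lmodType R).

Record dsum := DSum {
  dsum_val :> forall j, M j;
  dsum_fin : finite_set [set j | dsum_val j != 0]
}.

Lemma dsum_inj (f g : dsum) : (forall j, f j = g j) -> f = g.
Proof.
case: f g => [f0 ff] [g0 fg] /= fgE.
have E : f0 = g0 by apply: functional_extensionality_dep.
by case: _ / E fg => fg; congr DSum; exact: Prop_irrelevance.
Qed.

HB.instance Definition _ := gen_eqMixin dsum.
HB.instance Definition _ := gen_choiceMixin dsum.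

Fact dsum0_fin : finite_set [set j | (0 : M j) != 0].
Proof. by rewrite (_ : mkset _ = set0) // -subset0 => j /=; rewrite eqxx. Qed.
Definition dsum0 := @DSum (fun=> 0) dsum0_fin.

Fact dsumD_fin (f g : dsum) : finite_set [set j | f j + g j != 0].
Proof.
apply: (@sub_finite_set _ _ ([set j | f j != 0] `|` [set j | g j != 0])).
  move=> j /=; case: (eqVneq (f j) 0) => [->|]; last by left.
  by rewrite add0r; right.
by rewrite finite_setU; split; exact: dsum_fin.
Qed.
Definition dsumD (f g : dsum) := @DSum (fun j => f j + g j) (dsumD_fin f g).

Fact dsumN_fin (f : dsum) : finite_set [set j | - f j != 0].
Proof.
by apply: sub_finite_set (dsum_fin f) => j /=; rewrite oppr_eq0.
Qed.
Definition dsumN (f : dsum) := @DSum (fun j => - f j) (dsumN_fin f).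

Fact dsumZ_fin a (f : dsum) : finite_set [set j | a *: f j != 0].
Proof.
apply: sub_finite_set (dsum_fin f) => j /=; apply: contra_neq => ->.
exact: scaler0.
Qed.
Definition dsumZ a (f : dsum) := @DSum (fun j => a *: f j) (dsumZ_fin a f).

Fact dsumA : associative dsumD.
Proof. by move=> f g h; apply: dsum_inj => j /=; rewrite addrA. Qed.
Fact dsumC : commutative dsumD.
Proof. by move=> f g; apply: dsum_inj => j /=; rewrite addrC. Qed.
Fact dsum0D : left_id dsum0 dsumD.
Proof. by move=> f; apply: dsum_inj => j /=; rewrite add0r. Qed.
Fact dsumND : left_inverse dsum0 dsumN dsumD.
Proof. by move=> f; apply: dsum_inj => j /=; rewrite addNr. Qed.
HB.instance Definition _ :=
  GRing.isZmodule.Build dsum dsumA dsumC dsum0D dsumND.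

Fact dsumZA a b f : dsumZ a (dsumZ b f) = dsumZ (a * b) f.
Proof. by apply: dsum_inj => j /=; rewrite scalerA. Qed.
Fact dsumZ1 : left_id 1 dsumZ.
Proof. by move=> f; apply: dsum_inj => j /=; rewrite scale1r. Qed.
Fact dsumZDr : right_distributive dsumZ +%R.
Proof. by move=> a f g; apply: dsum_inj => j /=; rewrite scalerDr. Qed.
Fact dsumZDl f : {morph dsumZ^~ f : a b / a + b}.
Proof. by move=> a b; apply: dsum_inj => j /=; rewrite scalerDl. Qed.
HB.instance Definition _ := GRing.Zmodule_isLmodule.Build R dsum
  dsumZA dsumZ1 dsumZDr dsumZDl.

End DirectSum.

(* M has a composition series 0 = N_0 < N_1 < ... < N_k = M; simplicity of    *)
(* N_{i+1}/N_i is the absence of a submodule strictly between N_i and N_{i+1}.*)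
Definition has_length (R : pzRingType) (M : lmodType R) (k : nat) : Prop :=
  exists N : nat -> set M,
    [/\ N 0%N = [set 0], N k = setT,
        forall i, (i <= k)%N -> submodule (N i) &
        forall i, (i < k)%N -> N i `<` N i.+1 /\
          forall P, submodule P -> N i `<=` P -> P `<=` N i.+1 ->
            P = N i \/ P = N i.+1].

Definition finite_length (R : pzRingType) (M : lmodType R) : Prop :=
  exists k, has_length M k.

(* Equal to 0 by convention when M does not have finite length. *)
Definition mod_length (R : pzRingType) (M : lmodType R) : nat :=
  xget 0%N [set k | has_length M k].

Definition has_dim (K : fieldType) (U : lmodType K) (V : set U) (k : nat) :
    Prop :=
  exists b : 'I_k -> U,
    (forall a : 'I_k -> K, \sum_(i < k) a i *: b i = 0 -> forall i, a i = 0) /\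
    V = lspan (range b).

(* f restricts to a K-linear isomorphism of the subspace P onto the subspace  *)
(* Q.                                                                         *)
Definition linear_iso_on (K : fieldType) (U V : lmodType K)
    (P : set U) (Q : set V) (f : U -> V) : Prop :=
  [/\ submodule P, submodule Q,
      forall a u v, P u -> P v -> f (a *: u + v) = a *: f u + f v &
      set_bij P Q f].

Definition ideal_gen (S : comNzRingType) (G : set S) : set S :=
  @lspan S S^o G.
Definition ideal_add (S : comNzRingType) (I J : set S) : set S :=
  [set a + b | a in I & b in J].
Definition ideal_mul (S : comNzRingType) (I J : set S) : set S :=
  ideal_gen [set a * b | a in I & b in J].
Definition ideal_colon (S : comNzRingType) (I : set S) (t : S) : set S :=
  [set s | I (s * t)].

Section WeylAlgebra.
Variables (K : fieldType) (n : nat).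

Inductive wexpr :=
  | WC of K | WX of 'I_n | WD of 'I_n | WAdd of wexpr & wexpr
  | WMul of wexpr & wexpr.

Inductive weq : wexpr -> wexpr -> Prop :=
  | weq_refl P : weq P P
  | weq_sym P Q : weq P Q -> weq Q P
  | weq_trans Q P T : weq P Q -> weq Q T -> weq P T
  | weq_add P P' Q Q' : weq P P' -> weq Q Q' -> weq (WAdd P Q) (WAdd P' Q')
  | weq_mul P P' Q Q' : weq P P' -> weq Q Q' -> weq (WMul P Q) (WMul P' Q')
  | weq_addA P Q T : weq (WAdd P (WAdd Q T)) (WAdd (WAdd P Q) T)
  | weq_addC P Q : weq (WAdd P Q) (WAdd Q P)
  | weq_add0 P : weq (WAdd (WC 0) P) P
  | weq_addN P : weq (WAdd (WMul (WC (-1)) P) P) (WC 0)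
  | weq_mulA P Q T : weq (WMul P (WMul Q T)) (WMul (WMul P Q) T)
  | weq_mul1l P : weq (WMul (WC 1) P) P
  | weq_mul1r P : weq (WMul P (WC 1)) P
  | weq_mulDl P Q T : weq (WMul (WAdd P Q) T) (WAdd (WMul P T) (WMul Q T))
  | weq_mulDr P Q T : weq (WMul P (WAdd Q T)) (WAdd (WMul P Q) (WMul P T))
  | weq_constD a b : weq (WC (a + b)) (WAdd (WC a) (WC b))
  | weq_constM a b : weq (WC (a * b)) (WMul (WC a) (WC b))
  | weq_constC a P : weq (WMul (WC a) P) (WMul P (WC a))
  | weq_xx i j : weq (WMul (WX i) (WX j)) (WMul (WX j) (WX i))
  | weq_dd i j : weq (WMul (WD i) (WD j)) (WMul (WD j) (WD i))
  | weq_dx i j :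
      weq (WMul (WD i) (WX j)) (WAdd (WMul (WX j) (WD i)) (WC (i == j)%:R)).

HB.instance Definition _ := gen_eqMixin wexpr.
HB.instance Definition _ := gen_choiceMixin wexpr.

Definition weqb (P Q : wexpr) : bool := `[< weq P Q >].

Fact weqb_equiv : equiv_class_of weqb.
Proof.
split=> [P|P Q|Q P T].
- exact/asboolP/weq_refl.
- by apply/asboolP/asboolP; exact: weq_sym.
- by move=> /asboolP PQ /asboolP QT; apply/asboolP; exact: weq_trans PQ QT.
Qed.
Canonical weqb_equiv_rel := EquivRelPack weqb_equiv.
Canonical weqb_encModRel := defaultEncModRel weqb.

Definition weyl := {eq_quot weqb}.
HB.instance Definition _ := Choice.on weyl.

Definition to_weyl (P : wexpr) : weyl := \pi_{eq_quot weqb} P.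

Lemma to_weylK (P : weyl) : to_weyl (repr P) = P.
Proof. exact: reprK. Qed.

Lemma to_weylP P Q : to_weyl P = to_weyl Q <-> weq P Q.
Proof.
rewrite /to_weyl; split=> [/eqP|PQ].
  by rewrite eqmodE => /asboolP.
by apply/eqP; rewrite eqmodE; apply/asboolP.
Qed.

Lemma repr_to_weyl P : weq (repr (to_weyl P)) P.
Proof. by apply/to_weylP; rewrite to_weylK. Qed.

Definition weyl_const (c : K) : weyl := to_weyl (WC c).
Definition weyl_x (j : 'I_n) : weyl := to_weyl (WX j).
Definition weyl_d (j : 'I_n) : weyl := to_weyl (WD j).
Definition weyl_add (P Q : weyl) : weyl := to_weyl (WAdd (repr P) (repr Q)).
Definition weyl_mul (P Q : weyl) : weyl := to_weyl (WMul (repr P) (repr Q)).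
Definition weyl_opp (P : weyl) : weyl := weyl_mul (weyl_const (-1)) P.

Lemma to_weylD P Q : to_weyl (WAdd P Q) = weyl_add (to_weyl P) (to_weyl Q).
Proof.
by apply/to_weylP/weq_sym; apply: weq_add; exact: repr_to_weyl.
Qed.

Lemma to_weylM P Q : to_weyl (WMul P Q) = weyl_mul (to_weyl P) (to_weyl Q).
Proof.
by apply/to_weylP/weq_sym; apply: weq_mul; exact: repr_to_weyl.
Qed.

Fact weyl_addA : associative weyl_add.
Proof.
move=> P Q T; rewrite -(to_weylK P) -(to_weylK Q) -(to_weylK T) -!to_weylD.
exact/to_weylP/weq_addA.
Qed.
Fact weyl_addC : commutative weyl_add.
Proof.
move=> P Q; rewrite -(to_weylK P) -(to_weylK Q) -!to_weylD.
exact/to_weylP/weq_addC.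
Qed.
Fact weyl_add0 : left_id (weyl_const 0) weyl_add.
Proof.
by move=> P; rewrite -(to_weylK P) -to_weylD; exact/to_weylP/weq_add0.
Qed.
Fact weyl_addN : left_inverse (weyl_const 0) weyl_opp weyl_add.
Proof.
move=> P; rewrite -(to_weylK P) /weyl_opp -to_weylM -to_weylD.
exact/to_weylP/weq_addN.
Qed.
HB.instance Definition _ :=
  GRing.isZmodule.Build weyl weyl_addA weyl_addC weyl_add0 weyl_addN.

Fact weyl_mulA : associative weyl_mul.
Proof.
move=> P Q T; rewrite -(to_weylK P) -(to_weylK Q) -(to_weylK T) -!to_weylM.
exact/to_weylP/weq_mulA.
Qed.
Fact weyl_mul1l : left_id (weyl_const 1) weyl_mul.
Proof.
by move=> P; rewrite -(to_weylK P) -to_weylM; exact/to_weylP/weq_mul1l.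
Qed.
Fact weyl_mul1r : right_id (weyl_const 1) weyl_mul.
Proof.
by move=> P; rewrite -(to_weylK P) -to_weylM; exact/to_weylP/weq_mul1r.
Qed.
Fact weyl_mulDl : left_distributive weyl_mul weyl_add.
Proof.
move=> P Q T; rewrite -(to_weylK P) -(to_weylK Q) -(to_weylK T).
by rewrite -!(to_weylM, to_weylD); exact/to_weylP/weq_mulDl.
Qed.
Fact weyl_mulDr : right_distributive weyl_mul weyl_add.
Proof.
move=> P Q T; rewrite -(to_weylK P) -(to_weylK Q) -(to_weylK T).
by rewrite -!(to_weylM, to_weylD); exact/to_weylP/weq_mulDr.
Qed.
HB.instance Definition _ := GRing.Zmodule_isPzRing.Build weyl
  weyl_mulA weyl_mul1l weyl_mul1r weyl_mulDl weyl_mulDr.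

Definition weyl_theta (j : 'I_n) : weyl := weyl_x j * weyl_d j.

End WeylAlgebra.

(* A family phi : K^n -> K[y] stands for the formal logarithmic series        *)
(* sum_gamma x^gamma (phi gamma)(log x).                                      *)
Notation fseries K n := ('cV[K]_n -> {mpoly K[n]}).

Section FormalSeries.
Variables (K : fieldType) (n : nat).

Definition evec (j : 'I_n) : 'cV[K]_n := delta_mx j 0.

Fixpoint wexpr_act (P : wexpr K n) (phi : fseries K n) : fseries K n :=
  match P with
  | WC c => c *: phi
  | WX j => fun gam => phi (gam - evec j)
  | WD j => fun gam =>
      (gam + evec j) j 0 *: phi (gam + evec j) + mderiv j (phi (gam + evec j))
  | WAdd P Q => wexpr_act P phi + wexpr_act Q phi
  | WMul P Q => wexpr_act P (wexpr_act Q phi)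
  end.

Definition weyl_act (P : weyl K n) (phi : fseries K n) : fseries K n :=
  wexpr_act (repr P) phi.

Lemma wexpr_act_linear P : linear (wexpr_act P).
Proof.
elim: P => [c|j|j|P IHP Q IHQ|P IHP Q IHQ] a phi psi; apply/funext => g /=.
- by rewrite scalerDr !scalerA mulrC.
- by [].
- rewrite mderivD mderivZ scalerDr !scalerA [_ * a]mulrC -scalerA addrACA.
  by rewrite -scalerDr.
- by rewrite IHP IHQ scalerDr addrACA.
- by rewrite IHQ IHP.
Qed.

Lemma wexpr_actD P : {morph wexpr_act P : phi psi / phi + psi}.
Proof.
by move=> phi psi; have := wexpr_act_linear P 1 phi psi; rewrite !scale1r.
Qed.

Lemma wexpr_act0 P : wexpr_act P 0 = 0.
Proof. by apply: (@addrI _ (wexpr_act P 0)); rewrite -wexpr_actD !addr0. Qed.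

Lemma wexpr_actZ P a phi : wexpr_act P (a *: phi) = a *: wexpr_act P phi.
Proof. by have := wexpr_act_linear P a phi 0; rewrite wexpr_act0 !addr0. Qed.

Lemma weq_act P Q : weq P Q -> wexpr_act P =1 wexpr_act Q.
Proof.
elim: P Q / => /=.
- by [].
- by move=> P Q _ PQ phi; rewrite PQ.
- by move=> Q P T _ PQ _ QT phi; rewrite PQ QT.
- by move=> P P' Q Q' _ PP' _ QQ' phi; rewrite PP' QQ'.
- by move=> P P' Q Q' _ PP' _ QQ' phi; rewrite QQ' PP'.
- by move=> P Q T phi; rewrite addrA.
- by move=> P Q phi; rewrite addrC.
- by move=> P phi; rewrite scale0r add0r.
- by move=> P phi; rewrite scaleN1r addNr scale0r.
- by [].
- by move=> P phi; rewrite scale1r.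
- by move=> P phi; rewrite scale1r.
- by [].
- by move=> P Q T phi; rewrite wexpr_actD.
- by move=> a b phi; rewrite scalerDl.
- by move=> a b phi; rewrite scalerA.
- by move=> a P phi; rewrite wexpr_actZ.
- by move=> i j phi; apply/funext => g /=; rewrite addrAC.
- move=> i j phi; apply/funext => g /=.
  have [->//|ij] := eqVneq i j.
  rewrite !mxE !eqxx [j == i]eq_sym !(negbTE ij) /= !addr0.
  rewrite [g + evec j + evec i]addrAC.
  set p := phi _; rewrite !mderivD !mderivZ !scalerDr !scalerA addrACA.
  by rewrite [(g j 0 + 1) * _]mulrC [mderiv i (mderiv j p)]mderiv_comm.
- move=> i j phi; apply/funext => g /=.
  rewrite [RHS](_ : _ = (g - evec j + evec i) i 0 *: phi (g - evec j + evec i) +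
    mderiv i (phi (g - evec j + evec i)) + (i == j)%:R *: phi g) //.
  rewrite [g - evec j + evec i]addrAC; set p := phi (g + evec i - evec j).
  have -> : (i == j)%:R *: phi g = (i == j)%:R *: p.
    by rewrite /p; case: (eqVneq i j) => [->|]; rewrite ?addrK // !scale0r.
  rewrite [RHS]addrAC -scalerDl; congr (_ *: _ + _).
  by rewrite !mxE !eqxx /= andbT subrK.
Qed.

Lemma weyl_act_to_weyl P phi : weyl_act (to_weyl P) phi = wexpr_act P phi.
Proof. exact/weq_act/repr_to_weyl. Qed.

Lemma weyl_actM P Q phi : weyl_act (P * Q) phi = weyl_act P (weyl_act Q phi).
Proof.
have -> : P * Q = to_weyl (WMul (repr P) (repr Q)) by [].
by rewrite weyl_act_to_weyl.
Qed.

Lemma weyl_actD P Q phi :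
  weyl_act (P + Q) phi = weyl_act P phi + weyl_act Q phi.
Proof.
have -> : P + Q = to_weyl (WAdd (repr P) (repr Q)) by [].
by rewrite weyl_act_to_weyl.
Qed.

Fact weyl_oner_neq0 : (1 : weyl K n) != 0.
Proof.
apply/eqP => /(congr1 (fun P => weyl_act P (fun=> 1) 0)).
rewrite -[1]/(to_weyl (WC n 1)) -[0 in RHS]/(to_weyl (WC n 0)).
rewrite !weyl_act_to_weyl /= scale1r scale0r => /eqP.
by rewrite oner_eq0.
Qed.
HB.instance Definition _ :=
  GRing.PzSemiRing_isNonZero.Build (weyl K n) weyl_oner_neq0.

(* The inclusion of K[d_x] into the Weyl algebra. *)
Definition weyl_of_dpoly (p : {mpoly K[n]}) : weyl K n :=
  mmap (@weyl_const K n) (@weyl_d K n) p.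

(* The action of S = K[d_y] on K[y]: 'X_j in S acts as d/dy_j. *)
Definition dact (s p : {mpoly K[n]}) : {mpoly K[n]} :=
  \sum_(m <- msupp s) s@_m *: mderivm m p.

Definition dact_inv (s p : {mpoly K[n]}) : {mpoly K[n]} :=
  xget 0 [set q | dact s q = p].

End FormalSeries.

Section Hypergeometric.
Variables (R : realType) (d n : nat).
Local Notation C := R[i].
Local Notation Cn := 'cV[C]_n.
(* The same type serves for S = C[d_y], where 'X_j is the symbol d/dy_j, and  *)
(* for C[y], where 'X_j is the variable y_j.                                  *)
Local Notation S := {mpoly C[n]}.
Local Notation Cy := {mpoly C[n]}.

Implicit Types (A : 'M[int]_(d, n)) (beta : 'cV[C]_d) (w : 'cV[R]_n).
Implicit Types (Lam Om : set Cn) (gam lam : Cn) (phi : fseries C n).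

Definition kerZ A : set 'cV[int]_n := [set u | A *m u = 0].

Definition exp_lattices A beta : set (set Cn) :=
  [set Lam | exists2 lam : Cn, map_mx intr A *m lam = beta &
     Lam = [set lam + map_mx intr u | u in kerZ A]].

Definition pos_part (u : 'cV[int]_n) : 'X_{1..n} :=
  [multinom absz (Num.max (u j 0) 0)%R | j < n].

Definition toric_ideal A : set {mpoly C[n]} :=
  ideal_gen [set 'X_[pos_part u] - 'X_[pos_part (- u)] | u in kerZ A].

Definition euler_op A (i : 'I_d) : weyl C n :=
  \sum_(j < n) weyl_theta C j *~ A i j.

(* Submodules of the regular left module of the Weyl algebra are its left     *)
(* ideals.                                                                    *)
Definition hyp_ideal A beta : set (weyl C n) :=
  @lspan (weyl C n) (weyl C n)^o
    ([set weyl_of_dpoly p | p in toric_ideal A] `|`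
     range (fun i : 'I_d => euler_op A i - weyl_const n (beta i 0))).

Definition Supp phi : set Cn := [set gam | phi gam != 0].

Definition log_space Lam : set (fseries C n) :=
  [set phi | Supp phi `<=` [set gam + map_mx intr u | gam in Lam &
                                     u in [set: 'cV[int]_n]]].

Definition nsupp gam : {set 'I_n} :=
  [set j | `[< exists m : nat, gam j 0 = - m.+1%:R >]]%SET.

Definition stratum Lam (I : {set 'I_n}) : set Cn :=
  [set gam | Lam gam /\ nsupp gam = I].

Definition NS Lam : {set {set 'I_n}} := [set I | `[< stratum Lam I !=set0 >]]%SET.

Definition NSidx Lam := {I : {set 'I_n} | I \in NS Lam}.

Definition MinNS Lam : set (NSidx Lam) :=
  [set I : NSidx Lam | minset (mem (NS Lam)) (sval I)].

Definition L_generic A w : Prop :=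
  forall u, kerZ A u -> u != 0 -> \sum_(j < n) w j 0 * (u j 0)%:~R != 0.

(* Only used on differences of elements of one exponent lattice; these have   *)
(* integer entries, hence equal their real parts.                             *)
Definition wdot w gam : R := \sum_(j < n) w j 0 * complex.Re (gam j 0).

Definition wle w gam gam' : Prop := 0 <= wdot w (gam' - gam).
Definition wlt w gam gam' : Prop := wle w gam gam' /\ gam <> gam'.

Definition is_wmin w Om gam : Prop :=
  Om gam /\ forall gam', Om gam' -> wle w gam gam'.
Definition wmin w Om : Cn := xget 0 [set gam | is_wmin w Om gam].

Definition wbounded_below w Lam Om : Prop :=
  exists2 lam, Lam lam & exists b : R,
    forall gam, Om gam -> b <= wdot w (gam - lam).

Definition Bw w Lam : set (NSidx Lam) :=
  [set I : NSidx Lam | wbounded_below w Lam (stratum Lam (sval I))].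

Definition vmin w Lam (I : NSidx Lam) : Cn := wmin w (stratum Lam (sval I)).

Definition Mw w Lam : set (NSidx Lam) := @MinNS Lam `&` @Bw w Lam.

Definition adm_lattices A beta w : set (set Cn) :=
  [set Lam | exp_lattices A beta Lam /\ @Mw w Lam !=set0].

Definition acc w Lam : set (NSidx Lam) :=
  [set I : NSidx Lam | forall J : NSidx Lam, sval J \subset sval I -> @Bw w Lam J].

Definition acc_lt w Lam (K : NSidx Lam) : set (NSidx Lam) :=
  [set J | @acc w Lam J /\ wlt w (vmin w J) (vmin w K)].

Definition Sol A beta w Lam : set (fseries C n) :=
  [set phi | [/\ log_space Lam phi, Supp phi `<=` Lam,
     forall P, hyp_ideal A beta P -> weyl_act P phi = 0 &
     phi = 0 \/ exists gam, is_wmin w (Supp phi) gam]].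

Definition lexp w phi : Cn := wmin w (Supp phi).

Definition Rexp A beta w Lam : set Cn :=
  [set lexp w phi | phi in [set phi | Sol A beta w Lam phi /\ phi <> 0]].

Definition Sol_all A beta w : set (exp_lattices A beta -> fseries C n) :=
  [set f : exp_lattices A beta -> fseries C n |
     finite_set [set Lam | f Lam <> 0] /\
     forall Lam : exp_lattices A beta, Sol A beta w (val Lam) (f Lam)].

(* In d_op gam' gam and dt_op gam' gam (the operators gam' <- gam) the target *)
(* gam' comes first and the source gam second.                                *)
Definition dmon (J : {set 'I_n}) : S := \prod_(j in J) 'X_j.

Definition bracket gam (nu : 'X_{1..n}) : S :=
  \prod_(j < n) \prod_(k < nu j) ('X_j + (gam j 0 - k%:R)%:MP).

(* The positive part of gam - gam', for gam - gam' with integer entries. *)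
Definition diff_pos gam gam' : 'X_{1..n} :=
  [multinom Num.trunc (complex.Re (gam j 0 - gam' j 0))%R | j < n].

Definition d_op gam' gam : S := bracket gam (diff_pos gam gam').

Definition dt_op gam' gam : S :=
  xget 0 [set q | q * dmon (nsupp gam' :\: nsupp gam) = d_op gam' gam].

Definition norm_coeff lam phi gam : Cy :=
  dact_inv (dt_op gam lam) (dact (dt_op lam gam) (phi gam)).

Definition normalize lam Lam phi : {ffun NSidx Lam -> Cy} :=
  [ffun I => xget 0 [set c | forall gam, stratum Lam (sval I) gam ->
                       norm_coeff lam phi gam = c]].

Definition realize lam Lam (c : {ffun NSidx Lam -> Cy}) : fseries C n :=
  fun gam => \sum_(I : NSidx Lam | gam \in stratum Lam (sval I))
    dact_inv (dt_op lam gam) (dact (dt_op gam lam) (c I)).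

Definition eulerS A (i : 'I_d) : S := \sum_(j < n) 'X_j *~ A i j.

Definition Coeff A w Lam : set {ffun NSidx Lam -> Cy} :=
  [set c | [/\ forall I i, dact (eulerS A i) (c I) = 0,
     forall I J, dact (dmon (sval J :\: sval I)) (c I) =
                 dact (dmon (sval I :\: sval J)) (c J) &
     forall I, ~ @acc w Lam I -> c I = 0]].

Definition Ffree Lam := {ffun NSidx Lam -> S^o}.

Definition estar Lam (I : NSidx Lam) : Ffree Lam := [ffun J => (J == I)%:R].

Definition Mrel A w Lam : set (Ffree Lam) :=
  [set eulerS A i *: estar I | i in [set: 'I_d] & I in [set: NSidx Lam]] `|`
  [set dmon (sval J :\: sval I) *: estar I - dmon (sval I :\: sval J) *: estar J |
     I in [set: NSidx Lam] & J in [set: NSidx Lam]] `|`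
  [set estar I | I in ~` @acc w Lam].

Definition Mdir A w Lam := quotmod (@Mrel A w Lam).

Definition ebar A w Lam (I : NSidx Lam) : Mdir A w Lam :=
  to_quotmod (@Mrel A w Lam) (estar I).

Definition Mdir_all A beta w :=
  dsum (fun Lam : exp_lattices A beta => Mdir A w (val Lam)).

(* Hom_S(M, C[y]), with S acting on C[y] by differentiation. *)
Definition HomS (M : lmodType S) : set (M -> Cy) :=
  [set f | linear_for (@dact C n) f].

Definition eval_gen A w Lam (f : Mdir A w Lam -> Cy) : {ffun NSidx Lam -> Cy} :=
  [ffun I => f (ebar A w I)].

Definition proj Lam (K : NSidx Lam) (c : {ffun NSidx Lam -> Cy}) : Cy := c K.

Definition proj_lt w Lam (K : NSidx Lam) (c : {ffun NSidx Lam -> Cy}) :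
    acc_lt w K -> Cy :=
  fun J => proj (val J) c.

Definition Ker A w Lam (V : zmodType) (f : {ffun NSidx Lam -> Cy} -> V) :
    set {ffun NSidx Lam -> Cy} :=
  [set c | Coeff A w c /\ f c = 0].

Definition idealE A : set S := ideal_gen (range (eulerS A)).
Definition idealM Lam : set S :=
  ideal_gen (range (fun I : NSidx Lam => dmon (sval I))).
Definition idealP w Lam (K : NSidx Lam) : set S :=
  ideal_gen [set dmon (sval J) | J in ~` @acc w Lam `|` acc_lt w K].
Definition idealQ A w Lam (K : NSidx Lam) : set S :=
  ideal_add (ideal_mul (idealE A) (idealM Lam)) (idealP w K).

End Hypergeometric.

Arguments MinNS {R n} Lam _.
Arguments Bw {R n} w Lam _.
Arguments Mw {R n} w Lam _.
Arguments acc {R n} w Lam _.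
Arguments Coeff {R d n} A w Lam _.
Arguments Mrel {R d n} A w Lam _.
Arguments Sol_all {R d n} A beta w _.
Arguments HomS {R n} M _.
Arguments ebar {R d n} A w Lam I.
Arguments eval_gen {R d n} A w Lam f.
Arguments normalize {R n} lam Lam phi.
Arguments proj {R n Lam} K c.
Arguments proj_lt {R n} w {Lam} K c _.
Arguments Ker {R d n} A w {Lam V} f _.
Arguments dmon R {n} J.

(* Main.v *)
Require Import Defs.
From HB Require Import structures.
From mathcomp Require Import all_boot all_order all_algebra.
From mathcomp Require Import boolp classical_sets functions cardinality fsbigop.
From mathcomp Require Import finmap reals complex ssrcomplements mpoly zify ring lra.

Set Implicit Arguments.
Unset Strict Implicit.
Unset Printing Implicit Defensive.

Import Order.TTheory GRing.Theory Num.Theory.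

Local Open Scope classical_set_scope.
Local Open Scope ring_scope.

(** The equations of H_A(beta) couple only exponents of one lattice Lam. For a
    series with coefficients r_gam they say that every r_gam is killed by the
    Euler forms (A d_y)_i and that d_op gam' gam . r_gam = d_op gam gam' . r_gam'
    for all gam, gam' in Lam ([hyp_ideal_eqs]). Up to a monomial d^J, the operator
    d_op is an operator dt_op with nonzero constant term, which is invertible on
    C[y] because differentiation lowers degrees. The operators dt_op satisfy the
    cocycle identity of a quotient of Gamma functions ([dt_op_cocycle]). So the
    normalized coefficients c depend only on the negative support I of gam, and
    the equations become d^(J - I) c_I = d^(I - J) c_J ([norm_coeff_toric]).

    If c_I is nonzero, the equation for J contained in I makes c_J nonzero, and the
    support of the series is the union of the strata with c_I nonzero. Bounded
    strata have a minimum by Dickson's lemma ([stratum_wmin]). Hence the support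
    has a lowest exponent exactly when c vanishes outside the acceptable supports
    ([Sol_realize], [realize_Sol]). The solutions are therefore the families in
    Coeff, which are the homomorphisms from M^dir to C[y] ([eval_gen_iso]). A
    nonzero family exists as soon as some minimal negative support is bounded: take
    1 there and 0 elsewhere ([indicator_Coeff]). Conversely an acceptable support
    contains a minimal one, which is bounded ([acc_Mw]).

    The monomials of degree greater than n kill M^dir ([Mrel_monomial]): a nonzero
    vector of L supported on a set F leads, in one direction, into an unbounded
    stratum, whose negative support J is not acceptable, so that the monomial
    d^(J - I) on F kills e_I; if there is no such vector, the Euler forms express
    each variable of F through variables outside F. So M^dir is finite dimensional
    over C and supported at the origin. For such a module M a composition series is
    a complete flag of C-subspaces ([comp_series_kbasis]), and
    f |-> f(.)(0) identifies Hom_S(M, C[y]) with the C-dual of M, the inverse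
    being an exponential series ([exp_functional_HomS]). This gives the equality of
    dimension and length ([HomS_has_dim]), which then adds up over the lattices.

    A bounded stratum also makes A injective on the vectors vanishing at the
    integral coordinates E of the lattice, so a lattice is determined by E and by
    residues modulo an integer depending on A and E ([bounded_lattices_finite]);
    there are finitely many.

    The lowest exponent of a series is the least stratum minimum at which c does
    not vanish, so v_K is realizable when some c in Coeff vanishes before K but not
    at K. Such a c gives the functional s d^I |-> s . c_I, which kills the ideal Q
    but not d^K ([realizable_notin_idealQ]); conversely C[y] cogenerates the
    nilpotent modules of finite length, and a homomorphism that does not vanish on
    the class of d^K modulo Q gives such a c ([notin_idealQ_realizable]). *)

(** * Submodules and the action of differential operators *)

Section Submodules.
Variables (R : pzRingType) (U : lmodType R).
Implicit Types N G : set U.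

Lemma submoduleP N :
  submodule N <-> N 0 /\ forall a u v, N u -> N v -> N (a *: u + v).
Proof.
split=> [[N0 NL]|[N0 NL]].
  split=> [|a u v Nu Nv]; first exact: set_mem N0.
  by apply: set_mem; apply: NL; apply: mem_set.
split=> [|a u v /set_mem Nu /set_mem Nv]; first exact: mem_set N0.
by apply: mem_set; exact: NL.
Qed.

Lemma submodule0 N : submodule N -> N 0.
Proof. by case/submoduleP. Qed.

Lemma submoduleD N u v : submodule N -> N u -> N v -> N (u + v).
Proof. by case/submoduleP=> _ NL Nu Nv; rewrite -[u]scale1r; exact: NL. Qed.

Lemma submoduleZ N a u : submodule N -> N u -> N (a *: u).
Proof.
by case/submoduleP=> N0 NL Nu; rewrite -[_ *: _]addr0; exact: NL.
Qed.

Lemma submoduleN N u : submodule N -> N u -> N (- u).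
Proof. by move=> sN Nu; rewrite -scaleN1r; exact: submoduleZ. Qed.

Lemma submoduleB N u v : submodule N -> N u -> N v -> N (u - v).
Proof. by move=> sN Nu Nv; apply: submoduleD => //; exact: submoduleN. Qed.

Lemma submodule_sum N (T : Type) (s : seq T) (P : pred T) (F : T -> U) :
  submodule N -> (forall i, P i -> N (F i)) -> N (\sum_(i <- s | P i) F i).
Proof.
move=> sN NF; apply: (big_ind N) => //; first exact: submodule0.
by move=> u v; exact: submoduleD.
Qed.

Lemma sub_lspan G : G `<=` lspan G.
Proof. by move=> u Gu N [_]; apply. Qed.

Lemma lspan_min N G : submodule N -> G `<=` N -> lspan G `<=` N.
Proof. by move=> sN GN u; apply; split. Qed.

End Submodules.

Section DifferentialAction.
Variables (K : fieldType) (n : nat).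
Local Notation S := {mpoly K[n]}.
Implicit Types (s t p q : S) (m : 'X_{1..n}).

Definition monomial_ext (V : lmodType K) (h : 'X_{1..n} -> V) s : V :=
  \sum_(m <- msupp s) s@_m *: h m.

Lemma monomial_extE (V : lmodType K) (h : 'X_{1..n} -> V) k s : (msize s <= k)%N ->
  monomial_ext h s = \sum_(m : 'X_{1..n < k}) s@_m *: h m.
Proof.
move=> sk; pose I : subFinType _ := 'X_{1..n < k}.
rewrite /monomial_ext (big_mksub I) ?msupp_uniq //=; last first.
  by move=> x /msize_mdeg_lt /leq_trans; apply.
by rewrite big_rmcond //= => j /memN_msupp_eq0 ->; rewrite scale0r.
Qed.

Fact monomial_ext_linear (V : lmodType K) (h : 'X_{1..n} -> V) : linear (monomial_ext h).
Proof.
move=> a s t; pose k := maxn (maxn (msize s) (msize t)) (msize (a *: s + t)).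
rewrite !(@monomial_extE _ _ k) /k ?leq_max ?leqnn ?orbT // scaler_sumr -big_split /=.
by apply: eq_bigr => m _; rewrite mcoeffD mcoeffZ scalerDl scalerA.
Qed.
HB.instance Definition _ (V : lmodType K) (h : 'X_{1..n} -> V) :=
  GRing.isLinear.Build K S V *:%R (monomial_ext h) (monomial_ext_linear h).

Lemma monomial_extX (V : lmodType K) (h : 'X_{1..n} -> V) m : monomial_ext h 'X_[m] = h m.
Proof. by rewrite /monomial_ext msuppX big_seq1 mcoeffX eqxx scale1r. Qed.

Fact dact_linear s : linear (dact s).
Proof.
move=> a p q; rewrite /dact scaler_sumr -big_split /=.
by apply: eq_bigr => m _; rewrite linearP scalerDr !scalerA mulrC.
Qed.
HB.instance Definition _ s := GRing.isLinear.Build K S S *:%R (dact s)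
  (dact_linear s).

Lemma dact_ext s p : dact s p = monomial_ext (fun m => mderivm m p) s.
Proof. by []. Qed.

Lemma dactDl s t p : dact (s + t) p = dact s p + dact t p.
Proof. by rewrite !dact_ext linearD. Qed.
Lemma dactBl s t p : dact (s - t) p = dact s p - dact t p.
Proof. by rewrite !dact_ext linearB. Qed.
Lemma dactZl a s p : dact (a *: s) p = a *: dact s p.
Proof. by rewrite !dact_ext linearZ. Qed.
Lemma dact0l p : dact 0 p = 0.
Proof. by rewrite dact_ext linear0. Qed.
Lemma dact_suml (T : Type) (r : seq T) (P : pred T) (F : T -> S) p :
  dact (\sum_(i <- r | P i) F i) p = \sum_(i <- r | P i) dact (F i) p.
Proof. by rewrite dact_ext linear_sum. Qed.

Lemma dactX m p : dact 'X_[m] p = mderivm m p.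
Proof. exact: monomial_extX. Qed.

Lemma dactXU j p : dact 'X_j p = mderiv j p.
Proof. by rewrite dactX mderivmU1m. Qed.

Lemma dactC c p : dact c%:MP p = c *: p.
Proof.
rewrite -[c%:MP]mulr1 -mpolyC1 mul_mpolyC dactZl mpolyC1 -mpolyX0 dactX.
by rewrite mderivm0m.
Qed.

Lemma dact1 p : dact 1 p = p.
Proof. by rewrite -mpolyC1 dactC scale1r. Qed.

Lemma dactM s t p : dact (s * t) p = dact s (dact t p).
Proof.
elim/mpolyind: s => [|a m s _ _ IHs]; first by rewrite mul0r !dact0l.
rewrite mulrDl !dactDl IHs -scalerAl !dactZl {IHs}; congr (_ *: _ + _).
elim/mpolyind: t => [|b m' t _ _ IHt].
  by rewrite mulr0 !dact0l linear0.
rewrite mulrDr !dactDl linearD /= -IHt -scalerAr !dactZl linearZ /=.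
by rewrite -mpolyXD !dactX addmC mderivmDm.
Qed.

Lemma dact_comm s t p : dact s (dact t p) = dact t (dact s p).
Proof. by rewrite -!dactM mulrC. Qed.

(** A coefficient of [dact s p] in degree e only involves coefficients of p in
    degrees greater than e. *)
Lemma msize_dact_lt s p : s@_0 = 0 -> p != 0 -> (msize (dact s p) < msize p)%N.
Proof.
move=> s0 p0; rewrite ltnNge; apply/negP => le_ps.
have q0 : dact s p != 0.
  by rewrite -msize_poly_eq0 -lt0n; apply: leq_trans le_ps; rewrite lt0n msize_poly_eq0.
have := mlead_supp q0; rewrite mcoeff_msupp => /eqP; apply.
have := mlead_deg q0; move: (mlead _) => m degm.
rewrite /dact linear_sum /= big_seq big1 // => m' sm'.
rewrite mcoeffZ mcoeff_mderivm.
have [m'0|m'0] := eqVneq m' 0%MM; first by rewrite m'0 s0 mul0r.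
rewrite (_ : p@_(m' + m) = 0) ?mul0rn ?mulr0 //.
apply: memN_msupp_eq0; apply: msize_mdeg_ge; rewrite mdegD.
have: (0 < mdeg m')%N by rewrite lt0n mdeg_eq0.
by move: le_ps degm; lia.
Qed.

(** An operator with nonzero constant term is a nonzero scalar plus an operator
    that lowers degrees; this makes it bijective. *)
Lemma dact_bij_inj s : s@_0 != 0 -> injective (dact s).
Proof.
move=> s0; suff inj0 p : dact s p = 0 -> p = 0.
  by move=> p q /eqP; rewrite -subr_eq0 -raddfB => /eqP/inj0/eqP; rewrite subr_eq0 => /eqP.
move=> sp0; apply/eqP; apply/negPn/negP => p0.
have := @msize_dact_lt (s - (s@_0)%:MP) p; rewrite mcoeffB mcoeffC eqxx mulr1 subrr.
move=> /(_ erefl p0); rewrite dactBl sp0 dactC sub0r -scaleNr msizeZ ?oppr_eq0 //.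
by rewrite ltnn.
Qed.

Lemma dact_surj s p : s@_0 != 0 -> exists q, dact s q = p.
Proof.
move=> s0; have [k le_pk] := ubnP (msize p); elim: k => // k IHk in p le_pk *.
have [->|p0] := eqVneq p 0; first by exists 0; rewrite linear0.
pose t := s - (s@_0)%:MP; have t0 : t@_0 = 0.
  by rewrite mcoeffB mcoeffC eqxx mulr1 subrr.
have sE : s = (s@_0)%:MP + t by rewrite addrC subrK.
have [q sq] : exists q, dact s q = dact t ((s@_0)^-1 *: p).
  apply: IHk; rewrite linearZ /=.
  by apply: leq_ltn_trans (msizeZ_le _ _) (leq_trans (msize_dact_lt _ _) _).
exists ((s@_0)^-1 *: p - q).
by rewrite linearB /= sq {1}sE dactDl dactC scalerA divff // scale1r addrK.
Qed.

Lemma dact_invK s p : s@_0 != 0 -> dact s (dact_inv s p) = p.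
Proof.
move=> s0; have [q sq] := dact_surj p s0.
by rewrite /dact_inv; case: xgetP => [r _ //|/(_ q)].
Qed.

Lemma dactK s p : s@_0 != 0 -> dact_inv s (dact s p) = p.
Proof. by move=> s0; apply: (dact_bij_inj s0); rewrite dact_invK. Qed.

Lemma dact_invP s p q : s@_0 != 0 -> dact_inv s p = q <-> p = dact s q.
Proof. by move=> s0; split=> [<-|->]; rewrite ?dact_invK // dactK. Qed.

End DifferentialAction.

(** * Dickson's lemma *)

(** The index of the least value of f beyond N, iterated. *)
Lemma monotone_subsequence (f : nat -> nat) :
  exists g : nat -> nat, {homo g : i j / (i < j)%N} /\
    {homo f \o g : i j / (i <= j)%N}.
Proof.
have exh N : exists i, (N <= i)%N /\ forall j, (N <= j)%N -> (f i <= f j)%N.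
  have exv : exists v, `[< exists2 i, (N <= i)%N & f i = v >].
    by exists (f N); apply/asboolP; exists N.
  case: (ex_minnP exv) => v /asboolP[i Ni <-] min_v; exists i; split=> // j Nj.
  by apply: min_v; apply/asboolP; exists j.
have [h hP] := choice exh.
pose g := fix g k := if k is k'.+1 then h (g k').+1 else h 0%N.
have gS k : (g k < g k.+1)%N by have [] := hP (g k).+1.
have gmono : {homo g : i j / (i < j)%N} by apply: homo_ltn => //; exact: ltn_trans.
exists g; split=> //; apply: homo_leq => // [j i k|k]; first exact: leq_trans.
case: k => [|k] /=.
  by have [_] := hP 0%N; apply.
have [_] := hP (g k).+1; apply.
have [le_h _] := hP (h (g k).+1).+1.
by rewrite (leq_trans _ (ltnW le_h)).
Qed.

(** Extract monotone subsequences one coordinate at a time. *)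
Lemma dickson m (f : nat -> 'I_m -> nat) :
  exists i j, (i < j)%N /\ forall k, (f i k <= f j k)%N.
Proof.
suff [g [gmono fg]] : exists g : nat -> nat, {homo g : i j / (i < j)%N} /\
    forall k, k \in enum 'I_m -> {homo (f^~ k) \o g : i j / (i <= j)%N}.
  exists (g 0%N), (g 1%N); split=> [|k]; first exact: gmono.
  exact: (fg k (mem_enum _ _)).
elim: (enum _) => [|k s [g [gmono fg]]]; first by exists id; split=> //.
have [h [hmono fh]] := monotone_subsequence (f^~ k \o g).
exists (g \o h); split=> [i j ij|l]; first exact/gmono/hmono.
rewrite inE => /orP[/eqP -> //|ls] i j ij /=.
apply: (fg _ ls (h i) (h j)).
by move: ij; rewrite leq_eqVlt => /orP[/eqP->|/hmono/ltnW].
Qed.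

(** * Exponent lattices *)

Section Lattices.
Variables (R : realType) (d n : nat) (A : 'M[int]_(d, n)) (beta : 'cV[R[i]]_d).
Variable w : 'cV[R]_n.
Local Notation C := R[i].
Local Notation Cn := 'cV[C]_n.
Implicit Types (u v : 'cV[int]_n) (gam lam : Cn) (I J : {set 'I_n}).

Definition ivec u : Cn := map_mx intr u.
Definition zdot u : R := \sum_(j < n) w j 0 * (u j 0)%:~R.

Lemma ReD (x y : C) : complex.Re (x + y) = complex.Re x + complex.Re y.
Proof. by case: x y => [a b] [a' b']. Qed.
Lemma ReN (x : C) : complex.Re (- x) = - complex.Re x.
Proof. by case: x => [a b]. Qed.
Lemma Re_int (z : int) : complex.Re (z%:~R : C) = z%:~R.
Proof. by rewrite -(rmorph_int (real_complex R)). Qed.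

Lemma wdotD gam gam' : wdot w (gam + gam') = wdot w gam + wdot w gam'.
Proof.
rewrite /wdot -big_split; apply: eq_bigr => j _ /=.
by rewrite mxE ReD mulrDr.
Qed.
Lemma wdotN gam : wdot w (- gam) = - wdot w gam.
Proof.
by rewrite /wdot -sumrN; apply: eq_bigr => j _; rewrite mxE ReN mulrN.
Qed.
Lemma wdotB gam gam' : wdot w (gam - gam') = wdot w gam - wdot w gam'.
Proof. by rewrite wdotD wdotN. Qed.
Lemma wdot_ivec u : wdot w (ivec u) = zdot u.
Proof. by apply: eq_bigr => j _; rewrite mxE Re_int. Qed.

Lemma ivecD u v : ivec (u + v) = ivec u + ivec v.
Proof. exact: map_mxD. Qed.
Lemma ivecN u : ivec (- u) = - ivec u.
Proof. exact: map_mxN. Qed.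
Lemma zdotD u v : zdot (u + v) = zdot u + zdot v.
Proof. by rewrite -!wdot_ivec ivecD wdotD. Qed.
Lemma zdotN u : zdot (- u) = - zdot u.
Proof. by rewrite -!wdot_ivec ivecN wdotN. Qed.
Lemma zdotMn u k : zdot (u *+ k) = zdot u *+ k.
Proof.
elim: k => [|k IHk]; last by rewrite !mulrS zdotD IHk.
by rewrite !mulr0n /zdot big1 // => j _; rewrite mxE mulr0.
Qed.

Lemma kerZD u v : kerZ A u -> kerZ A v -> kerZ A (u + v).
Proof. by rewrite /kerZ /= mulmxDr => -> ->; rewrite addr0. Qed.
Lemma kerZN u : kerZ A u -> kerZ A (- u).
Proof. by rewrite /kerZ /= mulmxN => ->; rewrite oppr0. Qed.
Lemma kerZMn u k : kerZ A u -> kerZ A (u *+ k).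
Proof.
move=> ku; elim: k => [|k IHk]; first by rewrite /kerZ /= mulr0n mulmx0.
by rewrite mulrS; exact: kerZD.
Qed.

Lemma mulmx_ivec u : map_mx intr A *m ivec u = map_mx intr (A *m u).
Proof.
apply/matrixP => i j; rewrite !mxE rmorph_sum /=; apply: eq_bigr => k _.
by rewrite !mxE rmorphM.
Qed.

Lemma ivec_kerZ u : map_mx intr A *m ivec u = 0 -> kerZ A u.
Proof.
rewrite mulmx_ivec => /matrixP Au; apply/matrixP => i j.
by have := Au i j; rewrite !mxE => /eqP; rewrite intr_eq0 => /eqP.
Qed.

Section OneLattice.
Variables (Lam : set Cn).
Hypothesis LamP : exp_lattices A beta Lam.

Lemma lattice_beta gam : Lam gam -> map_mx intr A *m gam = beta.
Proof.
case: LamP => lam Alam -> [u ku <-].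
by rewrite mulmxDr Alam mulmx_ivec ku map_mx0 addr0.
Qed.

Lemma lattice_diff gam gam' : Lam gam -> Lam gam' ->
  exists2 u, kerZ A u & gam' = gam + ivec u.
Proof.
case: LamP => lam Alam -> [u ku <-] [v kv <-].
exists (v - u); first by apply: kerZD => //; exact: kerZN.
by rewrite ivecD ivecN addrACA subrr addr0.
Qed.

Lemma lattice_add gam u : Lam gam -> kerZ A u -> Lam (gam + ivec u).
Proof.
case: LamP => lam Alam -> [v kv <-] ku.
by exists (v + u); [exact: kerZD | rewrite -/(ivec _) ivecD addrA].
Qed.

Lemma lattice_nonempty : exists gam, Lam gam.
Proof.
case: LamP => lam Alam ->; exists lam; exists 0; first by rewrite /kerZ /= mulmx0.
by rewrite map_mx0 addr0.
Qed.

Lemma lattice_translate gam : Lam gam -> Lam = [set gam + ivec u | u in kerZ A].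
Proof.
move=> Lg; apply/seteqP; split=> [gam' Lg'|_ [u ku <-]]; last exact: lattice_add.
by have [u ku ->] := lattice_diff Lg Lg'; exists u.
Qed.

End OneLattice.

(** * Negative supports along a ray *)

Lemma nsupp_int gam j (z : int) : gam j 0 = z%:~R ->
  (j \in nsupp gam) = (z < 0).
Proof.
move=> gz; rewrite inE; apply/asboolP/idP => [[m]|z0].
  rewrite gz -[m.+1%:R]/((m.+1 : int)%:~R) -rmorphN => /intr_inj ->.
  by rewrite oppr_lt0.
by case: z gz z0 => // m gz _; exists m; rewrite gz NegzE rmorphN.
Qed.

Lemma nsupp_isint gam j : j \in nsupp gam -> exists z : int, gam j 0 = z%:~R.
Proof.
rewrite inE => /asboolP[m ->]; exists (- (m.+1 : int)).
by rewrite rmorphN.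
Qed.

Lemma ivecDE gam u j (z : int) : gam j 0 = z%:~R ->
  (gam + ivec u) j 0 = (z + u j 0)%:~R.
Proof. by move=> gz; rewrite !mxE gz rmorphD. Qed.

(** The conditions determine the negative support because a non-integral
    coordinate never lies in it and stays non-integral along the lattice. *)
Lemma nsupp_addP gam u I :
  (forall j (z : int), gam j 0 = z%:~R -> (z + u j 0 < 0) = (j \in I)) ->
  (forall j, j \in I -> exists z : int, gam j 0 = z%:~R) ->
  nsupp (gam + ivec u) = I.
Proof.
move=> uI Iint; apply/setP => j; apply/idP/idP => [/[dup] gj /nsupp_isint[z]|jI].
  rewrite !mxE => gz; have gE : gam j 0 = (z - u j 0)%:~R.
    by rewrite intrB -gz addrK.
  by rewrite -(uI _ _ gE) -(nsupp_int (ivecDE u gE)).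
have [z gz] := Iint j jI.
by rewrite (nsupp_int (ivecDE u gz)) uI.
Qed.

Definition stable_ray gam u := forall j (z : int), gam j 0 = z%:~R ->
  if z < 0 then u j 0 <= 0 else 0 <= u j 0.

Lemma nsupp_ray gam u k : stable_ray gam u ->
  nsupp (gam + ivec (u *+ k)) = nsupp gam.
Proof.
move=> gu; apply: nsupp_addP => [j z gz|j /nsupp_isint//].
rewrite (nsupp_int gz) mulmxnE; have := gu j z gz.
case: ifPn; first by case: (u j 0) => m; nia.
by rewrite -leNgt; case: (u j 0) => m; nia.
Qed.

End Lattices.

(** * Minima of strata *)

Section Minima.
Variables (R : realType) (d n : nat) (A : 'M[int]_(d, n)) (beta : 'cV[R[i]]_d).
Variable w : 'cV[R]_n.
Hypothesis w_generic : L_generic A w.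
Variable Lam : set 'cV[R[i]]_n.
Hypothesis LamP : exp_lattices A beta Lam.
Implicit Types (u v : 'cV[int]_n) (gam lam : 'cV[R[i]]_n) (I J : {set 'I_n}).

Lemma wleE gam gam' : wle w gam gam' <-> wdot w gam <= wdot w gam'.
Proof. by rewrite /wle wdotB subr_ge0. Qed.

Lemma wdot_inj gam gam' : Lam gam -> Lam gam' ->
  wdot w gam = wdot w gam' -> gam = gam'.
Proof.
move=> Lg Lg' gg'; have [u ku g'E] := lattice_diff LamP Lg Lg'.
have [u0|u0] := eqVneq u 0; first by rewrite g'E u0 /ivec map_mx0 addr0.
have /eqP[] := w_generic ku u0; rewrite -/(zdot w u) -wdot_ivec.
by apply: (addrI (wdot w gam)); rewrite -wdotD -g'E addr0.
Qed.

Lemma wltE gam gam' : Lam gam -> Lam gam' ->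
  wlt w gam gam' <-> wdot w gam < wdot w gam'.
Proof.
move=> Lg Lg'; rewrite /wlt wleE lt_neqAle; split=> [[-> neq]|/andP[neq ->]].
  by rewrite andbT; apply/eqP => /wdot_inj; auto.
by split=> // gg'; move: neq; rewrite gg' eqxx.
Qed.

Lemma is_wminE Om gam :
  is_wmin w Om gam <-> Om gam /\ forall gam', Om gam' -> wdot w gam <= wdot w gam'.
Proof. by split=> -[Og mg]; split=> // gam' /mg /wleE. Qed.

Lemma wmin_eq Om gam : Om `<=` Lam -> is_wmin w Om gam -> wmin w Om = gam.
Proof.
move=> OmL mg; rewrite /wmin; case: xgetP => [gam' _ mg'|/(_ gam)//].
move/is_wminE: mg => [Og mg]; move/is_wminE: mg' => [Og' mg'].
apply: wdot_inj; [exact: OmL|exact: OmL|].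
by apply/eqP; rewrite eq_le mg' // mg.
Qed.

Lemma wmin_bounded Om Om' gam : Om `<=` Lam -> is_wmin w Om gam -> Om' `<=` Om ->
  wbounded_below w Lam Om'.
Proof.
move=> OmL /is_wminE[Og mg] Om'Om; exists gam; first exact: OmL.
by exists 0 => gam' /Om'Om/mg; rewrite wdotB subr_ge0.
Qed.

Lemma stratum_sub I : stratum Lam I `<=` Lam.
Proof. by move=> gam []. Qed.

Lemma bounded_progression (b x y : R) :
  (exists k0, forall k : nat, (k0 <= k)%N -> b <= x + y *+ k) -> 0 <= y.
Proof.
move=> [k0 bxy]; rewrite leNgt; apply/negP => y0.
pose k := (Num.bound `|(x - b) / - y| + k0)%N.
have := bxy k (leq_addl _ _); apply/negP; rewrite -ltNge.
have : (x - b) / - y < k%:R.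
  apply: le_lt_trans (_ : _ <= `|(x - b) / - y|) _; first exact: ler_norm.
  apply: lt_le_trans (archi_boundP (normr_ge0 _)) _.
  by rewrite ler_nat leq_addr.
rewrite ltr_pdivrMr ?oppr_gt0 // mulrN mulr_natl; lra.
Qed.

(** The ray gam + k u stays in the stratum, so its weight is an arithmetic
    progression that is bounded below. *)
Lemma bounded_ray I gam u : wbounded_below w Lam (stratum Lam I) ->
  stratum Lam I gam -> kerZ A u -> stable_ray gam u -> 0 <= zdot w u.
Proof.
move=> [lam Llam [b blam]] [Lg gI] ku gu.
apply: (@bounded_progression b (wdot w (gam - lam))); exists 0%N => k _.
have : stratum Lam I (gam + ivec R (u *+ k)).
  by split; [apply: (lattice_add LamP) => //; exact: kerZMn | rewrite nsupp_ray].
by move/blam; rewrite addrAC (wdotD w (gam - lam)) wdot_ivec zdotMn.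
Qed.

(** A strictly descending sequence in a stratum would, by Dickson's lemma on the
    absolute values of the integral coordinates, contain two terms whose
    difference spans a stable ray, along which the weight cannot decrease. *)
Lemma stratum_wmin I : stratum Lam I !=set0 ->
  wbounded_below w Lam (stratum Lam I) -> exists gam, is_wmin w (stratum Lam I) gam.
Proof.
move=> [gam0 Ig0] bI; apply: contrapT => nomin.
have desc (gam : {gam | stratum Lam I gam}) :
    exists gam' : {gam | stratum Lam I gam},
      wdot w (sval gam') < wdot w (sval gam).
  apply: contrapT => ngam; apply: nomin; exists (sval gam); apply/is_wminE.
  split=> [|gam' Ig']; first exact: svalP.
  by rewrite leNgt; apply/negP => lt_g'g; apply: ngam; exists (exist _ gam' Ig').
have [next nextP] := choice desc.
pose s k := iter k next (exist _ gam0 Ig0).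
have s_desc : {homo (fun k => wdot w (sval (s k))) : i j / (i < j)%N >-> j < i}.
  by apply: homo_ltn => [x y z xy yz|k]; [exact: lt_trans yz xy | exact: nextP].
pose f k (j : 'I_n) := absz (Num.floor (complex.Re (sval (s k) j 0))).
have [i [j [ij fij]]] := dickson f.
have [Lgi gi] := svalP (s i); have [Lgj gj] := svalP (s j).
have [u ku giE] := lattice_diff LamP Lgi Lgj.
have := s_desc _ _ ij; rewrite giE wdotD wdot_ivec; apply/negP; rewrite -leNgt lerDl.
apply: (@bounded_ray I (sval (s i))) => // k z gz.
have gz' : sval (s j) k 0 = (z + u k 0)%:~R by rewrite giE (ivecDE u gz).
have := fij k; rewrite /f gz gz' !Re_int !intrKfloor.
have := nsupp_int gz; have := nsupp_int gz'; rewrite gi gj => ->.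
by move: z (u k 0) {gz gz'} => z t; case: ifPn; lia.
Qed.

Lemma vminP (I : NSidx Lam) : Bw w Lam I ->
  is_wmin w (stratum Lam (sval I)) (vmin w I).
Proof.
move=> bI; have /(stratum_wmin)/(_ bI) [gam mg] : stratum Lam (sval I) !=set0.
  by have := svalP I; rewrite inE => /asboolP.
by rewrite /vmin (wmin_eq _ mg) //; exact: stratum_sub.
Qed.

Lemma bounded_ray_trivial I gam u : wbounded_below w Lam (stratum Lam I) ->
  stratum Lam I gam -> kerZ A u ->
  (forall j (z : int), gam j 0 = z%:~R -> u j 0 = 0) -> u = 0.
Proof.
move=> bI Ig ku u0; apply/eqP/negPn/negP => nz_u.
have [zu zuN] : 0 <= zdot w u /\ 0 <= zdot w (- u).
  split; apply: (bounded_ray bI Ig) => //; try exact: kerZN;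
    by move=> j z /u0 uj; rewrite ?mxE uj ?oppr0; case: ifP.
have := w_generic ku nz_u; rewrite -/(zdot w u).
by move: zuN; rewrite zdotN oppr_ge0 => zuN; rewrite eq_le zu zuN.
Qed.

Lemma in_NS (I : NSidx Lam) : stratum Lam (sval I) !=set0.
Proof. by have := svalP I; rewrite inE => /asboolP. Qed.

Lemma stratum_NS gam : Lam gam -> nsupp gam \in NS Lam.
Proof. by move=> Lg; rewrite inE; apply/asboolP; exists gam. Qed.

Definition ns_of gam (Lg : Lam gam) : NSidx Lam := exist _ (nsupp gam) (stratum_NS Lg).

(** Far out on the side of a lattice vector where the weight decreases, the
    negative support is constant; this is an unbounded stratum. *)
Lemma unbounded_stratum (I : NSidx Lam) u : kerZ A u -> u != 0 ->
  exists2 J : NSidx Lam, ~ Bw w Lam J &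
    forall j, j \in sval J :\: sval I -> u j 0 != 0.
Proof.
move=> ku nz_u; wlog zu : u ku nz_u / zdot w u < 0.
  move=> wl; have := w_generic ku nz_u; rewrite -/(zdot w u) neq_lt => /orP[|zu].
    exact: wl.
  have [||//|J nbJ uJ] := wl (- u); [exact: kerZN|by rewrite oppr_eq0|
    by rewrite zdotN oppr_lt0|].
  by exists J => // j /uJ; rewrite mxE oppr_eq0.
have [gam [Lg gI]] := in_NS I.
pose zc j := Num.floor (complex.Re (gam j 0)).
pose isint j := `[< exists z : int, gam j 0 = z%:~R >].
(* the negative support of gam + k u for all large k *)
pose J0 := [set j | isint j && ((u j 0 < 0) || (u j 0 == 0) && (zc j < 0))]%SET.
(* larger than the absolute value of every integral coordinate of gam *)
pose k0 := (\sum_j absz (zc j)).+1.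
have nsJ k : (k0 <= k)%N -> nsupp (gam + ivec R (u *+ k)) = J0.
  move=> k0k; apply: nsupp_addP => [j z gz|j]; last first.
    by rewrite inE => /andP[/asboolP].
  have zcE : zc j = z by rewrite /zc gz Re_int intrKfloor.
  have -> : (j \in J0) = ((u j 0 < 0) || (u j 0 == 0) && (z < 0)).
    by rewrite inE zcE (_ : isint j) //; apply/asboolP; exists z.
  have : (absz z < k)%N.
    by apply: leq_trans k0k; rewrite ltnS -zcE (bigD1 j) //= leq_addr.
  rewrite mulmxnE; case: (ltgtP (u j 0) 0) => [u0|u0|->] /=; last first.
  - by rewrite mul0rn addr0.
  - by case: (u j 0) u0 => m; nia.
  - by case: (u j 0) u0 => m; nia.
have Lray k : Lam (gam + ivec R (u *+ k)).
  by apply: (lattice_add LamP) => //; exact: kerZMn.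
have J0NS : J0 \in NS Lam by rewrite -(nsJ k0) //; exact: stratum_NS.
exists (exist _ J0 J0NS) => /= [[lam Llam [b blam]]|j].
  move: zu; apply/negP; rewrite -leNgt.
  apply: (@bounded_progression b (wdot w (gam - lam))); exists k0 => k k0k.
  have /blam : stratum Lam J0 (gam + ivec R (u *+ k)) by split=> //; exact: nsJ.
  by rewrite addrAC (wdotD w (gam - lam)) wdot_ivec zdotMn.
rewrite !inE -gI => /andP[ngj /andP[/asboolP[z gz] uj]].
apply: contraNneq ngj => uj0.
by move: uj; rewrite uj0 ltxx eqxx /= /zc gz Re_int intrKfloor (nsupp_int gz).
Qed.

End Minima.

(** * Composition series of nilpotent modules *)

Section CompositionSeries.
Variables (S : pzRingType) (M : lmodType S).
Implicit Types P Q : set M.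

Definition covers P Q := P `<` Q /\
  forall T, submodule T -> P `<=` T -> T `<=` Q -> T = P \/ T = Q.

Definition comp_series P k := exists N : nat -> set M,
  [/\ N 0%N = [set 0], N k = P, forall i, (i <= k)%N -> submodule (N i) &
      forall i, (i < k)%N -> covers (N i) (N i.+1)].

Lemma comp_series_submodule P k : comp_series P k -> submodule P.
Proof. by case=> N [_ <- sN _]; exact: sN. Qed.

Lemma submodule_zero : submodule ([set 0] : set M).
Proof. by apply/submoduleP; split=> // a u v -> ->; rewrite scaler0 addr0. Qed.

Lemma comp_series0 : comp_series [set 0] 0.
Proof.
exists (fun=> [set 0]); split=> // i _; exact: submodule_zero.
Qed.

Lemma comp_seriesS P Q k :
  comp_series P k -> submodule Q -> covers P Q -> comp_series Q k.+1.
Proof.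
move=> [N [N0 Nk sN cN]] sQ PQ.
exists (fun i => if (i <= k)%N then N i else Q); split=> [||i _|i].
- by rewrite leq0n.
- by rewrite ltnn.
- by case: ifP => // /sN.
by rewrite ltnS; case: (ltngtP i k) => [ik|//|->] _; [exact: cN | rewrite Nk].
Qed.

Lemma comp_series_inv P k : comp_series P k.+1 ->
  exists2 Q, comp_series Q k & covers Q P.
Proof.
move=> [N [N0 Nk sN cN]]; exists (N k); last by rewrite -Nk; exact: cN.
by exists N; split=> // i ik; [exact/sN/leqW | exact/cN/leqW].
Qed.

Lemma comp_series0_inv P : comp_series P 0 -> P = [set 0].
Proof. by case=> N [-> ->]. Qed.

End CompositionSeries.

Section NilpotentModules.
Variables (R : realType) (n : nat).
Local Notation C := R[i].
Local Notation S := {mpoly C[n]}.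
Variable X : lmodType S.
Implicit Types (P Q : set X) (x y : X) (c : C) (s : S) (m : 'X_{1..n}).

Definition killed_by_degree e :=
  forall m x, (e <= mdeg m)%N -> 'X_[m] *: x = 0.

(** The C-subspace P + C b. *)
Definition ext_line P b : set X := [set x | exists2 c, P (x - c%:MP *: b) & True].

(** Modulo P, the operator s acts on b through its constant term. *)
Lemma maximal_ideal_smul P b s : submodule P -> (forall j, P ('X_j *: b)) ->
  P (s *: b - (s@_0)%:MP *: b).
Proof.
move=> sP PX; elim/mpolyind: s => [|c m s _ _ IHs].
  by rewrite mcoeff0 mpolyC0 subrr; exact: submodule0.
rewrite mcoeffD mpolyCD !scalerDl opprD addrACA; apply: submoduleD => //.
rewrite mcoeffZ mcoeffX -mul_mpolyC mpolyCM -!scalerA -scalerBr.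
apply: submoduleZ => //; have [->|] := eqVneq m 0%MM.
  by rewrite mpolyX0 mpolyC1 subrr; exact: submodule0.
rewrite -mdeg_eq0 mpolyC0 scale0r subr0 mdegE sum_nat_eq0 negb_forall.
case/existsP=> j /= mj; have jm : (U_(j) <= m)%MM by rewrite lep1mP.
by rewrite -(submK jm) mpolyXD -scalerA; exact: submoduleZ.
Qed.

Lemma ext_line_submodule P b : submodule P -> (forall j, P ('X_j *: b)) ->
  submodule (ext_line P b).
Proof.
move=> sP PX; apply/submoduleP; split.
  by exists 0 => //; rewrite mpolyC0 scale0r subr0; exact: submodule0.
move=> s u v [c Pu _] [c' Pv _]; exists (s@_0 * c + c') => //.
have -> : s *: u + v - (s@_0 * c + c')%:MP *: b =
   s *: (u - c%:MP *: b) + (v - c'%:MP *: b)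
     + c%:MP *: (s *: b - (s@_0)%:MP *: b).
  rewrite mpolyCD mpolyCM [_ * c%:MP]mulrC scalerDl !scalerBr !scalerA.
  rewrite [c%:MP * s]mulrC [RHS]addrAC [s *: u - _ + _]addrA subrK.
  by rewrite opprD addrACA.
apply: submoduleD => //; first by apply: submoduleD => //; exact: submoduleZ.
by apply: submoduleZ => //; exact: maximal_ideal_smul.
Qed.

Lemma ext_line_sub P b : P `<=` ext_line P b.
Proof. by move=> x Px; exists 0 => //; rewrite mpolyC0 scale0r subr0. Qed.

Lemma ext_line_mem P b : submodule P -> ext_line P b b.
Proof.
by move=> sP; exists 1 => //; rewrite mpolyC1 scale1r subrr; exact: submodule0.
Qed.

Lemma ext_line_min P Q b : submodule Q -> P `<=` Q -> Q b -> ext_line P b `<=` Q.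
Proof.
move=> sQ PQ Qb x [c Px _]; rewrite -(subrK (c%:MP *: b) x).
by apply: submoduleD => //; [exact: PQ | exact: submoduleZ].
Qed.

Lemma ext_line_covers P b : submodule P -> (forall j, P ('X_j *: b)) -> ~ P b ->
  covers P (ext_line P b).
Proof.
move=> sP PX nPb; split.
  by split=> [|/(_ b (ext_line_mem b sP))//]; exact: ext_line_sub.
move=> T sT PT TE; have [TP|] := pselect (T `<=` P).
  by left; apply/seteqP.
move=> /existsNP[x /not_implyP[Tx nPx]]; right.
apply/seteqP; split=> //; apply: ext_line_min => //.
have [c Pxc _] := TE _ Tx; have c0 : c != 0.
  by apply: contra_notN nPx => /eqP c0; move: Pxc; rewrite c0 mpolyC0 scale0r subr0.
have -> : b = c^-1%:MP *: (x - (x - c%:MP *: b)).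
  by rewrite opprB addrC subrK scalerA -mpolyCM mulVf // mpolyC1 scale1r.
by apply: submoduleZ => //; apply: submoduleB => //; exact: PT.
Qed.

(** In a nilpotent module every covering step adjoins one element annihilated
    modulo the smaller submodule by all the variables: push any new element by
    monomials for as long as it stays outside. *)
Lemma covers_ext_line e P Q : killed_by_degree e -> submodule P -> submodule Q ->
  covers P Q -> exists b, [/\ ~ P b, forall j, P ('X_j *: b) & Q = ext_line P b].
Proof.
move=> nilX sP sQ [[PQ QP] max_PQ].
move/existsNP: QP => [x /not_implyP[Qx nPx]].
pose out k := `[< exists2 m, mdeg m = k & ~ P ('X_[m] *: x) >].
have out0 : exists k, out k.
  exists 0%N; apply/asboolP; exists 0%MM; first exact: mdeg0.
  by rewrite mpolyX0 scale1r.
have out_bound k : out k -> (k <= e)%N.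
  move=> /asboolP[m <- nPm]; rewrite leqNgt; apply: contra_notN nPm => em.
  by rewrite nilX ?(ltnW em) //; exact: submodule0.
case: (ex_maxnP out0 out_bound) => k /asboolP[m mk nPm] max_k.
exists ('X_[m] *: x); have PX j : P ('X_j *: ('X_[m] *: x)).
  apply: contrapT => nPj; suff /max_k : out k.+1 by rewrite ltnn.
  apply/asboolP; exists (U_(j) + m)%MM; first by rewrite mdegD mdeg1 mk.
  by rewrite mpolyXD -scalerA.
split=> //; have sE := ext_line_submodule sP PX.
have EQ : ext_line P ('X_[m] *: x) `<=` Q.
  by apply: ext_line_min => //; exact: submoduleZ.
have [EP|//] := max_PQ _ sE (@ext_line_sub _ _) EQ.
by case: nPm; rewrite -EP; exact: ext_line_mem.
Qed.

(** Adjoining an element either does nothing or is one step of the series, so a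
    list of elements killed modulo P by the variables can be adjoined one by one. *)
Lemma comp_series_extend P k (l : seq X) : comp_series P k ->
  (forall x, x \in l -> forall j, P ('X_j *: x)) ->
  exists k' Q, [/\ comp_series Q k', P `<=` Q & forall x, x \in l -> Q x].
Proof.
elim: l P k => [|b l IHl] P k cP PX; first by exists k, P; split.
have sP := comp_series_submodule cP.
have Pb := PX b (mem_head _ _).
have [k1 cE] : exists k', comp_series (ext_line P b) k'.
  have [Pbb|nPb] := pselect (P b).
    exists k; rewrite (_ : ext_line P b = P) //; apply/seteqP; split.
      exact: ext_line_min.
    exact: ext_line_sub.
  exists k.+1; apply: comp_seriesS cP _ _; first exact: ext_line_submodule.
  exact: ext_line_covers.
have [x xl j|k' [Q [cQ EQ Ql]]] := IHl _ _ cE.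
  by apply: ext_line_sub; apply: PX _ j; rewrite inE xl orbT.
exists k', Q; split=> // [|x].
  by apply: subset_trans EQ; exact: ext_line_sub.
by rewrite inE => /orP[/eqP->|/Ql//]; apply: EQ; exact: ext_line_mem.
Qed.

(** The multiples of the generators by monomials are adjoined in decreasing
    degree: multiplication by a variable then lands in what is already there. *)
Lemma nilpotent_finite_length e (T : finType) (g : T -> X) :
  (forall m t, (e <= mdeg m)%N -> 'X_[m] *: g t = 0) ->
  (forall P, submodule P -> (forall t, P (g t)) -> P = setT) ->
  finite_length X.
Proof.
move=> nilg gen.
suff /(_ e)[k [P [cP Pg]]] : forall i, exists k P, comp_series P k /\
    forall m t, (e - i <= mdeg m)%N -> P ('X_[m] *: g t).
  exists k; rewrite /has_length -/(comp_series setT k).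
  rewrite -[setT](gen P) => [//||t]; first exact: comp_series_submodule cP.
  by rewrite -[g t]scale1r -mpolyX0; apply: Pg; rewrite subnn.
elim=> [|i [k [P [cP Pg]]]].
  exists 0%N, [set 0]; split; first exact: comp_series0.
  by move=> m t; rewrite subn0; exact: nilg.
pose l := [seq 'X_[val mt.1] *: g mt.2 |
  mt <- enum [pred mt : 'X_{1..n < (e - i).+1} * T | mdeg (val mt.1) == (e - i.+1)%N]].
have [x /mapP[[m t]] |k' [Q [cQ PQ Ql]]] := @comp_series_extend P k l cP.
  rewrite mem_enum => /eqP /= dm -> j; rewrite scalerA -mpolyXD.
  by apply: Pg; rewrite mdegD mdeg1 dm; lia.
exists k', Q; split=> // m t; rewrite leq_eqVlt => /orP[/eqP dm|dm]; last first.
  by apply/PQ/Pg; lia.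
have lt_m : (mdeg m < (e - i).+1)%N by lia.
apply: Ql; apply/mapP; exists (BMultinom lt_m, t) => //.
by rewrite mem_enum inE /= dm.
Qed.

(** Only the first k terms of b count; indexing by nat lets a basis be extended by
    one vector without changing its type. *)
Definition kbasis P k (b : nat -> X) :=
  (forall a : nat -> C, \sum_(i < k) (a i)%:MP *: b i = 0 ->
     forall i, (i < k)%N -> a i = 0) /\
  (forall x, P x <-> exists a : nat -> C, x = \sum_(i < k) (a i)%:MP *: b i).

(** A composition series of a nilpotent module is a complete flag. *)
Lemma comp_series_kbasis e P k : killed_by_degree e -> comp_series P k ->
  exists b, kbasis P k b.
Proof.
move=> nilX; elim: k P => [|k IHk] P cP.
  exists (fun=> 0); split=> // x; rewrite (comp_series0_inv cP); split=> [->|[a ->]].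
    by exists (fun=> 0); rewrite big_ord0.
  by rewrite big_ord0.
have [Q cQ QP] := comp_series_inv cP; have [b [indep gen]] := IHk _ cQ.
have sQ := comp_series_submodule cQ.
have [b1 [nQb1 Qb1 PE]] := covers_ext_line nilX sQ (comp_series_submodule cP) QP.
pose b' i := if i == k then b1 else b i.
have b'E (a : nat -> C) : \sum_(i < k.+1) (a i)%:MP *: b' i =
    \sum_(i < k) (a i)%:MP *: b i + (a k)%:MP *: b1.
  rewrite big_ord_recr /= /b' eqxx; congr (_ + _); apply: eq_bigr => i _.
  by rewrite ltn_eqF.
exists b'; split=> [a|x].
  rewrite b'E => a0; have ak0 : a k = 0.
    apply: contrapT => /eqP ak; apply: nQb1.
    have -> : b1 = (- (a k)^-1)%:MP *: \sum_(i < k) (a i)%:MP *: b i.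
      move/eqP: a0; rewrite addr_eq0 => /eqP ->; rewrite scalerN -scaleNr -mpolyCN.
      by rewrite opprK scalerA -mpolyCM mulVf // mpolyC1 scale1r.
    by apply: submoduleZ => //; apply/gen; exists a.
  move=> i; rewrite ltnS leq_eqVlt => /orP[/eqP->//|]; apply: indep.
  by move: a0; rewrite ak0 mpolyC0 scale0r addr0.
rewrite PE; split=> [[c /gen[a xE] _]|[a ->]].
  pose a' i := if i == k then c else a i.
  exists a'; rewrite (b'E a') /a' eqxx.
  rewrite -[LHS](subrK (c%:MP *: b1)) xE; congr (_ + _); apply: eq_bigr => i _.
  by rewrite ltn_eqF.
by exists (a k) => //; rewrite b'E addrK; apply/gen; exists a.
Qed.

(** More than k vectors with coordinates in C^k satisfy a linear relation. *)
Lemma kbasis_leq P k k' b b' : kbasis P k b -> kbasis P k' b' -> (k' <= k)%N.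
Proof.
move=> [_ gen] [indep' gen']; rewrite leqNgt; apply/negP => lt_kk'.
have exa (i : 'I_k') : exists a : nat -> C, b' i = \sum_(j < k) (a j)%:MP *: b j.
  apply/gen/gen'; exists (fun j => (j == i :> nat)%:R).
  rewrite (bigD1 i) //= eqxx mpolyC1 scale1r big1 ?addr0 // => j ji.
  by rewrite val_eqE (negbTE ji) mpolyC0 scale0r.
have [a aE] := choice exa.
pose M : 'M[C]_(k', k) := \matrix_(i, j) a i j.
have : kermx M != 0.
  by rewrite -mxrank_eq0 mxrank_ker subn_eq0 -ltnNge (leq_ltn_trans (rank_leq_col M)).
move=> /rowV0Pn[v /sub_kermxP vM /eqP]; apply.
pose z i := if insub i is Some i' then v 0 i' else 0 : C.
have zE (i : 'I_k') : z i = v 0 i by rewrite /z valK.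
apply/rowP => i; rewrite mxE -zE; apply: indep' (ltn_ord i).
under eq_bigr => j _ do rewrite zE aE scaler_sumr.
rewrite exchange_big big1 //= => j _.
have vMj : \sum_i' v 0 i' * a i' j = 0.
  have /rowP/(_ j) := vM; rewrite !mxE => vMj.
  by rewrite -[RHS]vMj; apply: eq_bigr => i' _; rewrite mxE.
under eq_bigr => i' _ do rewrite scalerA -mpolyCM.
by rewrite -scaler_suml -rmorph_sum /= vMj mpolyC0 scale0r.
Qed.

Lemma has_length_unique e k k' : killed_by_degree e ->
  has_length X k -> has_length X k' -> k = k'.
Proof.
move=> nilX /(comp_series_kbasis nilX)[b bP] /(comp_series_kbasis nilX)[b' bP'].
by apply/eqP; rewrite eqn_leq (kbasis_leq bP bP') (kbasis_leq bP' bP).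
Qed.

Lemma mod_lengthE e k : killed_by_degree e -> has_length X k -> mod_length X = k.
Proof.
move=> nilX Xk; rewrite /mod_length; case: xgetP => [k' _ Xk'|/(_ k)//].
exact: has_length_unique nilX Xk' Xk.
Qed.

End NilpotentModules.

(** * Duality between a nilpotent module and its homomorphisms to C[y] *)

Section Duality.
Variables (R : realType) (n : nat).
Local Notation C := R[i].
Local Notation S := {mpoly C[n]}.
Variable X : lmodType S.
Implicit Types (x y : X) (c : C) (m : 'X_{1..n}) (f : X -> S) (g : X -> C).

Lemma HomSP f : HomS X f <-> [/\ {morph f : x y / x + y} &
  forall s x, f (s *: x) = dact s (f x)].
Proof.
split=> [fL|[fD fZ] a x y]; last by rewrite fD fZ.
have f0 : f 0 = 0.
  have := fL 1 0 0; rewrite scale1r dact1 addr0 => /eqP.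
  by rewrite -subr_eq0 opprD addrA subrr sub0r oppr_eq0 => /eqP.
split=> [x y|s x]; first by have := fL 1 x y; rewrite scale1r dact1.
by have := fL s x 0; rewrite f0 !addr0.
Qed.

Lemma HomS_sub : submodule (HomS X : set (X -> S)).
Proof.
apply/submoduleP; split=> [a x y|c f f' fL f'L a x y] /=.
  by rewrite linear0 addr0.
rewrite !fctE fL f'L (linearD (dact a)) (linearZ_LR (dact a)) /= scalerDr.
exact: addrACA.
Qed.

Definition mfactorial m : nat := \prod_(i < n) (m i)`!.

Lemma mfactorial_neq0 m : (mfactorial m)%:R != 0 :> C.
Proof.
by rewrite pnatr_eq0 -lt0n; apply: prodn_gt0 => i; exact: fact_gt0.
Qed.

(** Taylor's formula: the coefficient of y^m is the constant term of the
    derivative by d^m, divided by m!. So f is determined by its constant terms. *)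
Lemma HomS_coeff f x m : HomS X f ->
  (f x)@_m = (f ('X_[m] *: x))@_0 / (mfactorial m)%:R.
Proof.
move=> /HomSP[_ fZ]; rewrite fZ dactX mcoeff_mderivm addm0 -[_ *+ _]mulr_natr.
rewrite (_ : \prod_(i < n) _ = mfactorial m) ?mulfK ?mfactorial_neq0 //.
by apply: eq_bigr => i _; rewrite ffactnn.
Qed.

Lemma HomS_eq0 f : HomS X f -> (forall x, (f x)@_0 = 0) -> f = 0.
Proof.
move=> fH f0; apply/funext => x; apply/mpolyP => m.
by rewrite (HomS_coeff _ _ fH) f0 mul0r mcoeff0.
Qed.

(** C-linearity, where C acts through the constant polynomials. *)
Definition functional g := forall c x y, g (c%:MP *: x + y) = c * g x + g y.

(** The exponential of a functional: the S-linear map whose constant terms are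
    given by [g], on a module killed by the monomials of degree [e]. *)
Definition exp_functional e g : X -> S := fun x =>
  \sum_(m : 'X_{1..n < e}) (g ('X_[val m] *: x) / (mfactorial (val m))%:R) *: 'X_[val m].

Section Exponential.
Variables (e : nat) (g : X -> C).
Hypothesis nilX : killed_by_degree X e.
Hypothesis gL : functional g.

Lemma functionalD : {morph g : x y / x + y}.
Proof. by move=> x y; have := gL 1 x y; rewrite mpolyC1 scale1r mul1r. Qed.
Lemma functional0 : g 0 = 0.
Proof. by apply: (addrI (g 0)); rewrite -functionalD !addr0. Qed.
Lemma functionalZ c x : g (c%:MP *: x) = c * g x.
Proof. by have := gL c x 0; rewrite functional0 !addr0. Qed.

Lemma exp_functional_coeff x m :
  (exp_functional e g x)@_m = g ('X_[m] *: x) / (mfactorial m)%:R.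
Proof.
have [lt_me|le_em] := ltnP (mdeg m) e.
  exact: (mcoeff_mpoly (fun m => g ('X_[m] *: x) / (mfactorial m)%:R)).
rewrite nilX // functional0 mul0r; apply: memN_msupp_eq0.
rewrite mcoeff_msupp negbK linear_sum big1 //= => m' _.
rewrite mcoeffZ mcoeffX; case: eqP => [mE|]; last by rewrite mulr0.
by move: le_em; rewrite -mE leqNgt bmdeg.
Qed.

Lemma exp_functional_const x : (exp_functional e g x)@_0 = g x.
Proof.
rewrite exp_functional_coeff mpolyX0 scale1r /mfactorial big1 ?divr1 //.
by move=> i _; rewrite mnm0E.
Qed.

Lemma exp_functional_HomS : HomS X (exp_functional e g).
Proof.
have expD : {morph exp_functional e g : x y / x + y}.
  move=> x y; apply/mpolyP => m.
  by rewrite mcoeffD !exp_functional_coeff scalerDr functionalD mulrDl.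
apply/HomSP; split=> // s x; elim/mpolyind: s => [|c m s _ _ IHs].
  rewrite scale0r dact0l; apply/mpolyP => m.
  by rewrite exp_functional_coeff scaler0 functional0 mul0r mcoeff0.
rewrite scalerDl expD dactDl IHs; congr (_ + _); apply/mpolyP => m'.
rewrite dactZl mcoeffZ exp_functional_coeff -mul_mpolyC scalerA mulrCA -scalerA.
rewrite functionalZ -mulrA; congr (_ * _).
rewrite dactX mcoeff_mderivm exp_functional_coeff -mpolyXD [(m' + m)%MM]addmC.
rewrite -[RHS]mulr_natr -mulrA; congr (_ * _).
apply: (mulfI (mfactorial_neq0 m')); rewrite divff ?mfactorial_neq0 //.
rewrite mulrCA mulrA [_^-1 * _]mulrC mulrAC -natrM -[LHS](@divff _ (mfactorial (m +
  m'))%:R).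
  (* m'! times the falling factorial of m + m' by m is (m + m')! *)
  congr (_%:R / _); rewrite /mfactorial -big_split; apply: eq_bigr => i _ /=.
  by rewrite mulnC mnmDE -{3}(addKn (m i) (m' i)) ffact_fact // leq_addr.
exact: mfactorial_neq0.
Qed.

End Exponential.

(** The coordinates in a basis; their exponentials are the dual basis of the
    homomorphisms to C[y]. *)
Lemma kbasis_coord k b : kbasis (setT : set X) k b -> exists g : nat -> X -> C,
  [/\ forall i, functional (g i),
      forall i j, (i < k)%N -> (j < k)%N -> g i (b j) = (i == j)%:R &
      forall x, x = \sum_(i < k) (g i x)%:MP *: b i].
Proof.
move=> [indep gen]; have exa x : exists a : nat -> C,
    x = \sum_(i < k) (a i)%:MP *: b i /\ forall i, (k <= i)%N -> a i = 0.
  have [a xE] := (gen x).1 I; exists (fun i => if (i < k)%N then a i else 0).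
  by split=> [|i ki]; rewrite ?ltnNge ?ki // {1}xE; apply: eq_bigr => i _; rewrite ltn_ord.
have [g gE] := choice exa.
have uniq_a (a a' : nat -> C) : \sum_(i < k) (a i)%:MP *: b i =
    \sum_(i < k) (a' i)%:MP *: b i -> forall i, (i < k)%N -> a i = a' i.
  move=> aa' i ik; apply/eqP; rewrite -subr_eq0; apply/eqP.
  apply: (indep (fun i => a i - a' i)) ik.
  under eq_bigr => j _ do rewrite mpolyCB scalerBl.
  by rewrite big_split /= aa' -big_split big1 //= => j _; rewrite subrr.
exists (fun i x => g x i); split=> [i c x y|i j ik jk|x]; last by have [] := gE x.
  have [ik|ki] := ltnP i k; last first.
    by rewrite !(gE _).2 // mulr0 addr0.
  pose a i := c * g x i + g y i.
  rewrite -[RHS]/(a i); apply: uniq_a ik; rewrite -(gE _).1.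
  rewrite {1}[x](gE x).1 {1}[y](gE y).1 scaler_sumr -big_split /=.
  by apply: eq_bigr => j _; rewrite scalerA -mpolyCM -scalerDl -mpolyCD.
rewrite -[RHS]/((fun i => (i == j)%:R) i); apply: uniq_a ik; rewrite -(gE _).1.
rewrite (bigD1 (Ordinal jk)) //= eqxx mpolyC1 scale1r big1 ?addr0 // => j' jj'.
by rewrite (_ : (j' == j :> nat) = false) ?mpolyC0 ?scale0r //; exact: negbTE.
Qed.

(** A homomorphism f is the combination of the exponentials of the coordinates with
    the coefficients f(b_i)(0), because both have the same constant terms. *)
Lemma HomS_has_dim e k : killed_by_degree X e -> has_length X k ->
  has_dim (HomS X : set (X -> S)) k.
Proof.
move=> nilX /(comp_series_kbasis nilX)[b /kbasis_coord[g [gL gb gE]]].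
exists (fun i => exp_functional e (g i)); split=> [a a0 i|].
  have := congr1 (fun f : X -> S => (f (b i))@_0) a0.
  rewrite fct_sumE raddf_sum /= mcoeff0 (bigD1 i) //= big1 => [|j ji].
    by rewrite addr0 mcoeffZ exp_functional_const // gb // eqxx mulr1.
  by rewrite mcoeffZ exp_functional_const // gb // val_eqE (negbTE ji) mulr0.
apply/seteqP; split; last first.
  apply: lspan_min => [|_ [i _ <-]]; first exact: HomS_sub.
  exact: exp_functional_HomS.
move=> f fH; pose h := \sum_(i < k) (f (b i))@_0 *: exp_functional e (g i).
have -> : f = h.
  apply/eqP; rewrite -subr_eq0; apply/eqP; apply: HomS_eq0 => [|x].
    apply: (submoduleB HomS_sub fH).
    apply: (submodule_sum _ HomS_sub) => i _; apply: (submoduleZ _ HomS_sub).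
    exact: exp_functional_HomS.
  rewrite !fctE mcoeffB /h fct_sumE raddf_sum /= {1}[x](gE x).
  have /HomSP[fD fZ] := fH; have f0 : f 0 = 0.
    by rewrite -(scale0r 0) fZ dact0l.
  rewrite (big_morph f fD f0) raddf_sum -sumrB big1 //= => i _.
  by rewrite fZ dactC !mcoeffZ exp_functional_const // mulrC subrr.
apply: (submodule_sum _ (@lspan_submodule _ _ _)) => i _.
by apply: (submoduleZ _ (@lspan_submodule _ _ _)); apply: sub_lspan; exists i.
Qed.

(** C[y] cogenerates the nilpotent modules of finite length: some coordinate of x
    is nonzero, and its exponential does not vanish at x. *)
Lemma HomS_separates e x : killed_by_degree X e -> finite_length X -> x != 0 ->
  exists2 f, HomS X f & f x != 0.
Proof.
move=> nilX [k /(comp_series_kbasis nilX)[b /kbasis_coord[g [gL gb gE]]]] x0.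
have [i gx] : exists i : 'I_k, g i x != 0.
  apply: contrapT => /forallNP g0; case/eqP: x0; rewrite [x]gE big1 // => i _.
  by have /negP/negPn/eqP -> := g0 i; rewrite mpolyC0 scale0r.
exists (exp_functional e (g i)); first exact: exp_functional_HomS.
by apply: contra_neq gx => ex0; rewrite -(exp_functional_const nilX) // ex0 mcoeff0.
Qed.

End Duality.

(** * The operators attached to pairs of exponents *)

Lemma cancel_triple (S : idomainType) (x1 x2 x3 y1 y2 y3 s1 s2 s3 t1 t2 t3 : S) :
  x1 * x2 * x3 = y1 * y2 * y3 -> x1 * x2 * x3 != 0 ->
  (x1 * s1) * (x2 * s2) * (x3 * s3) = (y1 * t1) * (y2 * t2) * (y3 * t3) ->
  s1 * s2 * s3 = t1 * t2 * t3.
Proof.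
move=> xy x0 st; apply: (mulfI x0).
by transitivity (x1 * s1 * (x2 * s2) * (x3 * s3)); [|rewrite st xy]; ring.
Qed.

Lemma cancel_swap (S : idomainType) (gp gq gr x y z x' y' z' : S) :
  gp != 0 -> gq != 0 -> gr != 0 ->
  x * gq = x' * gp -> y * gr = y' * gq -> z * gp = z' * gr -> x * y * z = x' * y' * z'.
Proof.
move=> p0 q0 r0 xE yE zE; apply: (mulIf (mulf_neq0 p0 (mulf_neq0 q0 r0))).
by transitivity ((x * gq) * (y * gr) * (z * gp)); [|rewrite xE yE zE]; ring.
Qed.

Section FallingFactorials.
Variables (R : realType) (n : nat).
Local Notation C := R[i].
Local Notation S := {mpoly C[n]}.
Implicit Types (j : 'I_n) (a : C) (k l : nat) (gam lam : 'cV[C]_n) (I J K : {set 'I_n}).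
Implicit Types (u v : 'cV[int]_n) (p q r : int).

Definition falling j a k : S := \prod_(i < k) ('X_j + (a - i%:R)%:MP).

Lemma bracketE gam nu : bracket gam nu = \prod_j falling j (gam j 0) (nu j).
Proof. by []. Qed.

Lemma falling0 j a : falling j a 0 = 1.
Proof. exact: big_ord0. Qed.

Lemma fallingD j a k l : falling j a (k + l) = falling j a k * falling j (a - k%:R) l.
Proof.
rewrite /falling big_split_ord; congr (_ * _); apply: eq_bigr => i _ /=.
by rewrite natrD opprD addrA.
Qed.

Lemma linear_factor_neq0 j a : 'X_j + a%:MP != 0 :> S.
Proof.
apply/eqP => /(congr1 (mcoeff U_(j)%MM)); rewrite mcoeffD mcoeffX eqxx mcoeffC mcoeff0.
by rewrite mnm1_eq0 mulr0 addr0 => /eqP; rewrite oner_eq0.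
Qed.

Lemma falling_neq0 j a k : falling j a k != 0.
Proof. by apply/prodf_neq0 => i _; exact: linear_factor_neq0. Qed.

Definition posz p : nat := absz (Num.max p 0).

(** The larger of p and q goes down to r through the smaller one. *)
Lemma falling_swap j a p q r : r <= p -> r <= q ->
  falling j (a + p%:~R) (posz (p - q)) * falling j (a + q%:~R) (posz (q - r)) =
  falling j (a + q%:~R) (posz (q - p)) * falling j (a + p%:~R) (posz (p - r)).
Proof.
wlog pq : p q / p <= q.
  move=> wl rp rq; have [pq|/ltW qp] := leP p q; first exact: wl.
  by rewrite [RHS]wl.
move=> rp rq; rewrite (_ : posz (p - q) = 0%N) ?falling0 ?mul1r; last first.
  by rewrite /posz; lia.
rewrite (_ : posz (q - r) = (posz (q - p) + posz (p - r))%N); last first.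
  by rewrite /posz; lia.
rewrite fallingD; congr (_ * falling _ _ _); rewrite -addrA; congr (_ + _).
rewrite -[_%:R]/((posz (q - p))%:~R) -intrB; congr (_%:~R).
by rewrite /posz; lia.
Qed.

(** Both sides become equal after multiplication by the falling factorials down
    to the least of the three exponents. *)
Lemma falling_cocycle j a p q r :
  falling j (a + p%:~R) (posz (p - q)) * falling j (a + q%:~R) (posz (q - r)) *
    falling j (a + r%:~R) (posz (r - p)) =
  falling j (a + q%:~R) (posz (q - p)) * falling j (a + r%:~R) (posz (r - q)) *
    falling j (a + p%:~R) (posz (p - r)).
Proof.
pose m := Num.min p (Num.min q r).
have [mp mq mr] : [/\ m <= p, m <= q & m <= r] by rewrite /m; split; lia.
apply: (cancel_swap (falling_neq0 j (a + p%:~R) (posz (p - m)))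
  (falling_neq0 j (a + q%:~R) (posz (q - m))) (falling_neq0 j (a + r%:~R) (posz (r - m))));
  exact: falling_swap.
Qed.

Lemma diff_posE gam u v :
  diff_pos (gam + ivec R u) (gam + ivec R v) = [multinom posz (u j 0 - v j 0)%R | j < n].
Proof.
apply/mnmP => j; rewrite !mnmE !mxE opprD addrACA subrr add0r -intrB Re_int /posz.
rewrite truncn_floor intrKfloor ler0z; case: ifPn => [u0|]; first by rewrite max_l.
by rewrite -ltNge => u0; rewrite max_r // ltW.
Qed.

Lemma d_opE gam u v : d_op (gam + ivec R v) (gam + ivec R u) =
  \prod_j falling j (gam j 0 + (u j 0)%:~R) (posz (u j 0 - v j 0)).
Proof.
rewrite /d_op diff_posE bracketE; apply: eq_bigr => j _.
by rewrite mnmE !mxE.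
Qed.

Lemma dmonE J : dmon R J = \prod_j 'X_j ^+ (j \in J).
Proof.
rewrite /dmon big_mkcond /=; apply: eq_bigr => j _.
by case: (j \in J); rewrite ?expr1 ?expr0.
Qed.

Lemma dmon_neq0 J : dmon R J != 0.
Proof.
apply/prodf_neq0 => j _; have := linear_factor_neq0 j 0.
by rewrite mpolyC0 addr0.
Qed.

Lemma dmon_cocycle I J K :
  dmon R (J :\: I) * dmon R (K :\: J) * dmon R (I :\: K) =
  dmon R (I :\: J) * dmon R (J :\: K) * dmon R (K :\: I).
Proof.
rewrite !dmonE -!big_split; apply: eq_bigr => j _ /=; rewrite !inE -!exprD.
by case: (j \in I); case: (j \in J); case: (j \in K).
Qed.

(** The constant term of a factor 'X_j + a - i vanishes for at most one i, and
    for one exactly when the j-th exponent drops from nonnegative to negative. *)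
Lemma d_op_factor gam u v : exists2 q : S, q@_0 != 0 &
  q * dmon R (nsupp (gam + ivec R v) :\: nsupp (gam + ivec R u)) =
  d_op (gam + ivec R v) (gam + ivec R u).
Proof.
pose a j := (gam + ivec R u) j 0.
pose k j := posz (u j 0 - v j 0).
pose q j : S := \prod_(i < k j | a j != i%:R) ('X_j + (a j - i%:R)%:MP).
exists (\prod_j q j).
  rewrite rmorph_prod; apply/prodf_neq0 => j _; rewrite rmorph_prod.
  apply/prodf_neq0 => i ai; rewrite /= mcoeffD mcoeffX mnm1_eq0 add0r mcoeffC eqxx mulr1.
  by rewrite subr_eq0.
rewrite d_opE dmonE -big_split; apply: eq_bigr => j _ /=.
rewrite -/(k j) (_ : gam j 0 + _ = a j) /falling; last by rewrite /a !mxE.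
rewrite [RHS](bigID (fun i : 'I_(k j) => a j != i%:R)) /=; congr (_ * _).
rewrite inE; set b := (_ && _).
(* the factor i with a_j = i is present exactly when a_j goes from >= 0 to < 0 *)
have bE : b = [exists i : 'I_(k j), a j == i%:R].
  apply/andP/existsP => [[nu nv]|[i /eqP ai]].
    have [z gvz] := nsupp_isint nv.
    have gz : gam j 0 = (z - v j 0)%:~R by move: gvz; rewrite !mxE intrB => <-;
      rewrite addrK.
    move: nu nv; rewrite (nsupp_int gvz) (nsupp_int (ivecDE u gz)) -leNgt => nu z0.
    have ik : (absz (z - v j 0 + u j 0)%R < k j)%N by rewrite /k /posz; lia.
    exists (Ordinal ik); rewrite /a (ivecDE u gz) /= -[_%:R]/((Posz _)%:~R).
    by apply/eqP; congr (_%:~R); lia.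
  have ai' : (gam + ivec R u) j 0 = (Posz i)%:~R by [].
  have gz : gam j 0 = (Posz i - u j 0)%:~R by move: ai'; rewrite !mxE intrB => <-;
    rewrite addrK.
  rewrite (nsupp_int ai') (nsupp_int (ivecDE v gz)).
  by have := ltn_ord i; rewrite {2}/k /posz; split; lia.
have [/existsP[i ai]|/existsPn nai] := boolP [exists i : 'I_(k j), a j == i%:R].
  rewrite bE (introT existsP) ?expr1; last by exists i.
  rewrite (big_pred1 i) => [|i']; first by rewrite (eqP ai) subrr mpolyC0 addr0.
  by rewrite negbK (eqP ai) eqr_nat eq_sym.
rewrite big_pred0 => [|i]; last by rewrite negbK (negbTE (nai i)).
by rewrite bE; case: existsP => [[i1]|//]; rewrite (negbTE (nai i1)).
Qed.

Section Ratios.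
Variables (d : nat) (A : 'M[int]_(d, n)) (beta : 'cV[C]_d) (Lam : set 'cV[C]_n).
Hypothesis LamP : exp_lattices A beta Lam.

Lemma lattice_ivec gam gam' : Lam gam -> Lam gam' -> exists u, gam' = gam + ivec R u.
Proof. by move=> Lg /(lattice_diff LamP Lg)[u _ ->]; exists u. Qed.

Lemma dt_op_spec gam gam' : Lam gam -> Lam gam' ->
  (dt_op gam' gam)@_0 != 0 /\
  dt_op gam' gam * dmon R (nsupp gam' :\: nsupp gam) = d_op gam' gam.
Proof.
move=> Lg /(lattice_ivec Lg)[u ->].
have [q q0 qE] := d_op_factor gam 0 u; rewrite /ivec map_mx0 addr0 in qE.
rewrite /dt_op; case: xgetP => [r _ rE|/(_ q)//]; split=> //.
by rewrite (mulIf (dmon_neq0 _) (etrans rE (esym qE))).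
Qed.

Lemma dt_op_unit gam gam' : Lam gam -> Lam gam' -> (dt_op gam' gam)@_0 != 0.
Proof. by move=> Lg /(dt_op_spec Lg)[]. Qed.

Lemma d_op_dt gam gam' : Lam gam -> Lam gam' ->
  d_op gam' gam = dmon R (nsupp gam' :\: nsupp gam) * dt_op gam' gam.
Proof. by move=> Lg /(dt_op_spec Lg)[_ <-]; rewrite mulrC. Qed.

Lemma dt_op_cocycle g g' g'' : Lam g -> Lam g' -> Lam g'' ->
  dt_op g' g * dt_op g'' g' * dt_op g g'' = dt_op g g' * dt_op g' g'' * dt_op g'' g.
Proof.
move=> Lg Lg' Lg''.
have dcoc : d_op g' g * d_op g'' g' * d_op g g'' = d_op g g' * d_op g' g'' * d_op g'' g.
  have [u ->] := lattice_ivec Lg Lg'; have [v ->] := lattice_ivec Lg Lg''.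
  have -> : g = g + ivec R 0 by rewrite /ivec map_mx0 addr0.
  rewrite -!addrA -!ivecD !add0r !d_opE -!big_split; apply: eq_bigr => j _ /=.
  exact: falling_cocycle.
apply: cancel_triple (dmon_cocycle (nsupp g) (nsupp g') (nsupp g'')) _ _.
  by rewrite !mulf_neq0 ?dmon_neq0.
by rewrite !d_op_dt in dcoc.
Qed.

End Ratios.
End FallingFactorials.

(** * The hypergeometric equations on coefficients *)

Section WeylAction.
Variables (R : realType) (n : nat).
Local Notation C := R[i].
Local Notation S := {mpoly C[n]}.
Local Notation Cn := 'cV[C]_n.
Implicit Types (phi : fseries C n) (m : 'X_{1..n}) (p : S) (j : 'I_n) (gam : Cn).

Definition wact phi (P : weyl C n) : fseries C n := weyl_act P phi.

Fact wact_additive phi : additive (wact phi).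
Proof.
move=> P Q; rewrite /wact; apply: (addIr (weyl_act Q phi)).
by rewrite -weyl_actD !subrK.
Qed.
HB.instance Definition _ phi :=
  GRing.isAdditive.Build (weyl C n) (fseries C n) (wact phi) (wact_additive phi).

Lemma fseriesMz phi (z : int) gam : (phi *~ z) gam = z%:~R *: phi gam.
Proof. by rewrite -scaler_int. Qed.

Lemma weyl_act_const (c : C) phi : weyl_act (weyl_const n c) phi = c *: phi.
Proof. exact: weyl_act_to_weyl. Qed.

Lemma weyl_act_dE j phi gam : weyl_act (weyl_d C j) phi gam =
  dact ('X_j + ((gam + evec C j) j 0)%:MP) (phi (gam + evec C j)).
Proof. by rewrite weyl_act_to_weyl /= dactDl dactXU dactC addrC. Qed.

Lemma weyl_act1 phi : weyl_act 1 phi = phi.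
Proof. by rewrite -[1]/(weyl_const n 1) weyl_act_const scale1r. Qed.

Lemma weyl_act_thetaE j phi gam :
  weyl_act (weyl_theta C j) phi gam = dact ('X_j + (gam j 0)%:MP) (phi gam).
Proof.
by rewrite weyl_actM weyl_act_to_weyl /= weyl_act_dE subrK.
Qed.

Definition nvec m : Cn := \col_j (m j)%:R.

Lemma nvecD m m' : nvec (m + m') = nvec m + nvec m'.
Proof. by apply/colP => j; rewrite !mxE mnmDE natrD. Qed.

(** The action of a monomial in the derivations on a series. *)
Definition shift_op m phi : fseries C n :=
  fun gam => dact (bracket (gam + nvec m) m) (phi (gam + nvec m)).

Lemma weyl_act_dX j k phi gam : weyl_act (weyl_d C j ^+ k) phi gam =
  dact (falling j (gam j 0 + k%:R) k) (phi (gam + evec C j *+ k)).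
Proof.
elim: k gam => [|k IHk] gam.
  by rewrite expr0 weyl_act1 falling0 dact1 mulr0n addr0.
rewrite exprS weyl_actM weyl_act_dE IHk -dactM -addrA -mulrS; congr (dact _ _).
rewrite -[in RHS](addn1 k) fallingD addn1 mulrC !mxE eqxx mulr1n /=.
rewrite {3}/falling big_ord1 subr0 -natr1 [k%:R + 1]addrC addrA.
by congr (_ * ('X_j + _%:MP)); rewrite addrK.
Qed.

Lemma weyl_act_mmap1 m phi : weyl_act (mmap1 (@weyl_d C n) m) phi = shift_op m phi.
Proof.
rewrite /mmap1; apply/funext => gam.
have gE (s : seq 'I_n) psi gam0 : uniq s ->
    weyl_act (\prod_(i <- s) weyl_d C i ^+ m i) psi gam0 =
    dact (\prod_(i <- s) falling i (gam0 i 0 + (m i)%:R) (m i))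
      (psi (gam0 + \sum_(i <- s) evec C i *+ m i)).
  elim: s gam0 => [|i s IHs] gam0 /=; first by rewrite !big_nil weyl_act1 dact1 addr0.
  case/andP=> nis us; rewrite !big_cons weyl_actM weyl_act_dX IHs // -dactM addrA.
  congr (dact (_ * _) _); rewrite !big_seq; apply: eq_bigr => j js.
  rewrite mxE mulmxnE mxE (_ : (j == i) = false) ?mul0rn ?addr0 //.
  by apply: contraNF nis => /eqP <-.
rewrite gE ?index_enum_uniq // /shift_op bracketE.
have -> : \sum_i evec C i *+ m i = nvec m.
  apply/colP => j; rewrite summxE mxE (bigD1 j) //= big1 => [|i ij].
    by rewrite mulmxnE mxE !eqxx addr0.
  by rewrite mulmxnE mxE eq_sym (negbTE ij) mul0rn.
by congr (dact _ _); apply: eq_bigr => j _; rewrite !mxE.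
Qed.

Definition dpact phi p : fseries C n := weyl_act (weyl_of_dpoly p) phi.

Lemma dpact_ext phi p : dpact phi p = monomial_ext (shift_op^~ phi) p.
Proof.
rewrite /dpact /weyl_of_dpoly /mmap -/(wact phi _) raddf_sum /=.
by apply: eq_bigr => m _; rewrite /wact weyl_actM weyl_act_const weyl_act_mmap1.
Qed.

Fact dpact_linear phi : linear (dpact phi).
Proof. by move=> a s t; rewrite !dpact_ext linearP. Qed.
HB.instance Definition _ phi := GRing.isLinear.Build C S (fseries C n) *:%R (dpact phi)
  (dpact_linear phi).

Lemma dpactX phi m : dpact phi 'X_[m] = shift_op m phi.
Proof. by rewrite dpact_ext monomial_extX. Qed.

Lemma shift_op_linear m : linear (shift_op m).
Proof.
move=> a phi psi; apply/funext => gam.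
by rewrite /shift_op !fctE linearD (linearZ_LR (dact _)).
Qed.
HB.instance Definition _ m := GRing.isLinear.Build C (fseries C n) (fseries C n) *:%R
  (shift_op m) (shift_op_linear m).

Lemma shift_opD m m' phi : shift_op (m + m') phi = shift_op m (shift_op m' phi).
Proof.
apply/funext => gam; rewrite /shift_op -dactM nvecD addrA; congr (dact _ _).
rewrite !bracketE -big_split; apply: eq_bigr => j _ /=.
rewrite mnmDE addnC fallingD mulrC; congr (falling _ _ _ * _).
by rewrite !mxE addrK.
Qed.

Lemma dpact_XM phi m p : dpact phi ('X_[m] * p) = shift_op m (dpact phi p).
Proof.
elim/mpolyind: p => [|a m' p _ _ IHp].
  by rewrite mulr0 !raddf0.
rewrite mulrDr !raddfD /= IHp -scalerAr !linearZ_LR /= -mpolyXD !dpactX.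
by rewrite shift_opD.
Qed.

Lemma dpact_eq0M phi s p : dpact phi p = 0 -> dpact phi (s * p) = 0.
Proof.
move=> p0; elim/mpolyind: s => [|a m s _ _ IHs]; first by rewrite mul0r raddf0.
by rewrite mulrDl raddfD /= IHs -scalerAl linearZ_LR /= dpact_XM p0 raddf0 scaler0 addr0.
Qed.

End WeylAction.

Section Equations.
Variables (R : realType) (d n : nat) (A : 'M[int]_(d, n)) (beta : 'cV[R[i]]_d).
Local Notation C := R[i].
Variable Lam : set 'cV[C]_n.
Hypothesis LamP : exp_lattices A beta Lam.
Implicit Types (phi : fseries C n) (gam lam : 'cV[C]_n).

Lemma pos_partE (u : 'cV[int]_n) : pos_part u = [multinom posz (u j 0)%R | j < n].
Proof. by []. Qed.

Lemma nvec_pos_part (u : 'cV[int]_n) :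
  nvec R (pos_part u) = ivec R u + nvec R (pos_part (- u)).
Proof.
apply/colP => j; rewrite !mxE !mnmE mxE -![_%:R]/((Posz _)%:~R) -intrD.
by congr (_%:~R); move: (u j 0) => z; lia.
Qed.

(** At an exponent del the binomial of u compares the coefficients at
    del + u_+ and del + u_-, whose difference is u. *)
Lemma toric_act phi (u : 'cV[int]_n) del :
  let gam := del + nvec R (pos_part u) in
  let gam' := del + nvec R (pos_part (- u)) in
  gam = gam' + ivec R u /\
  dpact phi ('X_[pos_part u] - 'X_[pos_part (- u)]) del =
  dact (d_op gam' gam) (phi gam) - dact (d_op gam gam') (phi gam').
Proof.
move=> gam gam'; have gE : gam = gam' + ivec R u.
  by rewrite /gam /gam' nvec_pos_part -addrA; congr (_ + _); exact: addrC.
split=> //; have g'E : gam' = gam' + ivec R 0 by rewrite /ivec map_mx0 addr0.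
have -> : d_op gam' gam = bracket gam (pos_part u).
  rewrite /d_op; congr bracket; rewrite gE {2}g'E diff_posE pos_partE.
  by apply/mnmP => j; rewrite !mnmE mxE subr0.
have -> : d_op gam gam' = bracket gam' (pos_part (- u)).
  rewrite /d_op; congr bracket; rewrite gE {1}g'E diff_posE pos_partE.
  by apply/mnmP => j; rewrite !mnmE !mxE sub0r.
by rewrite raddfB /= !dpactX.
Qed.

Lemma euler_actE phi i gam :
  weyl_act (euler_op R A i - weyl_const n (beta i 0)) phi gam =
  dact (eulerS R A i) (phi gam) +
    ((map_mx intr A *m gam) i 0 - beta i 0) *: phi gam.
Proof.
rewrite -/(wact phi _) raddfB raddf_sum /= !fctE /wact weyl_act_const.
rewrite fct_sumE /eulerS dact_suml.
have -> : \sum_(j < n) wact phi (weyl_theta C j *~ A i j) gam =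
    \sum_(j < n) (dact ('X_j *~ A i j) (phi gam) + ((A i j)%:~R * gam j 0) *: phi gam).
  apply: eq_bigr => j _.
  rewrite raddfMz fseriesMz /= /wact weyl_act_thetaE.
  by rewrite -[X in _ = dact X _ + _]scaler_int dactZl dactDl dactC scalerDr scalerA.
rewrite big_split /= -scaler_suml -addrA -scalerBl mxE.
by congr (_ + (_ - _) *: _); apply: eq_bigr => j _; rewrite mxE.
Qed.

Lemma euler_act phi i gam : Lam gam ->
  weyl_act (euler_op R A i - weyl_const n (beta i 0)) phi gam =
  dact (eulerS R A i) (phi gam).
Proof.
move=> Lg.
by rewrite euler_actE (lattice_beta LamP Lg) subrr scale0r addr0.
Qed.

Definition toric_eqs phi := forall gam gam', Lam gam -> Lam gam' ->
  dact (d_op gam' gam) (phi gam) = dact (d_op gam gam') (phi gam').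
Definition euler_eqs phi := forall gam i, Lam gam -> dact (eulerS R A i) (phi gam) = 0.

Lemma annihilator_submodule phi :
  submodule ([set P | weyl_act P phi = 0] : set (weyl C n)^o).
Proof.
apply/submoduleP; split=> [|P Q T /= Q0 T0].
  by rewrite /= -/(wact phi _) raddf0.
by rewrite weyl_actD weyl_actM Q0 T0 addr0; exact: wexpr_act0.
Qed.

(** It suffices to test the generators, since the annihilator of a series is a
    left ideal and the operators in C[d] that kill it form an ideal. Conversely a
    pair of exponents differing by u in L is the pair at del = gam - u_+. *)
Lemma hyp_ideal_eqs phi : Supp phi `<=` Lam ->
  (forall P, hyp_ideal A beta P -> weyl_act P phi = 0) <-> toric_eqs phi /\ euler_eqs phi.
Proof.
move=> supp; have supp0 gam : ~ Lam gam -> phi gam = 0.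
  by move=> nLg; apply: contrapT => /eqP /supp.
split=> [Hphi|[Tphi Ephi]].
  split=> [gam gam' Lg Lg'|gam i Lg]; last first.
    by rewrite -euler_act // Hphi //; apply: sub_lspan; right; exists i.
  have [u ku gE] := lattice_diff LamP Lg' Lg.
  have := toric_act phi u (gam - nvec R (pos_part u)) => /=.
  rewrite subrK => -[gE' tE].
  have g'E : gam' = gam - nvec R (pos_part u) + nvec R (pos_part (- u)).
    by apply: (addIr (ivec R u)); rewrite -gE.
  rewrite -g'E in tE; apply/eqP; rewrite -subr_eq0 -tE.
  rewrite [dpact _ _](_ : _ = 0) //; apply: Hphi; apply: sub_lspan; left.
  by eexists; last by []; apply: sub_lspan; exists u.
rewrite /hyp_ideal; apply: (lspan_min (annihilator_submodule phi)) => P [[p pT <-]|[i _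
  <-]].
  suff /(_ p pT) : toric_ideal A `<=` [set p | dpact phi p = 0] by [].
  have sK : submodule ([set p | dpact phi p = 0] : set {mpoly C[n]}^o).
    apply/submoduleP; split=> [|s q q' /= q0 q'0]; first exact: (raddf0 (dpact phi)).
    rewrite -[_ + _]/(s * q + q' : {mpoly C[n]}) (raddfD (dpact phi)) /= q'0 addr0.
    exact: dpact_eq0M.
  apply: (lspan_min sK) => _ [u ku <-]; apply/funext => del.
  have /= [gE ->] := toric_act phi u del.
  set gam := del + nvec R (pos_part u) in gE *; set gam' := del + _ in gE *.
  have [Lg'|nLg'] := pselect (Lam gam').
    have Lg : Lam gam by rewrite gE; exact: lattice_add LamP _ _ Lg' ku.
    by rewrite Tphi // subrr.
  have nLg : ~ Lam gam.
    move=> Lg; apply: nLg'; rewrite -(addrK (ivec R u) gam') -gE -ivecN.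
    by apply: lattice_add LamP _ _ Lg _; exact: kerZN.
  by rewrite !supp0 // !linear0 ?addr0.
apply/funext => gam; have [Lg|nLg] := pselect (Lam gam).
  by rewrite euler_act // Ephi.
by rewrite euler_actE supp0 // linear0 scaler0 addr0.
Qed.

End Equations.

(** * Normalized coefficients *)

(** Here a r = b p and a' r' = b' p' define p and p' from r and r'. Multiplying
    the left equation by a a' gives the right one times t a' b. *)
Lemma transfer_equation (F : fieldType) n (a a' b b' t t' x x' r r' p p' : {mpoly F[n]}) :
  dact a r = dact b p -> dact a' r' = dact b' p' ->
  a@_0 != 0 -> a'@_0 != 0 -> b@_0 != 0 -> t@_0 != 0 ->
  t * a' * b = t' * b' * a ->
  dact (x * t) r = dact (x' * t') r' <-> dact x p = dact x' p'.
Proof.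
move=> rp r'p' a0 a'0 b0 t0 cocycle.
have lhs : dact (a * a') (dact (x * t) r) = dact (t * a' * b) (dact x p).
  rewrite -dactM [_ * (x * t)](_ : _ = x * t * a' * a); last by ring.
  by rewrite dactM rp -!dactM; congr (dact _ _); ring.
have rhs : dact (a * a') (dact (x' * t') r') = dact (t * a' * b) (dact x' p').
  rewrite -dactM [_ * (x' * t')](_ : _ = x' * t' * a * a'); last by ring.
  by rewrite dactM r'p' cocycle -!dactM; congr (dact _ _); ring.
have E0 : (t * a' * b)@_0 != 0 by rewrite !rmorphM !mulf_neq0.
have F0 : (a * a')@_0 != 0 by rewrite rmorphM mulf_neq0.
split=> [eq_r|eq_p]; first by apply: (dact_bij_inj E0); rewrite -lhs eq_r rhs.
by apply: (dact_bij_inj F0); rewrite lhs eq_p rhs.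
Qed.

Section Normalization.
Variables (R : realType) (d n : nat) (A : 'M[int]_(d, n)) (beta : 'cV[R[i]]_d).
Local Notation C := R[i].
Local Notation S := {mpoly C[n]}.
Variable w : 'cV[R]_n.
Hypothesis w_generic : L_generic A w.
Variable Lam : set 'cV[C]_n.
Hypothesis LamP : exp_lattices A beta Lam.
Variable lam : 'cV[C]_n.
Hypothesis Llam : Lam lam.
Implicit Types (phi : fseries C n) (gam : 'cV[C]_n) (c : {ffun NSidx Lam -> S}).
Implicit Types (I J K : NSidx Lam).

Lemma dmon0 : dmon R (finset.set0 : {set 'I_n}) = 1.
Proof. by rewrite /dmon big_set0. Qed.

Lemma dact_inv_linear (s : S) : s@_0 != 0 -> linear (dact_inv s).
Proof.
move=> s0 a p q; apply: (dact_bij_inj s0).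
by rewrite linearD (linearZ_LR (dact s)) /= !dact_invK.
Qed.

Lemma norm_coeffP phi gam (p : S) : Lam gam ->
  norm_coeff lam phi gam = p <-> dact (dt_op lam gam) (phi gam) = dact (dt_op gam lam) p.
Proof. by move=> Lg; apply: dact_invP; exact: dt_op_unit LamP _ _ Llam Lg. Qed.

Lemma norm_coeff_eq0 phi gam : Lam gam -> norm_coeff lam phi gam = 0 <-> phi gam = 0.
Proof.
move=> Lg; rewrite norm_coeffP // linear0; split=> [E|->]; last exact: linear0.
by apply: (dact_bij_inj (dt_op_unit LamP Lg Llam)); rewrite E linear0.
Qed.

(** The cocycle identity turns the toric equation between two exponents into an
    equation that only sees their negative supports. *)
Lemma norm_coeff_toric phi gam gam' : Lam gam -> Lam gam' ->
  dact (d_op gam' gam) (phi gam) = dact (d_op gam gam') (phi gam') <->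
  dact (dmon R (nsupp gam' :\: nsupp gam)) (norm_coeff lam phi gam) =
  dact (dmon R (nsupp gam :\: nsupp gam')) (norm_coeff lam phi gam').
Proof.
move=> Lg Lg'; set p := norm_coeff lam phi gam; set p' := norm_coeff lam phi gam'.
have pE : dact (dt_op lam gam) (phi gam) = dact (dt_op gam lam) p by apply/norm_coeffP.
have p'E : dact (dt_op lam gam') (phi gam') = dact (dt_op gam' lam) p'.
  by apply/norm_coeffP.
rewrite (d_op_dt LamP Lg Lg') (d_op_dt LamP Lg' Lg).
apply: (transfer_equation _ _ pE p'E); rewrite ?(dt_op_unit LamP) //.
exact: (dt_op_cocycle LamP).
Qed.

Lemma norm_coeff_stratum phi I gam gam' : toric_eqs Lam phi ->
  stratum Lam (sval I) gam -> stratum Lam (sval I) gam' ->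
  norm_coeff lam phi gam = norm_coeff lam phi gam'.
Proof.
move=> Tphi [Lg gI] [Lg' g'I].
have := (norm_coeff_toric phi Lg Lg').1 (Tphi _ _ Lg Lg').
rewrite gI g'I finset.setDv dmon0 => E.
exact: etrans (esym (dact1 _)) (etrans E (dact1 _)).
Qed.

Lemma normalizeE phi I gam : toric_eqs Lam phi -> stratum Lam (sval I) gam ->
  normalize lam Lam phi I = norm_coeff lam phi gam.
Proof.
move=> Tphi Ig; rewrite ffunE; case: xgetP => [p _ /(_ _ Ig) //|].
move=> /(_ (norm_coeff lam phi gam)) [] gam' Ig'.
exact: norm_coeff_stratum Ig' Ig.
Qed.

Lemma realizeE c I gam : stratum Lam (sval I) gam ->
  realize lam c gam = dact_inv (dt_op lam gam) (dact (dt_op gam lam) (c I)).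
Proof.
move=> [Lg gI]; rewrite /realize (big_pred1 I) // => J /=.
apply/idP/eqP => [/set_mem[_ gJ]|->]; last exact/mem_set.
by apply: val_inj; rewrite /= -gJ -gI.
Qed.

Lemma realize_out c gam : ~ Lam gam -> realize lam c gam = 0.
Proof.
by move=> nLg; rewrite /realize big_pred0 // => I; apply/negP => /set_mem[].
Qed.

Lemma Supp_realize c : Supp (realize lam c) `<=` Lam.
Proof.
move=> gam Sg; apply: contrapT => nLg; move: Sg.
by rewrite /Supp /= realize_out // eqxx.
Qed.

Lemma norm_realize c I gam : stratum Lam (sval I) gam ->
  norm_coeff lam (realize lam c) gam = c I.
Proof.
move=> /[dup] Ig [Lg _]; apply/norm_coeffP => //.
by rewrite (realizeE _ Ig) dact_invK // (dt_op_unit LamP).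
Qed.

Lemma normalize_realize c : normalize lam Lam (realize lam c) = c.
Proof.
apply/ffunP => I; rewrite ffunE; have [gam Ig] := in_NS I.
case: xgetP => [p _ /(_ _ Ig) <-|/(_ (c I))[] gam' Ig']; exact: norm_realize.
Qed.

Lemma realize_norm phi : Supp phi `<=` Lam -> toric_eqs Lam phi ->
  realize lam (normalize lam Lam phi) = phi.
Proof.
move=> supp Tphi; apply/funext => gam; have [Lg|nLg] := pselect (Lam gam); last first.
  by rewrite realize_out //; apply/esym; apply: contrapT => /eqP /supp.
have Ig : stratum Lam (sval (ns_of Lg)) gam by [].
rewrite (realizeE _ Ig) (normalizeE Tphi Ig); apply/dact_invP.
  exact: dt_op_unit LamP _ _ Lg Llam.
by rewrite /norm_coeff dact_invK // (dt_op_unit LamP).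
Qed.

Lemma realize_linear : linear (@realize R n lam Lam).
Proof.
move=> a c c'; apply/funext => gam; have [Lg|nLg] := pselect (Lam gam); last first.
  by rewrite !fctE !realize_out // scaler0 addr0.
have Ig : stratum Lam (sval (ns_of Lg)) gam by [].
have u0 := dt_op_unit LamP Lg Llam.
rewrite !fctE !(realizeE _ Ig) !ffunE linearD (linearZ_LR (dact _)) /=.
exact: dact_inv_linear.
Qed.

Lemma realize0 : realize lam (0 : {ffun NSidx Lam -> S}) = 0.
Proof.
by have := realize_linear (- 1) 0 0; rewrite scaler0 addr0 scaleN1r addNr.
Qed.

Definition gluing c := forall I J,
  dact (dmon R (sval J :\: sval I)) (c I) = dact (dmon R (sval I :\: sval J)) (c J).

Lemma realize_toric c : toric_eqs Lam (realize lam c) <-> gluing c.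
Proof.
split=> [T I J|G gam gam' Lg Lg'].
  have [gam Ig] := in_NS I; have [gam' Jg'] := in_NS J.
  have := (norm_coeff_toric _ Ig.1 Jg'.1).1 (T _ _ Ig.1 Jg'.1).
  by rewrite (norm_realize _ Ig) (norm_realize _ Jg') Ig.2 Jg'.2.
apply/(norm_coeff_toric _ Lg Lg').
have Ig : stratum Lam (sval (ns_of Lg)) gam by [].
have Ig' : stratum Lam (sval (ns_of Lg')) gam' by [].
by rewrite (norm_realize _ Ig) (norm_realize _ Ig'); exact: G (ns_of Lg) (ns_of Lg').
Qed.

Lemma realize_euler c :
  euler_eqs A Lam (realize lam c) <-> forall I i, dact (eulerS R A i) (c I) = 0.
Proof.
have key gam I i : stratum Lam (sval I) gam ->
    dact (eulerS R A i) (realize lam c gam) = 0 <-> dact (eulerS R A i) (c I) = 0.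
  move=> /[dup] Ig [Lg _]; rewrite (realizeE _ Ig).
  have u0 := dt_op_unit LamP Lg Llam; have v0 := dt_op_unit LamP Llam Lg.
  split=> [E0|E0].
    apply: (dact_bij_inj v0);
      rewrite linear0 dact_comm -[dact (dt_op gam lam) _](dact_invK _ u0).
    by rewrite dact_comm E0 linear0.
  by apply: (dact_bij_inj u0); rewrite linear0 dact_comm dact_invK // dact_comm E0 linear0.
split=> [E I i|E gam i Lg].
  by have [gam Ig] := in_NS I; apply/(key gam) => //; apply: E; case: Ig.
by apply/(key gam (ns_of Lg)).
Qed.

Lemma realize_eq0 c I gam : stratum Lam (sval I) gam ->
  realize lam c gam = 0 <-> c I = 0.
Proof.
by move=> /[dup] Ig [Lg _]; rewrite -norm_coeff_eq0 // (norm_realize _ Ig).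
Qed.

Lemma Supp_realizeP c gam :
  Supp (realize lam c) gam <-> exists2 I, stratum Lam (sval I) gam & c I != 0.
Proof.
split=> [Sg|[I Ig cI]].
  have Lg := Supp_realize Sg.
  have Ig : stratum Lam (sval (ns_of Lg)) gam by [].
  exists (ns_of Lg) => //; apply/eqP => /(realize_eq0 c Ig) E.
  by move: Sg; rewrite /Supp /= E eqxx.
by apply/eqP => /(realize_eq0 c Ig) E; move: cI; rewrite E eqxx.
Qed.

Definition minimal_at c K := [/\ c K != 0 &
  forall J, c J != 0 -> wdot w (vmin w K) <= wdot w (vmin w J)].

Lemma acc_bounded I : acc w Lam I -> Bw w Lam I.
Proof. by apply; exact: subxx. Qed.

Lemma Coeff_acc c I : Coeff A w Lam c -> c I != 0 -> acc w Lam I.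
Proof. by case=> _ _ c0 cI; apply: contrapT => /c0/eqP; apply/negP. Qed.

(** The support is a union of strata, so its minimum is the least of their
    minima. *)
Lemma Supp_wmin c K : Coeff A w Lam c -> minimal_at c K ->
  is_wmin w (Supp (realize lam c)) (vmin w K).
Proof.
move=> cC [cK minK]; apply/is_wminE.
have bdd J : c J != 0 -> is_wmin w (stratum Lam (sval J)) (vmin w J).
  by move=> cJ; apply: (vminP w_generic LamP); apply: acc_bounded; exact: Coeff_acc cC cJ.
split; first by apply/Supp_realizeP; exists K => //; case: (bdd _ cK).
move=> gam /Supp_realizeP[J Jg cJ]; apply: le_trans (minK _ cJ) _.
by have /is_wminE[_] := bdd _ cJ; apply.
Qed.

Lemma exists_minimal c : c != 0 -> exists K, minimal_at c K.
Proof.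
move=> c0; have [I cI] : exists I, c I != 0.
  apply: contrapT => /forallNP cI0; case/eqP: c0; apply/ffunP => I.
  by rewrite ffunE; apply/eqP/negPn/negP/cI0.
have := @Order.TotalTheory.arg_minP _ _ _ I (fun I => c I != 0) (fun I => wdot w (vmin w
  I)) cI.
by case=> K cK minK; exists K; split.
Qed.

Lemma realize_Sol c : Coeff A w Lam c -> Sol A beta w Lam (realize lam c).
Proof.
move=> /[dup] cC [cE cG cA]; split.
- move=> gam /Supp_realize Lg; exists gam => //; exists 0 => //.
  by rewrite map_mx0 addr0.
- exact: Supp_realize.
- apply/(hyp_ideal_eqs LamP); first exact: Supp_realize.
  by split; [apply/realize_toric | apply/realize_euler].
have [->|c0] := eqVneq c 0.
  by left; exact: realize0.
have [K minK] := exists_minimal c0.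
by right; exists (vmin w K); exact: Supp_wmin.
Qed.

(** A nonzero coefficient at I forces nonzero coefficients at all smaller
    negative supports, whose strata then lie in the support of the series. *)
Lemma Sol_realize phi : Sol A beta w Lam phi ->
  exists2 c, Coeff A w Lam c & phi = realize lam c.
Proof.
move=> [_ supp /(hyp_ideal_eqs LamP supp)[T E] minphi].
pose c := normalize lam Lam phi; have phiE := realize_norm supp T.
exists c => //; rewrite -phiE in T E; have G := (realize_toric c).1 T.
split=> //; first exact/realize_euler.
move=> I nI; apply: contrapT => /eqP cI; apply: nI => J JI.
have cJ : c J != 0.
  apply: contraNneq cI => cJ0; have := G I J; rewrite cJ0 linear0.
  by move: JI; rewrite -finset.setD_eq0 => /eqP ->; rewrite dmon0 dact1 => /eqP.
have sub : stratum Lam (sval J) `<=` Supp phi.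
  by move=> gam Jg; rewrite -phiE; apply/Supp_realizeP; exists J.
case: minphi => [phi0|[gam mg]]; last exact: wmin_bounded supp mg sub.
have [gam Jg] := in_NS J; have := sub _ Jg.
by rewrite phi0 /Supp /= eqxx.
Qed.

Lemma Coeff_sub : submodule (Coeff A w Lam).
Proof.
apply/submoduleP; split=> [|a c c' [cE cG cA] [c'E c'G c'A]].
  by split=> [I i|I J|I _]; rewrite !ffunE // ?linear0.
split=> [I i|I J|I nI]; rewrite !ffunE.
- by rewrite linearD (linearZ_LR (dact _)) /= cE c'E scaler0 addr0.
- by rewrite !(linearD (dact _)) !(linearZ_LR (dact _)) /= cG c'G.
- by rewrite cA // c'A // scaler0 addr0.
Qed.

Lemma Sol_sub : submodule (Sol A beta w Lam).
Proof.
have C0 := submodule0 Coeff_sub; have /submoduleP[_ CL] := Coeff_sub.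
apply/submoduleP; split; first by rewrite -realize0; exact: realize_Sol.
move=> a _ _ /Sol_realize[c cC ->] /Sol_realize[c' c'C ->].
by rewrite -realize_linear; apply: realize_Sol; exact: CL.
Qed.

Lemma normalize_iso : linear_iso_on (Sol A beta w Lam) (Coeff A w Lam) (normalize lam Lam).
Proof.
split; [exact: Sol_sub | exact: Coeff_sub | |].
  move=> a _ _ /Sol_realize[c cC ->] /Sol_realize[c' c'C ->].
  rewrite -realize_linear; apply: etrans (normalize_realize _) _.
  by congr (_ *: _ + _); apply/esym; exact: normalize_realize.
split=> [_ /Sol_realize[c cC ->]|phi psi /set_mem/Sol_realize[c cC ->]|c cC].
- by rewrite normalize_realize.
- move=> /set_mem/Sol_realize[c' _ ->].
  move=> E; congr realize.
  exact: etrans (esym (normalize_realize c)) (etrans E (normalize_realize c')).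
- by exists (realize lam c); [exact: realize_Sol | exact: normalize_realize].
Qed.

Lemma norm_coeff_Sol phi : Sol A beta w Lam phi -> forall I gam,
  stratum Lam (sval I) gam -> norm_coeff lam phi gam = normalize lam Lam phi I.
Proof.
by move=> /Sol_realize[c cC ->] I gam Ig; rewrite normalize_realize; exact: norm_realize.
Qed.

End Normalization.

(** * Finite length of M^dir *)

Lemma clear_denominators p q (V : 'M[rat]_(p, q)) :
  exists2 N : int, N != 0 & exists V' : 'M[int]_(p, q),
    N%:~R *: V = map_mx intr V'.
Proof.
exists (\prod_(ij : 'I_p * 'I_q) denq (V ij.1 ij.2)).
  by apply/prodf_neq0 => ij _; exact: denq_neq0.
exists (\matrix_(i, j) (numq (V i j) *
   \prod_(ij : 'I_p * 'I_q | ij != (i, j)) denq (V ij.1 ij.2))).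
apply/matrixP => i j; rewrite !mxE (bigD1 (i, j)) //= !rmorphM /= numqE.
by rewrite mulrC mulrA.
Qed.

(** An integral matrix with trivial kernel has a left inverse over Q, hence one
    over Z up to a nonzero factor. *)
Lemma int_left_inverse p q (M : 'M[int]_(p, q)) :
  (forall u : 'cV[int]_q, M *m u = 0 -> u = 0) ->
  exists2 N : int, N != 0 & exists B : 'M[int]_(q, p), B *m M = N%:M.
Proof.
move=> kerM; pose MQ : 'M[rat]_(p, q) := map_mx intr M.
have full : row_full MQ.
  rewrite /row_full -mxrank_tr -/(row_free _) -kermx_eq0; apply/negPn/negP.
  move=> /rowV0Pn[v /sub_kermxP vM /eqP]; apply.
  have [N N0 [V' NV]] := clear_denominators v.
  have : V'^T = 0.
    apply: kerM; apply/matrixP => i j; rewrite [j]ord1.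
    have : (map_mx intr (M *m V'^T) : 'cV[rat]_p) i 0 = 0.
      rewrite map_mxM -matrix.map_trmx -NV -/MQ linearZ /= -scalemxAr.
      by rewrite -[MQ]trmxK -trmx_mul vM trmx0 scaler0 mxE.
    by rewrite mxE => /eqP; rewrite intr_eq0 => /eqP ->; rewrite mxE.
  move/(congr1 trmx); rewrite trmxK trmx0 => V0; move: NV; rewrite V0 map_mx0.
  by move/eqP; rewrite scalemx_eq0 intr_eq0 (negbTE N0) => /eqP.
have [B BM] := row_fullP full; have [N N0 [B' NB]] := clear_denominators B.
exists N => //; exists B'; apply/matrixP => i j.
have : (map_mx intr (B' *m M) : 'M[rat]_q) i j = (N%:~R *: 1%:M : 'M[rat]_q) i j.
  by rewrite map_mxM -NB -scalemxAl BM.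
rewrite [LHS]mxE [RHS]mxE [X in _ * X]mxE.
rewrite (_ : (i == j)%:R = ((i == j)%:R : int)%:~R) -?rmorphM; last by case: (i == j).
by move/intr_inj => ->; rewrite mxE; case: (i == j); rewrite ?mulr1 ?mulr0.
Qed.

(** The equations of [A] together with the vanishing of the coordinates in [E]. *)
Definition with_coords d n (A : 'M[int]_(d, n)) (E : {set 'I_n}) : 'M[int]_(d + n, n) :=
  col_mx A (diag_mx (\row_j (j \in E)%:R)).

Lemma with_coordsE (F : pzRingType) d n (A : 'M[int]_(d, n)) E (x : 'cV[F]_n) :
  map_mx intr (with_coords A E) *m x =
  col_mx (map_mx intr A *m x) (\col_j ((j \in E)%:R * x j 0)).
Proof.
rewrite map_col_mx mul_col_mx; congr col_mx; apply/colP => j.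
rewrite !mxE (bigD1 j) //= big1 ?addr0 => [|k kj].
  by rewrite !mxE eqxx mulr1n; case: (j \in E).
by rewrite !mxE eq_sym (negbTE kj) mulr0n mul0r.
Qed.

Lemma with_coords_left_inverse d n (A : 'M[int]_(d, n)) (E : {set 'I_n}) :
  (forall u, kerZ A u -> (forall j, j \in E -> u j 0 = 0) -> u = 0) ->
  exists2 N : int, N != 0 & exists B : 'M[int]_(n, d + n),
    B *m with_coords A E = N%:M.
Proof.
move=> kerA; apply: int_left_inverse => u.
have := with_coordsE A E u; rewrite !map_mx_id; last 2 first.
- by move=> z; rewrite intz.
- by move=> z; rewrite intz.
move=> -> /eqP; rewrite col_mx_eq0 => /andP[/eqP Au /eqP/colP uE].
by apply: kerA => // j jE; have := uE j; rewrite !mxE jE mul1r.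
Qed.

Section Module.
Variables (R : realType) (d n : nat) (A : 'M[int]_(d, n)) (beta : 'cV[R[i]]_d).
Local Notation C := R[i].
Local Notation S := {mpoly C[n]}.
Variable w : 'cV[R]_n.
Hypothesis w_generic : L_generic A w.
Variable Lam : set 'cV[C]_n.
Hypothesis LamP : exp_lattices A beta Lam.
Implicit Types (c : {ffun NSidx Lam -> S}) (I J K : NSidx Lam) (m : 'X_{1..n}).
Implicit Types (x y : Ffree Lam).

Lemma ffree_decomp x : x = \sum_I (x I : S) *: estar I.
Proof.
apply/ffunP => J; rewrite sum_ffunE (bigD1 J) //= big1 => [|I IJ].
  by rewrite !ffunE eqxx addr0; apply/esym; exact: mulr1.
by rewrite !ffunE eq_sym (negbTE IJ); exact: mulr0.
Qed.

Definition mset (J : {set 'I_n}) : 'X_{1..n} := [multinom (j \in J : nat) | j < n].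

Lemma dmonX (J : {set 'I_n}) : dmon R J = 'X_[mset J].
Proof. by rewrite dmonE mpolyXE_id; apply: eq_bigr => j _; rewrite mnmE. Qed.

Local Notation N := (lspan (Mrel A w Lam)).

Lemma Mrel_unacceptable I J (s : S) : ~ acc w Lam J ->
  N (s *: (dmon R (sval J :\: sval I) *: estar I)).
Proof.
move=> nJ; have sN := @lspan_submodule _ _ (Mrel A w Lam).
apply: (submoduleZ _ sN).
rewrite -(subrK (dmon R (sval I :\: sval J) *: estar J) (_ *: estar I)).
apply: (submoduleD sN).
  by apply: sub_lspan; left; right; exists I => //; exists J.
by apply: (submoduleZ _ sN); apply: sub_lspan; right; exists J.
Qed.

Lemma Mrel_linear_form I (s : S) (b : 'I_d -> C) :
  N (s *: ((\sum_i b i *: eulerS R A i) *: estar I)).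
Proof.
have sN := @lspan_submodule _ _ (Mrel A w Lam).
apply: (submoduleZ _ sN); rewrite scaler_suml; apply: (submodule_sum _ sN) => i _.
rewrite -mul_mpolyC -scalerA; apply: (submoduleZ _ sN).
by apply: sub_lspan; left; left; exists i => //; exists I.
Qed.

(** If the support of a monomial contains no J - I with J unacceptable, the
    columns of [A] in that support are independent, since a relation between them
    would lead to an unbounded stratum. A repeated variable of the monomial can
    then be traded, modulo the linear forms, for variables outside the support.
    So the support grows, at constant degree, until it contains such a J - I. *)
Lemma Mrel_monomial I m : (n < mdeg m)%N -> N ('X_[m] *: estar I).
Proof.
pose supp m : {set 'I_n} := [set j | m j != 0%N]%SET.
have sN := @lspan_submodule _ _ (Mrel A w Lam).
have [k le_k] := ubnP (n - #|supp m|); elim: k m le_k => // k IHk m le_k nm.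
have [[J nJ JI]|nface] := pselect (exists2 J, ~ acc w Lam J &
    sval J :\: sval I \subset supp m).
  have le_Jm : (mset (sval J :\: sval I) <= m)%MM.
    apply/mnm_lepP => j; rewrite mnmE.
    case: (boolP (j \in _)) => // /(fintype.subsetP JI); rewrite inE lt0n.
    by rewrite -lt0n.
  by rewrite -(submK le_Jm) mpolyXD -scalerA -dmonX; exact: Mrel_unacceptable.
(* a monomial of degree greater than n has a repeated variable *)
have [j mj] : exists j, (1 < m j)%N.
  apply: contrapT => /forallNP m1; move: nm; rewrite mdegE; apply/negP; rewrite -leqNgt.
  rewrite -[X in (_ <= X)%N]card_ord -sum1_card; apply: leq_sum => j _.
  by rewrite leqNgt; apply/negP/m1.
have [|M M0 [B BM]] := @with_coords_left_inverse d n A (~: supp m)%SET.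
  move=> u ku u0; apply/eqP/negPn/negP => nz_u; apply: nface.
  have [J nbJ uJ] := unbounded_stratum w_generic LamP I ku nz_u.
  exists J; first by move/acc_bounded.
  apply/fintype.subsetP => j' /uJ; apply: contraNT => nj'.
  by rewrite u0 // finset.in_setC.
(* row j of the left inverse is a combination l of the Euler forms that is 'X_j up
   to variables outside the support *)
pose b i := (B j (lshift n i))%:~R / M%:~R : C.
pose l : S := \sum_i b i *: eulerS R A i.
pose c' j' := (B j (rshift d j'))%:~R / M%:~R : C.
have lE : l = 'X_j - \sum_(j' | j' \notin supp m) c' j' *: 'X_j'.
  have lE : l = \sum_j' (\sum_i b i * (A i j')%:~R) *: 'X_j'.
    rewrite /l /eulerS; under eq_bigr => i _ do rewrite scaler_sumr.
    rewrite exchange_big; apply: eq_bigr => j' _; rewrite scaler_suml.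
    by apply: eq_bigr => i _; rewrite -scaler_int scalerA.
  rewrite lE -sumrN [X in _ = _ + X]big_mkcond /=.
  have -> : 'X_j = \sum_j' (j' == j)%:R *: 'X_j' :> S.
    by rewrite (bigD1 j) //= eqxx scale1r big1 ?addr0 // => j' /negbTE ->; rewrite scale0r.
  rewrite -big_split; apply: eq_bigr => j' _ /=.
  have : (B *m with_coords A (~: supp m)%SET) j j' = (M%:M : 'M_n) j j' by rewrite BM.
  rewrite mxE big_split_ord /= [X in _ + X = _](_ : _ =
      B j (rshift d j') * (j' \notin supp m)%:R); last first.
    rewrite (bigD1 j') //= big1 => [|i ij'].
      by rewrite col_mxEd !mxE eqxx mulr1n addr0 finset.in_setC.
    by rewrite col_mxEd !mxE (negbTE ij') mulr0n mulr0.
  under eq_bigr => i _ do rewrite col_mxEu.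
  rewrite mxE => /(congr1 (fun z : int => z%:~R / M%:~R : C)).
  rewrite rmorphD rmorph_sum mulrDl mulr_suml /=.
  rewrite (eq_bigr (fun i => b i * (A i j')%:~R)) => [|i _]; last first.
    by rewrite rmorphM /b mulrAC.
  rewrite [X in _ = X -> _](_ : _ = (j' == j)%:R); last first.
    rewrite eq_sym; case: (j' == j); last by rewrite mulr0n mul0r.
    by rewrite mulr1n divff // intr_eq0.
  move=> E.
  rewrite -E [X in (_ + X) *: _](_ : _ = c' j' * (j' \notin supp m)%:R); last first.
    by rewrite rmorphM rmorph_nat mulrAC.
  rewrite scalerDl; case: (j' \notin supp m); first by rewrite mulr1 addrK.
  by rewrite mulr0 scale0r !addr0.
have jm : (U_(j) <= m)%MM by rewrite lep1mP -lt0n ltnW.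
have sj : j \in supp m by rewrite inE -lt0n ltnW.
have -> : 'X_[m] = 'X_[m - U_(j)] * l +
    \sum_(j' | j' \notin supp m) c' j' *: 'X_[m - U_(j) + U_(j')] :> S.
  rewrite lE mulrBr -mpolyXD submK // mulr_sumr -[LHS]addr0 -addrA; congr (_ + _).
  by rewrite addrC -sumrB big1 // => j' _; rewrite mpolyXD -scalerAr subrr.
rewrite scalerDl; apply: (submoduleD sN).
  by rewrite -scalerA; exact: Mrel_linear_form.
rewrite scaler_suml; apply: (submodule_sum _ sN) => j' nj'.
(* the monomial with one 'X_j replaced by 'X_j' has a larger support, as m j > 1 *)
rewrite -mul_mpolyC -scalerA; apply: (submoduleZ _ sN); apply: IHk; last first.
  by rewrite mdegD mdeg1 -{1}(mdeg1 j) -mdegD submK.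
have : (#|(j' |: supp m)%SET| <= #|supp (m - U_(j) + U_(j'))%MM|)%N.
  apply/subset_leq_card/fintype.subsetP => i.
  rewrite !inE mnmDE mnmBE !mnm1E => /orP[/eqP->|]; first by rewrite eqxx addn1.
  by case: (eqVneq j i) => [<- _|_]; [move: mj | ]; case: (j' == _); lia.
have : (#|supp (m - U_(j) + U_(j'))%MM| <= n)%N.
  by rewrite -[X in (_ <= X)%N]card_ord max_card.
rewrite finset.cardsU1 nj' add1n; move: #|_| => p; move: #|supp m| le_k => q.
by lia.
Qed.

Section Quotient.
Variable G : set (Ffree Lam).

Lemma to_quotmod_linear a (x y : Ffree Lam) :
  to_quotmod G (a *: x + y) = a *: to_quotmod G x + to_quotmod G y.
Proof. by rewrite to_quotmodD to_quotmodZ. Qed.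

Lemma to_quotmod_scale a (x : Ffree Lam) : to_quotmod G (a *: x) = a *: to_quotmod G x.
Proof. exact: to_quotmodZ. Qed.

Lemma to_quotmod0P x : to_quotmod G x = 0 <-> lspan G x.
Proof.
have q0 : to_quotmod G 0 = 0.
  by have := to_quotmod_linear (-1) 0 0; rewrite scaler0 addr0 scaleN1r addNr.
by rewrite -q0 to_quotmodP subr0.
Qed.

Lemma quotmod_gen (P : set (quotmod G)) : submodule P ->
  (forall I, P (to_quotmod G (estar I))) -> P = setT.
Proof.
move=> sP Pe; apply/seteqP; split=> // x _;
  rewrite -(to_quotmodK x) (ffree_decomp (repr x)).
have q0 : to_quotmod G 0 = 0 by apply/to_quotmod0P; apply: submodule0;
  exact: lspan_submodule.
rewrite (big_morph _ (@to_quotmodD _ _ G) q0).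
apply: (submodule_sum _ sP) => I _; rewrite to_quotmod_scale.
exact: (submoduleZ _ sP).
Qed.

Lemma HomS_quotmod_ext (f g : quotmod G -> S) : HomS (quotmod G) f -> HomS (quotmod G) g ->
  (forall I, f (to_quotmod G (estar I)) = g (to_quotmod G (estar I))) -> f = g.
Proof.
move=> /HomSP[fD fZ] /HomSP[gD gZ] fg.
have sE : submodule [set x | f x = g x].
  apply/submoduleP; split=> [|a x y /= fx fy]; last by rewrite fD gD fZ gZ fx fy.
  by rewrite /= -(scale0r 0) fZ gZ !dact0l.
by apply/funext => x; have := quotmod_gen sE fg; move/seteqP => [_ /(_ x I)].
Qed.

Lemma HomS_quotmod_exists c : (forall x, G x -> \sum_I dact (x I : S) (c I) = 0) ->
  exists2 f, HomS (quotmod G) f & forall I, f (to_quotmod G (estar I)) = c I.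
Proof.
move=> cG; pose h (x : Ffree Lam) : S := \sum_I dact (x I : S) (c I).
have hL a x y : h (a *: x + y) = dact a (h x) + h y.
  rewrite /h linear_sum -big_split; apply: eq_bigr => I _ /=.
  rewrite !ffunE; have -> : a *: x I + y I = (a * (x I : S) + y I : S) by [].
  by rewrite dactDl dactM.
have h0 : h 0 = 0 by rewrite /h big1 // => I _; rewrite ffunE dact0l.
have hG x : lspan G x -> h x = 0.
  move=> Gx; suff /(_ x Gx) : lspan G `<=` [set x | h x = 0] by [].
  apply: lspan_min => [|z /cG//]; apply/submoduleP; split=> // a z y /= hz hy.
  by rewrite hL hz hy linear0 addr0.
have hq x : h (repr (to_quotmod G x)) = h x.
  apply/eqP; rewrite -subr_eq0; apply/eqP.
  have /hG <- : lspan G (repr (to_quotmod G x) - x).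
    by apply/to_quotmodP; rewrite to_quotmodK.
  have := hL (-1) x (repr (to_quotmod G x)).
  by rewrite scaleN1r addrC => ->; rewrite -mpolyC1 -mpolyCN dactC scaleN1r addrC.
exists (fun z : quotmod G => h (repr z)) => [a p q|I].
  by rewrite -{1}(to_quotmodK p) -{1}(to_quotmodK q) -to_quotmod_linear hq hL.
rewrite hq /h (bigD1 I) //= ffunE eqxx big1 ?addr0; first exact: dact1.
by move=> J JI; rewrite ffunE (negbTE JI); exact: dact0l.
Qed.

Hypothesis MrelG : Mrel A w Lam `<=` lspan G.

(** This applies to M^dir and, for the realizability criterion, to the quotient of
    the free module by the preimage of an ideal of S. *)
Lemma quotmod_killed : killed_by_degree (quotmod G) n.+1.
Proof.
move=> m x nm; rewrite -(to_quotmodK x) -to_quotmod_scale; apply/to_quotmod0P.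
have sG := @lspan_submodule _ _ G.
rewrite (ffree_decomp (repr x)) scaler_sumr; apply: (submodule_sum _ sG) => I _.
rewrite scalerA mulrC -scalerA; apply: (submoduleZ _ sG).
by apply: (lspan_min sG MrelG); exact: Mrel_monomial.
Qed.

Lemma quotmod_finite_length : finite_length (quotmod G).
Proof.
apply: (@nilpotent_finite_length _ _ _ n.+1 _ (fun I => to_quotmod G (estar I))).
  by move=> m I nm; exact: quotmod_killed.
exact: quotmod_gen.
Qed.

End Quotient.

Lemma Mdir_killed : killed_by_degree (Mdir A w Lam) n.+1.
Proof. by apply: quotmod_killed; exact: sub_lspan. Qed.

Lemma Mdir_finite_length : finite_length (Mdir A w Lam).
Proof. by apply: quotmod_finite_length; exact: sub_lspan. Qed.

Lemma sum_dact_estar (s : S) I c : \sum_J dact ((s *: estar I : Ffree Lam) J : S) (c J) =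
  dact s (c I).
Proof.
have sE J : (s *: estar I : Ffree Lam) J = s * (J == I)%:R :> S by rewrite !ffunE.
rewrite (bigD1 I) //= sE eqxx mulr1 big1 ?addr0 // => J JI.
by rewrite sE (negbTE JI) mulr0 dact0l.
Qed.

Lemma sum_dactB x y c : \sum_I dact ((x - y) I : S) (c I) =
  \sum_I dact (x I : S) (c I) - \sum_I dact (y I : S) (c I).
Proof.
rewrite -sumrB; apply: eq_bigr => I _; rewrite -dactBl; congr (dact _ _).
by rewrite !ffunE.
Qed.

Lemma HomS_Coeff (G : set (Ffree Lam)) (f : quotmod G -> S) : Mrel A w Lam `<=` lspan G ->
  HomS (quotmod G) f -> Coeff A w Lam [ffun I => f (to_quotmod G (estar I))].
Proof.
move=> MG /HomSP[fD fZ]; have f0 : f 0 = 0 by rewrite -(scale0r 0) fZ dact0l.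
have rel x : Mrel A w Lam x -> f (to_quotmod G x) = 0.
  by move/MG/to_quotmod0P => ->.
split=> [I i|I J|I nI]; rewrite !ffunE.
- by rewrite -fZ -to_quotmod_scale rel //; left; left; exists i => //; exists I.
- have fq (s : S) K : dact s (f (to_quotmod G (estar K))) = f (to_quotmod G (s *: estar K)).
    by rewrite to_quotmod_scale fZ.
  apply: etrans (fq _ I) (etrans _ (esym (fq _ J))).
  have MIJ : lspan G (dmon R (sval J :\: sval I) *: estar I -
      dmon R (sval I :\: sval J) *: estar J).
    by apply: MG; left; right; exists I => //; exists J.
  have := (to_quotmodP G _ _).2 MIJ; exact: congr1.
- by apply: rel; right; exists I.
Qed.

Lemma eval_gen_iso :
  linear_iso_on (HomS (Mdir A w Lam)) (Coeff A w Lam) (eval_gen A w Lam).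
Proof.
split; [exact: HomS_sub | exact: Coeff_sub | |].
  by move=> a f g _ _; apply/ffunP => I; rewrite !ffunE.
split=> [f fH|f g /set_mem fH /set_mem gH fg|c [cE cG cA]].
- by apply: HomS_Coeff fH; exact: sub_lspan.
- apply: HomS_quotmod_ext => // I.
  by have /ffunP/(_ I) := fg; rewrite !ffunE.
have [x [[[i _ [I _ <-]]|[I _ [J _ <-]]]|[I nI <-]]|f fH fc] := @HomS_quotmod_exists
  (Mrel A w Lam) c.
- by rewrite sum_dact_estar cE.
- rewrite -[RHS](subrr (dact (dmon R (sval J :\: sval I)) (c I))) [in X in _ = _ - X]cG.
  by rewrite -!sum_dact_estar -sum_dactB.
- by rewrite -[estar I]scale1r sum_dact_estar dact1 cA.
by exists f => //; apply/ffunP => I; rewrite ffunE; exact: fc.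
Qed.

End Module.

(** * Finitely many admissible lattices *)

Lemma finite_inj_finType T (F : finType) (B : set T) (f : T -> F) :
  {in B &, injective f} -> finite_set B.
Proof. by move=> injf; rewrite -(eq_finite_set (inj_card_eq injf));
  exact: finite_finset. Qed.

Section Finiteness.
Variables (R : realType) (d n : nat) (A : 'M[int]_(d, n)) (beta : 'cV[R[i]]_d).
Local Notation C := R[i].
Variable w : 'cV[R]_n.
Hypothesis w_generic : L_generic A w.
Implicit Types (Lam : set 'cV[C]_n) (gam : 'cV[C]_n) (E : {set 'I_n}).

Definition integral_at gam j := exists z : int, gam j 0 = z%:~R.

Definition bounded_lattices E : set (set 'cV[C]_n) :=
  [set Lam | [/\ exp_lattices A beta Lam, exists I : NSidx Lam, Bw w Lam I &
     forall gam, Lam gam -> forall j, j \in E <-> integral_at gam j]].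

Lemma integral_at_add gam u j : integral_at gam j -> integral_at (gam + ivec R u) j.
Proof. by move=> [z /(ivecDE u) gz]; exists (z + u j 0). Qed.

Lemma bounded_lattices_cover Lam : exp_lattices A beta Lam ->
  (exists I : NSidx Lam, Bw w Lam I) -> exists E, bounded_lattices E Lam.
Proof.
move=> LamP bI; have [gam0 Lg0] := lattice_nonempty LamP.
exists [set j | `[< integral_at gam0 j >]]%SET; split=> // gam Lg j.
have [u _ gE] := lattice_diff LamP Lg0 Lg.
rewrite inE; split=> [/asboolP|gz]; first by rewrite gE; exact: integral_at_add.
apply/asboolP; rewrite (_ : gam0 = gam + ivec R (- u)); first exact: integral_at_add.
by rewrite gE ivecN addrK.
Qed.

(** Two exponent lattices with the same integral coordinates [E] differ by a
    vector mu with A mu = 0 that is integral on [E]. Boundedness of one stratum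
    makes [A] injective on the vectors vanishing on [E], so mu has a denominator
    N that depends only on [A] and [E], and the lattices are separated by the
    residues of N mu. *)
Lemma bounded_lattices_finite E : finite_set (bounded_lattices E).
Proof.
have [->|/set0P[Lam0 [LamP0 [I0 bI0] int0]]] := eqVneq (bounded_lattices E) set0.
  exact: finite_set0.
have [gam0 Ig0] := in_NS I0; have Lg0 := Ig0.1.
have [|N N0 [B BN]] := @with_coords_left_inverse d n A E.
  move=> u ku uE; apply: (bounded_ray_trivial w_generic LamP0 bI0 Ig0 ku) => j z gz.
  by apply: uE; apply/(int0 _ Lg0); exists z.
(* p.2 is N mu for mu = p.1 - gam0 *)
have ext Lam : exists p : 'cV[C]_n * 'cV[int]_n, bounded_lattices E Lam ->
    Lam p.1 /\ N%:~R *: (p.1 - gam0) = ivec R p.2.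
  have [[LamP _ intL]|] := pselect (bounded_lattices E Lam); last by exists (0, 0).
  have [gam Lg] := lattice_nonempty LamP.
  pose z : 'cV[int]_n := \col_j if j \in E then
    Num.floor (complex.Re (gam j 0)) - Num.floor (complex.Re (gam0 j 0)) else 0.
  exists (gam, B *m col_mx 0 z) => _; split=> //=.
  rewrite /ivec map_mxM -[_ *: _]mul_scalar_mx -map_scalar_mx -BN map_mxM -mulmxA.
  congr (_ *m _); rewrite with_coordsE mulmxBr (lattice_beta LamP Lg).
  rewrite (lattice_beta LamP0 Lg0) subrr map_col_mx map_mx0; congr col_mx.
  apply/colP => j; rewrite !mxE; have [jE|jE] := boolP (j \in E); last by rewrite mul0r.
  have [[s gs] [t gt]] := ((intL _ Lg j).1 jE, (int0 _ Lg0 j).1 jE).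
  by rewrite gs gt !Re_int !intrKfloor mul1r /= intrB.
have [p pP] := choice ext.
pose f Lam : {ffun 'I_n -> 'I_(absz N).-1.+1} :=
  [ffun j => inord (absz (modz ((p Lam).2 j 0) N))].
apply: (@finite_inj_finType _ _ _ f) => Lam Lam' /set_mem BL /set_mem BL' /ffunP fE.
have [[Lp pE] [Lp' p'E]] := (pP _ BL, pP _ BL').
have [LamP _ _] := BL; have [LamP' _ _] := BL'.
have modE j : modz ((p Lam).2 j 0) N = modz ((p Lam').2 j 0) N.
  have lt_N (m : int) : (absz (m %% N)%Z < (absz N).-1.+1)%N.
    by rewrite prednK ?absz_gt0 // -ltz_nat gez0_abs ?modz_ge0 // -modz_abs ltz_pmod //
      ltz_nat absz_gt0.
  have := fE j; rewrite !ffunE => /(congr1 val) /=; rewrite !inordK // => /(congr1 Posz).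
  by rewrite !gez0_abs ?modz_ge0.
have [v vE] : exists v : 'cV[int]_n, (p Lam').2 - (p Lam).2 = N *: v.
  have exq j : exists q, (p Lam').2 j 0 - (p Lam).2 j 0 = q * N.
    by apply/dvdzP; rewrite -eqz_mod_dvd; apply/eqP; rewrite modE.
  have [q qE] := choice exq; exists (\col_j q j).
  by apply/colP => j; rewrite !mxE qE mulrC.
have gE : (p Lam').1 = (p Lam).1 + ivec R v.
  have NC : N%:~R != 0 :> C by rewrite intr_eq0.
  apply: (scalerI NC); rewrite scalerDr.
  have -> : N%:~R *: ivec R v = ivec R (p Lam').2 - ivec R (p Lam).2.
    rewrite -ivecN -ivecD vE; apply/colP => j; rewrite !mxE.
    by rewrite rmorphM.
  by rewrite -pE -p'E -scalerBr opprB addrA subrK scalerBr addrC subrK.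
have kv : kerZ A v.
  apply: (@ivec_kerZ R); apply: (addrI (map_mx intr A *m (p Lam).1)).
  by rewrite -mulmxDr -gE (lattice_beta LamP Lp) (lattice_beta LamP' Lp') addr0.
rewrite (lattice_translate LamP Lp); rewrite (lattice_translate LamP' Lp') gE.
apply/seteqP; split=> _ [u ku <-].
  exists (u - v); first by apply: kerZD => //; exact: kerZN.
  by rewrite -/(ivec R _) ivecD ivecN addrACA subrr addr0.
by exists (v + u); [exact: kerZD | rewrite -/(ivec R _) ivecD addrA].
Qed.

Lemma adm_lattices_finite : finite_set (adm_lattices A beta w).
Proof.
apply: (@sub_finite_set _ _ (\bigcup_(E in [set: {set 'I_n}]) bounded_lattices E)).
  move=> Lam [LamP [I [_ bI]]].
  by have [E LE] := bounded_lattices_cover LamP (ex_intro _ I bI); exists E.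
by apply: bigcup_finite => [|E _]; [exact: finite_finset | exact: bounded_lattices_finite].
Qed.

End Finiteness.

(** * Dimensions and lengths of direct sums *)

Section Dimension.
Variable (F : fieldType).

Lemma lspan_range (U : lmodType F) k (b : 'I_k -> U) v :
  lspan (range b) v <-> exists a : 'I_k -> F, v = \sum_i a i *: b i.
Proof.
split=> [bv|[a ->]]; last first.
  apply: (submodule_sum _ (@lspan_submodule _ _ _)) => i _.
  by apply: (submoduleZ _ (@lspan_submodule _ _ _)); apply: sub_lspan; exists i.
suff /(_ v bv) : lspan (range b) `<=` [set v | exists a, v = \sum_i a i *: b i] by [].
apply: lspan_min => [|_ [i _ <-]].
  apply/submoduleP; split=> [|c _ _ [a ->] [a' ->]].
    by exists (fun=> 0); rewrite big1 // => i _; rewrite scale0r.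
  exists (fun i => c * a i + a' i); rewrite scaler_sumr -big_split.
  by apply: eq_bigr => i _; rewrite /= scalerDl scalerA.
exists (fun j => (j == i)%:R); rewrite (bigD1 i) //= eqxx scale1r big1 ?addr0 //.
by move=> j /negbTE ->; rewrite scale0r.
Qed.

Lemma has_dimP (U : lmodType F) (V : set U) k : has_dim V k <-> exists b : 'I_k -> U,
  (forall a : 'I_k -> F, \sum_i a i *: b i = 0 -> forall i, a i = 0) /\
  (forall v, V v <-> exists a : 'I_k -> F, v = \sum_i a i *: b i).
Proof.
split=> -[b [indep gen]]; exists b; split=> //.
  by move=> v; rewrite gen; exact: lspan_range.
by apply/seteqP; split=> v; rewrite gen lspan_range.
Qed.

Section Transport.
Variables (U V : lmodType F) (P : set U) (Q : set V) (f : U -> V).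
Hypothesis iso : linear_iso_on P Q f.

Lemma iso_sum k (a : 'I_k -> F) (b : 'I_k -> U) : (forall i, P (b i)) ->
  f (\sum_i a i *: b i) = \sum_i a i *: f (b i).
Proof.
case: iso => sP _ fL _ Pb; have f0 : f 0 = 0.
  have := fL (-1) 0 0 (submodule0 sP) (submodule0 sP).
  by rewrite scaler0 addr0 scaleN1r addNr.
suff [] : P (\sum_i a i *: b i) /\ f (\sum_i a i *: b i) = \sum_i a i *: f (b i) by [].
apply: (big_ind2 (fun x y => P x /\ f x = y)) => [||i _].
- by split=> //; exact: submodule0.
- move=> x _ y _ [Px <-] [Py <-]; split; first exact: submoduleD.
  by have := fL 1 x y Px Py; rewrite !scale1r.
split; first exact: (submoduleZ _ sP).
by have := fL (a i) (b i) 0 (Pb i) (submodule0 sP); rewrite f0 !addr0.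
Qed.

Lemma iso_has_dim k : has_dim P k -> has_dim Q k.
Proof.
move/has_dimP => [b [indep gen]].
have Pb i : P (b i).
  apply/gen; exists (fun j => (j == i)%:R);
    rewrite (bigD1 i) //= eqxx scale1r big1 ?addr0 //.
  by move=> j /negbTE ->; rewrite scale0r.
have [sP sQ fL [fPQ fI fS]] := iso.
apply/has_dimP; exists (f \o b); split=> [a a0|v].
  apply: indep; apply: fI; rewrite ?inE.
  - by apply/mem_set/gen; exists a.
  - by apply/mem_set; exact: submodule0.
  rewrite iso_sum // [LHS]a0.
  have := iso_sum (fun=> 0) Pb; rewrite !big1 // => *; by rewrite scale0r.
split=> [/fS[u Pu <-]|[a ->]].
  by have [a ->] := (gen u).1 Pu; exists a; exact: iso_sum.
by rewrite -iso_sum //; apply: fPQ; apply/gen; exists a.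
Qed.

Lemma iso_sym : exists g, linear_iso_on Q P g.
Proof.
have [sP sQ fL [fPQ fI fS]] := iso.
have ex v : exists u, Q v -> P u /\ f u = v.
  have [/fS[u Pu fu]|nQ] := pselect (Q v); first by exists u.
  by exists 0.
have [g gP] := choice ex; exists g.
have gK u : P u -> g (f u) = u.
  by move=> Pu; have [Pg fg] := gP _ (fPQ _ Pu); apply: fI => //; exact: mem_set.
split=> // [a u v Qu Qv|].
  have [[Pu fu] [Pv fv]] := (gP _ Qu, gP _ Qv).
  rewrite -{1}fu -{1}fv -fL // gK //.
  by apply: (submoduleD sP) => //; exact: (submoduleZ _ sP).
split=> [v /gP[]//|u v /set_mem/gP[_ fu] /set_mem/gP[_ fv] E|u Pu].
  by rewrite -fu -fv E.
by exists (f u); [exact: fPQ | exact: gK].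
Qed.

End Transport.

Definition sections (J : choiceType) (U : lmodType F) (V : J -> set U) (s : seq J) :
  set (J -> U) := [set f | (forall j, V j (f j)) /\ forall j, j \notin s -> f j = 0].

Lemma sections_has_dim (J : choiceType) (U : lmodType F) (V : J -> set U) (l : J -> nat) s :
  (forall j, V j 0) -> uniq s -> (forall j, j \in s -> has_dim (V j) (l j)) ->
  has_dim (sections V s) (\sum_(j <- s) l j)%N.
Proof.
move=> V0; elim: s => [|j0 s IHs] /=.
  move=> _ _; rewrite big_nil; apply/has_dimP; exists (fun=> 0); split=> [a _ []//|f].
  split=> [[_ f0]|[a ->]].
    by exists (fun=> 0); rewrite big_ord0; apply/funext => j; exact: f0.
  by rewrite big_ord0; split.
case/andP=> j0s us Vl; rewrite big_cons.
have /has_dimP[b1 [indep1 gen1]] := Vl j0 (mem_head _ _).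
have /has_dimP[b2 [indep2 gen2]] : has_dim (sections V s) (\sum_(j <- s) l j)%N.
  by apply: IHs => // j js; apply: Vl; rewrite inE js orbT.
pose single (u : U) : J -> U := fun j => if j == j0 then u else 0.
apply/has_dimP; exists (fun i => match fintype.split i with inl i1 => single (b1 i1) |
  inr i2 => b2 i2 end).
have sumE (a : 'I_(l j0 + \sum_(j <- s) l j) -> F) :
    \sum_i a i *: (match fintype.split i with inl i1 => single (b1 i1) | inr i2 => b2 i2
      end) =
    single (\sum_i a (lshift _ i) *: b1 i) + \sum_i a (rshift _ i) *: b2 i.
  rewrite big_split_ord; congr (_ + _); last first.
    by apply: eq_bigr => i _; rewrite (unsplitK (inr i)).
  under eq_bigr => i _ do rewrite (unsplitK (inl i)).
  apply/funext => j; rewrite fct_sumE /single; case: ifP => jj0; last first.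
    by rewrite big1 // => i _; rewrite !fctE jj0 scaler0.
  by apply: eq_bigr => i _; rewrite !fctE jj0.
have b2j0 a : (\sum_i a i *: b2 i) j0 = 0.
  by have [_] := (gen2 (\sum_i a i *: b2 i)).2 (ex_intro _ a erefl); apply.
split=> [a|f].
  rewrite sumE => a0; have a1 i : a (lshift _ i) = 0.
    apply: (indep1 (fun i => a (lshift _ i))).
    by have := congr1 (fun f => f j0) a0; rewrite !fctE b2j0 addr0 /single eqxx.
  have a2 i : a (rshift _ i) = 0.
    apply: (indep2 (fun i => a (rshift _ i))); move: a0.
    rewrite [X in single X]big1 => [|i' _]; last by rewrite a1 scale0r.
    rewrite (_ : single 0 = 0) ?add0r //.
    by apply/funext => j; rewrite /single; case: ifP.
  by move=> i; rewrite -(splitK i); case: (fintype.split i) => i' /=;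
    [exact: a1 | exact: a2].
split=> [[Vf f0]|[a ->]]; last first.
  rewrite sumE; have [V2 z2] := (gen2 _).2 (ex_intro _ (fun i => a (rshift (l j0) i))
    erefl).
  split=> j; rewrite !fctE /single.
    case: eqP => [->|_]; last by rewrite add0r.
    by rewrite b2j0 addr0; apply/gen1; eexists.
  by rewrite inE negb_or => /andP[/negbTE -> /z2 ->]; rewrite addr0.
have [a1 a1E] := (gen1 _).1 (Vf j0).
have [a2 a2E] : exists a, (fun j => if j == j0 then 0 else f j) = \sum_i a i *: b2 i.
  apply/gen2; split=> j; first by case: ifP.
  case: ifP => // jj0 js; apply: f0; rewrite inE jj0.
  exact: js.
exists (fun i => match fintype.split i with inl i1 => a1 i1 | inr i2 => a2 i2 end).
rewrite sumE; apply/funext => j; rewrite !fctE /single.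
rewrite (eq_bigr (fun i => a1 i *: b1 i)) => [|i _]; last by rewrite (unsplitK (inl i)).
rewrite [X in _ + X j](eq_bigr (fun i => a2 i *: b2 i)) => [|i _]; last first.
  by rewrite (unsplitK (inr i)).
by rewrite -a2E -a1E; case: eqP => [->|_]; rewrite ?addr0 ?add0r.
Qed.

End Dimension.

Section DirectSums.
Variables (S : pzRingType) (J : choiceType) (M : J -> lmodType S).

Lemma dsum_single j0 (x : M j0) :
  exists f : dsum M, f j0 = x /\ forall j, j != j0 -> f j = 0.
Proof.
pose f j : M j := if j0 =P j is ReflectT e then eq_rect j0 M x j e else 0.
have f0 j : j != j0 -> f j = 0.
  by rewrite /f eq_sym; case: (j0 =P j) => // e /eqP[].
have fin : finite_set [set j | f j != 0].
  apply: (@sub_finite_set _ _ [set j0]); last exact: finite_set1.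
  move=> j /=; case: (eqVneq j j0) => // jj0.
  by rewrite f0 // eqxx.
exists (DSum fin); split=> //=; rewrite /f; case: eqP => // e.
by rewrite (eq_irrelevance e erefl).
Qed.

Definition dsum_on (s : seq J) : set (dsum M) :=
  [set f | forall j, j \notin s -> f j = 0].

Lemma dsum_on_submodule s (j0 : J) (N : set (M j0)) : submodule N ->
  submodule [set f | dsum_on s f /\ N (f j0)].
Proof.
move=> sN; apply/submoduleP; split=> [|a f g [sf Nf] [sg Ng]].
  by split=> //=; exact: submodule0.
split=> [j js|] /=; first by rewrite sf // sg // scaler0 addr0.
by have /submoduleP[_] := sN; apply.
Qed.

(** A submodule between the two is determined by its set of j0-components, since
    it contains every section on s whose j0-component lies in N. *)
Lemma dsum_covers s (j0 : J) (N N' : set (M j0)) : j0 \in s -> submodule N ->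
  submodule N' -> covers N N' ->
  covers [set f | dsum_on s f /\ N (f j0)] [set f | dsum_on s f /\ N' (f j0)].
Proof.
move=> j0s sN sN' [[NN' N'N] maxN].
have single x : exists2 f, dsum_on s f & f j0 = x.
  have [f [fx f0]] := dsum_single x; exists f => // j js; apply: f0.
  by apply: contraNneq js => ->.
split.
  split; first by move=> f [sf /NN'].
  apply: contra_not N'N => sub x N'x; have [f sf fx] := single x.
  by rewrite -fx; apply: (sub _ _).2; split=> //; rewrite fx.
move=> T sT VT TV'; pose P := [set f j0 | f in T].
have sP : submodule P.
  apply/submoduleP; split=> [|a _ _ [f Tf <-] [g Tg <-]].
    by exists 0 => //; exact: submodule0.
  by exists (a *: f + g) => //; have /submoduleP[_] := sT; apply.
have NP : N `<=` P.
  by move=> x Nx; have [f sf fx] := single x; exists f => //; apply: VT; rewrite /= fx.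
have PN' : P `<=` N' by move=> _ [f /TV'[_ N'f] <-].
have [PE|PE] := maxN P sP NP PN'; [left|right]; apply/seteqP; split=> // f.
  by move=> /[dup] /TV'[sf _] Tf; split=> //; rewrite -PE; exists f.
move=> [sf]; rewrite -PE => -[g Tg gf]; rewrite -(subrK g f).
apply: (submoduleD sT) => //; apply: VT; split=> [j js|] /=.
  by rewrite sf // (TV' _ Tg).1 // subrr.
by rewrite gf subrr; exact: submodule0.
Qed.

(** The series of the summands are run through one after the other. *)
Lemma dsum_comp_series s (l : J -> nat) : uniq s ->
  (forall j, j \in s -> has_length (M j) (l j)) ->
  comp_series (dsum_on s) (\sum_(j <- s) l j)%N.
Proof.
elim: s => [|j0 s IHs] /=.
  move=> _ _; rewrite big_nil (_ : dsum_on [::] = [set 0]); first exact: comp_series0.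
  apply/seteqP; split=> [f f0|f ->]; last by [].
  by apply: dsum_inj => j; rewrite f0.
case/andP=> j0s us lM; rewrite big_cons addnC.
have [N [N0 Nk sN cN]] := lM j0 (mem_head _ _).
suff ser i : (i <= l j0)%N -> comp_series
    [set f | dsum_on (j0 :: s) f /\ N i (f j0)] (\sum_(j <- s) l j + i)%N.
  have := ser _ (leqnn _); rewrite Nk.
  by rewrite (_ : [set f | _] = dsum_on (j0 :: s)) //; apply/seteqP; split=> f //= [].
elim: i => [_|i IHi il].
  rewrite addn0 N0 (_ : [set f | _] = dsum_on s).
    by apply: IHs => // j js; apply: lM; rewrite inE js orbT.
  apply/seteqP; split=> f /=.
    by move=> [sf f0] j js; case: (eqVneq j j0) => [->//|jj0]; apply: sf;
      rewrite inE negb_or jj0.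
  move=> sf; split; last exact: sf.
  by move=> j; rewrite inE negb_or => /andP[_ /sf].
rewrite addnS; apply: comp_seriesS (IHi (ltnW il)) _ _.
  by apply: dsum_on_submodule; exact: sN.
by apply: dsum_covers (mem_head _ _) (sN _ (ltnW il)) (sN _ il) (cN _ il).
Qed.

End DirectSums.

(** * Realizable lowest exponents *)

Section Ideals.
Variable S : comNzRingType.
Implicit Types (G I : set S).

Lemma ideal_gen_min G I : I 0 -> (forall a u v, I u -> I v -> I (a * u + v)) ->
  G `<=` I -> ideal_gen G `<=` I.
Proof. by move=> I0 IL; apply: (@lspan_min S S^o I); apply/submoduleP. Qed.

Lemma ideal_genL G a u v : ideal_gen G u -> ideal_gen G v -> ideal_gen G (a * u + v).
Proof. by have /submoduleP[_] := @lspan_submodule S S^o G; exact. Qed.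

Lemma ideal_gen0 G : ideal_gen G 0.
Proof. exact: submodule0 (@lspan_submodule S S^o G). Qed.

Lemma ideal_gen_sub G : G `<=` ideal_gen G.
Proof. exact: (@sub_lspan S S^o G). Qed.

Lemma ideal_addL I1 I2 (Q := ideal_add (ideal_gen I1) (ideal_gen I2)) a u v :
  Q u -> Q v -> Q (a * u + v).
Proof.
move=> [u1 Iu1 [u2 Iu2 <-]] [v1 Iv1 [v2 Iv2 <-]].
exists (a * u1 + v1); first exact: ideal_genL.
exists (a * u2 + v2); first exact: ideal_genL.
by rewrite mulrDr addrACA.
Qed.

Lemma ideal_add0 I1 I2 : ideal_add (ideal_gen I1) (ideal_gen I2) 0.
Proof. by exists 0; [exact: ideal_gen0 | exists 0;
  [exact: ideal_gen0 | rewrite addr0]]. Qed.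

End Ideals.

Section Realizability.
Variables (R : realType) (d n : nat) (A : 'M[int]_(d, n)) (beta : 'cV[R[i]]_d).
Local Notation C := R[i].
Local Notation S := {mpoly C[n]}.
Variable w : 'cV[R]_n.
Hypothesis w_generic : L_generic A w.
Variable Lam : set 'cV[C]_n.
Hypothesis LamP : exp_lattices A beta Lam.
Implicit Types (c : {ffun NSidx Lam -> S}) (I J K : NSidx Lam) (m : 'X_{1..n}).

Definition realizable K c :=
  [/\ Coeff A w Lam c, c K != 0 & forall J, acc_lt w K J -> c J = 0].

Section Coefficients.
Variable c : {ffun NSidx Lam -> S}.
Hypothesis cC : Coeff A w Lam c.

(** The image of a monomial under the map s d^I |-> s . c_I from the monomial
    ideal spanned by the d^I to C[y]. *)
Definition glue m : S :=
  if [pick I : NSidx Lam | (mset (sval I) <= m)%MM] is Some J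
  then mderivm (m - mset (sval J))%MM (c J) else 0.

(** The choice of I does not matter: passing through the union of I and J, two
    choices differ by the equation d^(J - I) c_I = d^(I - J) c_J. *)
Lemma glueE I m : (mset (sval I) <= m)%MM -> glue m = mderivm (m - mset (sval I))%MM (c I).
Proof.
move=> Im; rewrite /glue; case: pickP => [J Jm|/(_ I)]; last by rewrite Im.
pose u := (m - mset (sval I :|: sval J)%SET)%MM.
have uJ : (m - mset (sval J) = u + mset (sval I :\: sval J)%SET)%MM.
  apply/mnmP => j; have /mnm_lepP/(_ j) := Im; have /mnm_lepP/(_ j) := Jm.
  by rewrite !(mnmBE, mnmDE, mnmE) !inE; case: (j \in sval I); case: (j \in sval J); lia.
have uI : (m - mset (sval I) = u + mset (sval J :\: sval I)%SET)%MM.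
  apply/mnmP => j; have /mnm_lepP/(_ j) := Im; have /mnm_lepP/(_ j) := Jm.
  by rewrite !(mnmBE, mnmDE, mnmE) !inE; case: (j \in sval I); case: (j \in sval J); lia.
have [_ cG _] := cC; have := cG J I; rewrite !dmonX !dactX => E.
by rewrite uJ uI addmC mderivmDm E [in RHS]addmC [in RHS]mderivmDm.
Qed.

Lemma glue_dmon I (s : S) : monomial_ext glue (s * dmon R (sval I)) = dact s (c I).
Proof.
elim/mpolyind: s => [|a m s _ _ IHs]; first by rewrite mul0r linear0 dact0l.
rewrite mulrDl linearD /= IHs dactDl -scalerAl linearZ dactZl /=; congr (_ *: _ + _).
rewrite dmonX -mpolyXD monomial_extX (@glueE I) ?lem_addl // dactX.
by rewrite [(m + _)%MM]addmC addmC addmK.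
Qed.

Lemma glue_euler (a : S) : @idealE R d n A a -> forall I, dact a (c I) = 0.
Proof.
move: a; apply: ideal_gen_min => [I|a u v u0 v0 I|_ [i _ <-] I]; first exact: dact0l.
  by rewrite dactDl dactM u0 v0 linear0 addr0.
by have [cE _ _] := cC.
Qed.

(** The functional kills (A d_y)_i d^I by the Euler equations for c_I, and d^J
    because c_J = 0. *)
Lemma glue_idealQ K : (forall J, acc_lt w K J -> c J = 0) ->
  forall q, idealQ A w K q -> forall t, monomial_ext glue (t * q) = 0.
Proof.
move=> cK q [e Ee [p Pp <-]] t; rewrite mulrDr linearD /=.
rewrite [X in X + _](_ : _ = 0) ?add0r.
  move: p Pp t; apply: ideal_gen_min => [t|a u v u0 v0 t|_ [J nJ <-] t].
  - by rewrite mulr0 linear0.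
  - by rewrite mulrDr mulrA linearD /= u0 v0 addr0.
  rewrite glue_dmon; have [_ _ cA] := cC.
  by case: nJ => [/cA|/cK] ->; rewrite linear0.
move: e Ee t; apply: ideal_gen_min => [t|a u v u0 v0 t|_ [a Ea [b Mb <-]] t].
- by rewrite mulr0 linear0.
- by rewrite mulrDr mulrA linearD /= u0 v0 addr0.
move: b Mb t; apply: ideal_gen_min => [t|s u v u0 v0 t|_ [I _ <-] t].
- by rewrite !mulr0 linear0.
- by rewrite mulrDr mulrDr linearD /= v0 addr0 [a * _]mulrCA [t * _]mulrA u0.
by rewrite mulrA glue_dmon dactM glue_euler // linear0.
Qed.

End Coefficients.

Lemma realizable_notin_idealQ K c : realizable K c -> ~ idealQ A w K (dmon R (sval K)).
Proof.
move=> [cC cK cJ] /(glue_idealQ cC cJ)/(_ 1); rewrite glue_dmon // dact1.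
exact/eqP.
Qed.

(** If d^K is not in the ideal, its class is nonzero in the quotient of the free
    module by the preimage of the ideal under e_I |-> d^I, and a homomorphism to
    C[y] that does not vanish there gives the coefficients. *)
Lemma notin_idealQ_realizable K : ~ idealQ A w K (dmon R (sval K)) ->
  exists c, realizable K c.
Proof.
move=> nQK; pose ev (x : Ffree Lam) : S := \sum_I (x I : S) * dmon R (sval I).
have evL a x y : ev (a *: x + y) = a * ev x + ev y.
  rewrite /ev mulr_sumr -big_split; apply: eq_bigr => I _ /=.
  by rewrite !ffunE mulrA -mulrDl.
have evB x y : ev (x - y) = ev x - ev y.
  by rewrite addrC -scaleN1r evL mulN1r addrC.
have evZ (a : S) I : ev (a *: estar I) = a * dmon R (sval I).
  have sE J : (a *: estar I : Ffree Lam) J = a * (J == I)%:R :> S by rewrite !ffunE.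
  rewrite /ev (bigD1 I) //= sE eqxx mulr1 big1 ?addr0 // => J JI.
  by rewrite sE (negbTE JI) mulr0 mul0r.
have ev1 I : ev (estar I) = dmon R (sval I) by rewrite -[estar I]scale1r evZ mul1r.
pose G : set (Ffree Lam) := [set x | idealQ A w K (ev x)].
have Q0 : idealQ A w K 0 by exact: ideal_add0.
have sG : submodule G.
  apply/submoduleP; split=> [|a x y Gx Gy].
    by rewrite /G /= (_ : ev 0 = 0) // /ev big1 // => I _; rewrite ffunE mul0r.
  by rewrite /G /= evL; exact: ideal_addL.
have spanG x : lspan G x -> G x by apply: lspan_min.
have QP J : (~` acc w Lam `|` acc_lt w K) J -> idealQ A w K (dmon R (sval J)).
  move=> PJ; exists 0; first exact: ideal_gen0.
  by exists (dmon R (sval J)); [apply: ideal_gen_sub; exists J | rewrite add0r].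
have MG : Mrel A w Lam `<=` lspan G.
  apply: subset_trans (@sub_lspan _ _ G);
    move=> x [[[i _ [I _ <-]]|[I _ [J _ <-]]]|[J nJ <-]].
  - rewrite /G /= evZ; exists (eulerS R A i * dmon R (sval I)); last first.
      by exists 0; [exact: ideal_gen0 | rewrite addr0].
    apply: ideal_gen_sub; exists (eulerS R A i); first by apply: ideal_gen_sub; exists i.
    by exists (dmon R (sval I)) => //; apply: ideal_gen_sub; exists I.
  - have evR : ev (dmon R (sval J :\: sval I) *: estar I -
        dmon R (sval I :\: sval J) *: estar J) = 0.
      apply: etrans (evB _ _) _; apply/eqP; rewrite subr_eq0; apply/eqP.
      apply: etrans (evZ _ I) (etrans _ (esym (evZ _ J))).
      rewrite !dmonX -!mpolyXD; congr 'X_[_]; apply/mnmP => j.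
      by rewrite !(mnmDE, mnmE) !inE; case: (j \in sval I); case: (j \in sval J).
    exact: (eq_ind_r (idealQ A w K) Q0 evR).
  - by rewrite /G /= ev1; apply: QP; left.
have qK : to_quotmod G (estar K) != 0.
  by apply/eqP => /to_quotmod0P/spanG; rewrite /G /= ev1.
have killG := quotmod_killed w_generic LamP MG.
have [f fH fK] := HomS_separates killG (quotmod_finite_length w_generic LamP MG) qK.
exists [ffun I => f (to_quotmod G (estar I))]; split.
- exact: HomS_Coeff MG fH.
- by rewrite ffunE.
move=> J KJ; rewrite ffunE (_ : to_quotmod G (estar J) = 0).
  have /HomSP[_ fZ] := fH.
  by rewrite -(scale0r 0) fZ dact0l.
by apply/to_quotmod0P; apply: sub_lspan; rewrite /G /= ev1; apply: QP; right.
Qed.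

Lemma ideal_colonP K : ideal_colon (idealQ A w K) (dmon R (sval K)) <> setT <->
  ~ idealQ A w K (dmon R (sval K)).
Proof.
split=> [neq QK|nQ E].
  apply: neq; apply/seteqP; split=> // s _; rewrite /ideal_colon /= -[_ * _]addr0.
  by apply: ideal_addL => //; exact: ideal_add0.
by apply: nQ; have : setT (1 : S) by []; rewrite -E /ideal_colon /= mul1r.
Qed.

(** Among acceptable supports, to come before K is to have a smaller stratum
    minimum. *)
Lemma minimal_realizable K c : Coeff A w Lam c -> acc w Lam K ->
  minimal_at w c K <-> realizable K c.
Proof.
move=> cC aK; have LamV J : acc w Lam J -> Lam (vmin w J).
  by move/acc_bounded/(vminP w_generic LamP) => [[]].
have ltE J : acc w Lam J -> wlt w (vmin w J) (vmin w K) <->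
    wdot w (vmin w J) < wdot w (vmin w K).
  by move=> aJ; apply: (wltE w_generic LamP); exact: LamV.
split=> [[cK minK]|[_ cK cJ]]; split=> // J.
  move=> [aJ /(ltE _ aJ) lt_JK]; apply/eqP/negPn/negP => /minK.
  by rewrite leNgt lt_JK.
move=> nJ; have aJ := Coeff_acc cC nJ; rewrite leNgt; apply/negP => lt_JK.
by move: nJ; rewrite cJ ?eqxx //; split=> //; apply/ltE.
Qed.

Lemma lexp_realize lam c K : Lam lam -> Coeff A w Lam c -> minimal_at w c K ->
  lexp w (realize lam c) = vmin w K.
Proof.
move=> Llam cC minK; apply: (wmin_eq w_generic LamP).
  exact: Supp_realize.
exact: (Supp_wmin w_generic LamP Llam cC minK).
Qed.

Lemma realize_neq0 lam c : Lam lam -> (realize lam c <> 0) <-> c != 0.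
Proof.
move=> Llam; split=> [r0|/eqP c0 r0].
  by apply/eqP => c0; apply: r0; rewrite c0; exact: (realize0 LamP Llam).
apply: c0; rewrite -(normalize_realize LamP Llam c) r0 -(realize0 LamP Llam).
exact: (normalize_realize LamP Llam).
Qed.

Lemma RexpE : Rexp A beta w Lam =
  [set vmin w K | K in [set K | acc w Lam K /\ exists c, realizable K c]].
Proof.
have [lam Llam] := lattice_nonempty LamP; apply/seteqP; split=> [_ [phi [phiS phi0] <-]|].
  have [c cC phiE] := Sol_realize LamP Llam phiS; rewrite phiE in phi0 *.
  have [K minK] := exists_minimal w ((realize_neq0 c Llam).1 phi0).
  have aK : acc w Lam K by case: minK => cK _; exact: Coeff_acc cC cK.
  exists K; last by rewrite (lexp_realize Llam cC minK).
  by split=> //; exists c; apply/minimal_realizable.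
move=> _ [K [aK [c /[dup] cr [cC cK _]]] <-].
exists (realize lam c); last first.
  by apply: (lexp_realize Llam cC); apply/minimal_realizable.
split; first exact: (realize_Sol w_generic LamP Llam cC).
by apply/(realize_neq0 c Llam); apply: contraNneq cK => ->; rewrite ffunE.
Qed.

Lemma KerP K : ~ (Ker A w (proj_lt w K) `<=` Ker A w (proj K)) <-> exists c, realizable K c.
Proof.
split=> [/existsNP[c /not_implyP[[cC cJ] nK]]|[c [cC cK cJ]] sub].
  exists c; split=> //; first by apply/eqP => cK; apply: nK.
  by move=> J KJ; have := congr1 (fun f => f (exist _ J (mem_set KJ))) cJ.
have kc : Ker A w (proj_lt w K) c.
  by split=> //; apply/funext => J; exact: (cJ _ (set_mem (valP J))).
by case: (sub c kc) => _ cK0; move/eqP: cK; exact.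
Qed.

Lemma Rexp_Ker : Rexp A beta w Lam =
  [set vmin w K | K in [set K : NSidx Lam | acc w Lam K /\
     ~ (Ker A w (proj_lt w K) `<=` Ker A w (proj K))]].
Proof.
rewrite RexpE; congr (image _ _); apply/seteqP.
by split=> K [aK /KerP].
Qed.

Lemma Rexp_colon : Rexp A beta w Lam =
  [set vmin w K | K in [set K : NSidx Lam | acc w Lam K /\
     ideal_colon (idealQ A w K) (dmon R (sval K)) <> setT]].
Proof.
rewrite RexpE; congr (image _ _); apply/seteqP; split=> K [aK].
  by move=> [c /realizable_notin_idealQ/ideal_colonP].
by move/ideal_colonP/notin_idealQ_realizable.
Qed.

End Realizability.

(** * Admissible lattices and the sum over all lattices *)

Section Admissibility.
Variables (R : realType) (d n : nat) (A : 'M[int]_(d, n)) (beta : 'cV[R[i]]_d).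
Local Notation C := R[i].
Local Notation S := {mpoly C[n]}.
Variable w : 'cV[R]_n.
Hypothesis w_generic : L_generic A w.

Section OneLattice.
Variable Lam : set 'cV[C]_n.
Hypothesis LamP : exp_lattices A beta Lam.
Implicit Types (c : {ffun NSidx Lam -> S}) (I J K : NSidx Lam).

Lemma exists_MinNS I : exists2 J, MinNS Lam J & sval J \subset sval I.
Proof.
have [J minJ JI] := @minset_exists _ (mem (NS Lam)) _ (svalP I).
have JNS : J \in NS Lam by case/minsetP: minJ.
by exists (exist _ J JNS).
Qed.

Lemma acc_Mw I : acc w Lam I -> Mw w Lam !=set0.
Proof.
by move=> aI; have [J minJ /aI bJ] := exists_MinNS I; exists J; split.
Qed.

Lemma dact_dmon1 (J : {set 'I_n}) : J != finset.set0 -> dact (dmon R J) 1 = 0.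
Proof.
case/finset.set0Pn => j jJ; rewrite /dmon (finset.big_setD1 j) //= mulrC dactM dactXU.
by rewrite mderivC linear0.
Qed.

Definition indicator I : {ffun NSidx Lam -> S} := [ffun J => (J == I)%:R].

(** At a minimal negative support every monomial d^(J - I) with J different from
    I is nontrivial and kills constants. *)
Lemma indicator_Coeff I : Mw w Lam I -> Coeff A w Lam (indicator I).
Proof.
move=> [minI bI]; have zero J K : J != I ->
    dact (dmon R (sval J :\: sval I)) (indicator I K) = 0.
  move=> JI; rewrite ffunE; case: (K == I); last exact: linear0.
  apply: dact_dmon1; rewrite finset.setD_eq0; apply: contra JI => sub.
  by case/minsetP: minI => _ /(_ _ (svalP J) sub) JI; apply/eqP/val_inj.
split=> [J i|J K|J nJ].
- rewrite ffunE; case: (J == I); last exact: linear0.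
  rewrite dact_suml big1 // => j _; rewrite -scaler_int dactZl dactXU.
  by rewrite mderivC scaler0.
- have [->|JI] := eqVneq J I; have [->|KI] := eqVneq K I => //.
  + by rewrite zero // [indicator I K]ffunE (negbTE KI) linear0.
  + by rewrite zero // [indicator I J]ffunE (negbTE JI) linear0.
  + by rewrite !ffunE (negbTE JI) (negbTE KI) !linear0.
rewrite ffunE; case: eqP => // JI; case: nJ; rewrite JI => K sub.
rewrite (_ : K = I) //; case/minsetP: minI => _ /(_ _ (svalP K) sub) KI.
exact: val_inj.
Qed.

Lemma indicator_minimal I : minimal_at w (indicator I) I.
Proof.
split=> [|J]; first by rewrite ffunE eqxx oner_eq0.
by rewrite ffunE; have [->//|_] := eqVneq J I; rewrite eqxx.
Qed.

Lemma Mw_lexp I : Mw w Lam I ->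
  exists phi, [/\ Sol A beta w Lam phi, phi <> 0 & lexp w phi = vmin w I].
Proof.
move=> MI; have [lam Llam] := lattice_nonempty LamP.
have IC := indicator_Coeff MI; have minI := indicator_minimal I.
exists (realize lam (indicator I)); split.
- exact: (realize_Sol w_generic LamP Llam IC).
- apply/(realize_neq0 LamP _ Llam); case: minI => nz _.
  by apply: contraNneq nz => ->; rewrite ffunE.
- exact: (lexp_realize w_generic LamP Llam IC minI).
Qed.

Lemma Sol_neq0P : (exists2 phi, Sol A beta w Lam phi & phi <> 0) <-> Mw w Lam !=set0.
Proof.
split=> [[phi phiS phi0]|[I /Mw_lexp[phi [phiS phi0 _]]]]; last by exists phi.
have [lam Llam] := lattice_nonempty LamP.
have [c cC phiE] := Sol_realize LamP Llam phiS; rewrite phiE in phi0.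
have [K [cK _]] := exists_minimal w ((realize_neq0 LamP c Llam).1 phi0).
exact: acc_Mw (Coeff_acc cC cK).
Qed.

Lemma Mdir_length : has_length (Mdir A w Lam) (mod_length (Mdir A w Lam)).
Proof.
have [k Mk] := Mdir_finite_length w_generic LamP.
by rewrite (mod_lengthE (Mdir_killed w_generic LamP) Mk).
Qed.

(** Through normalization and evaluation on generators, the solutions are
    Hom_S(M^dir, C[y]). *)
Lemma Sol_has_dim : has_dim (Sol A beta w Lam) (mod_length (Mdir A w Lam)).
Proof.
have [lam Llam] := lattice_nonempty LamP.
have [g gP] := iso_sym (normalize_iso w_generic LamP Llam).
apply: (iso_has_dim gP); apply: (iso_has_dim (eval_gen_iso A w Lam)).
exact: (HomS_has_dim (Mdir_killed w_generic LamP) Mdir_length).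
Qed.

(** Every negative support contains a minimal one, which is unbounded here; so no
    negative support is acceptable and all generators vanish. *)
Lemma Mdir_eq0 : ~ (Mw w Lam !=set0) -> forall x : Mdir A w Lam, x = 0.
Proof.
move=> nM x; have zero : submodule ([set 0] : set (Mdir A w Lam)) by exact: submodule_zero.
have gen := quotmod_gen zero; have : setT x by [].
rewrite -gen // => I; apply/to_quotmod0P; apply: sub_lspan; right; exists I => //.
by move=> aI; exact: nM (acc_Mw aI).
Qed.

End OneLattice.

Section AllLattices.
Local Notation index := (exp_lattices A beta).

Lemma adm_Sol : adm_lattices A beta w = [set Lam | exp_lattices A beta Lam /\
  exists2 phi, Sol A beta w Lam phi & phi <> 0].
Proof.
by apply/seteqP; split=> Lam [LamP H]; split=> //; exact/(Sol_neq0P LamP).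
Qed.

Lemma index_exp (j : index) : exp_lattices A beta (val j).
Proof. exact: (set_mem (valP j)). Qed.

Definition adm_seq : seq index := pmap insub (fset_set (adm_lattices A beta w)).

Lemma map_adm_seq : map val adm_seq = fset_set (adm_lattices A beta w).
Proof.
rewrite pmap_filter; last exact: insubK.
apply/all_filterP/allP => Lam; rewrite in_fset_set; last exact: adm_lattices_finite.
by move=> /set_mem[LamP _]; rewrite isSome_insub; exact: mem_set.
Qed.

Lemma uniq_adm_seq : uniq adm_seq.
Proof. by rewrite -(map_inj_uniq val_inj) map_adm_seq fset_uniq. Qed.

Lemma mem_adm_seq (j : index) : j \in adm_seq <-> Mw w (val j) !=set0.
Proof.
rewrite -(mem_map val_inj) map_adm_seq in_fset_set; last exact: adm_lattices_finite.
split=> [/set_mem[]//|Mj]; apply: mem_set; split=> //; exact: index_exp.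
Qed.

Lemma sum_adm_seq : (\sum_(j <- adm_seq) mod_length (Mdir A w (val j)) =
  \big[addn/0%N]_(Lam \in adm_lattices A beta w) mod_length (Mdir A w Lam))%N.
Proof.
rewrite fsbig_finite; last exact: adm_lattices_finite.
by rewrite -map_adm_seq big_map.
Qed.

Lemma Mdir_all_length : has_length (Mdir_all A beta w)
  (\big[addn/0%N]_(Lam \in adm_lattices A beta w) mod_length (Mdir A w Lam)).
Proof.
rewrite -sum_adm_seq.
have := @dsum_comp_series _ _ (fun j : index => Mdir A w (val j)) adm_seq
  (fun j => mod_length (Mdir A w (val j))) uniq_adm_seq.
rewrite (_ : dsum_on _ = setT); first by apply=> j _; apply: Mdir_length; exact: index_exp.
apply/seteqP; split=> // f _ j jA; apply: Mdir_eq0 => /mem_adm_seq.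
by rewrite (negbTE jA).
Qed.

Lemma Mdir_all_killed : killed_by_degree (Mdir_all A beta w) n.+1.
Proof.
move=> m f nm; apply: dsum_inj => j.
exact: (Mdir_killed w_generic (index_exp j)).
Qed.

Lemma Mdir_all_mod_length : mod_length (Mdir_all A beta w) =
  \big[addn/0%N]_(Lam \in adm_lattices A beta w) mod_length (Mdir A w Lam).
Proof. exact: mod_lengthE Mdir_all_killed Mdir_all_length. Qed.

(** A family of solutions automatically vanishes outside the finitely many
    admissible lattices. *)
Lemma Sol_all_sections : Sol_all A beta w =
  sections (fun j : index => Sol A beta w (val j)) adm_seq.
Proof.
apply/seteqP; split=> f.
  move=> [_ fS]; split=> // j jA; apply: contrapT => fj0.
  have : Mw w (val j) !=set0.
    by apply/(Sol_neq0P (index_exp j)); exists (f j).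
  by move/mem_adm_seq; rewrite (negbTE jA).
move=> [fS f0]; split=> //; apply: (@sub_finite_set _ _ [set` adm_seq]).
  by move=> j fj /=; apply: contrapT => /negP /f0.
exact: finite_seq.
Qed.

Lemma Sol_all_has_dim : has_dim (Sol_all A beta w) (mod_length (Mdir_all A beta w)).
Proof.
rewrite Mdir_all_mod_length -sum_adm_seq Sol_all_sections.
apply: sections_has_dim => [j||j _]; last by apply: Sol_has_dim; exact: index_exp.
  have [lam Llam] := lattice_nonempty (index_exp j).
  exact: submodule0 (Sol_sub w_generic (index_exp j) Llam).
exact: uniq_adm_seq.
Qed.

End AllLattices.
End Admissibility.

Theorem mainTheorem1 (R : realType) (d n : nat) (A : 'M[int]_(d, n))
    (beta : 'cV[R[i]]_d) (w : 'cV[R]_n)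
    (rankA : \rank (map_mx intr A : 'M[rat]_(d, n)) = d)
    (w_generic : L_generic A w) :
  [/\ forall Lam, exp_lattices A beta Lam -> forall lam, Lam lam ->
        [/\ forall phi, Sol A beta w Lam phi ->
              forall (I : NSidx Lam) gam, stratum Lam (sval I) gam ->
                norm_coeff lam phi gam = normalize lam Lam phi I,
            linear_iso_on (Sol A beta w Lam) (Coeff A w Lam)
              (normalize lam Lam) &
            linear_iso_on (HomS (Mdir A w Lam)) (Coeff A w Lam)
              (eval_gen A w Lam)],
      forall Lam, exp_lattices A beta Lam ->
        ((exists2 phi, Sol A beta w Lam phi & phi <> 0) <->
           Mw w Lam !=set0) /\
        forall I : NSidx Lam, Mw w Lam I ->
          exists phi, [/\ Sol A beta w Lam phi, phi <> 0 &
                          lexp w phi = vmin w I],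
      finite_set [set Lam | exp_lattices A beta Lam /\
                    exists2 phi, Sol A beta w Lam phi & phi <> 0] /\
      finite_set (adm_lattices A beta w),
      (forall Lam, adm_lattices A beta w Lam -> finite_length (Mdir A w Lam)) /\
      finite_length (Mdir_all A beta w) &
      [/\ has_dim (Sol_all A beta w)
            (mod_length (Mdir_all A beta w)),
          mod_length (Mdir_all A beta w) =
            \big[addn/0%N]_(Lam \in adm_lattices A beta w)
              mod_length (Mdir A w Lam) &
          forall Lam, adm_lattices A beta w Lam -> forall lam, Lam lam ->
            forall c : {ffun NSidx Lam -> {mpoly R[i][n]}}, Coeff A w Lam c ->
              Sol A beta w Lam (realize lam c) /\
              normalize lam Lam (realize lam c) = c]] /\
  forall Lam, exp_lattices A beta Lam ->
    Rexp A beta w Lam =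
      [set vmin w K | K in [set K : NSidx Lam | acc w Lam K /\
         ~ (Ker A w (proj_lt w K) `<=` Ker A w (proj K))]] /\
    Rexp A beta w Lam =
      [set vmin w K | K in [set K : NSidx Lam | acc w Lam K /\
         ideal_colon (idealQ A w K) (dmon R (sval K)) <> setT]].
Proof.
split; last first.
  by move=> Lam LamP; split; [exact: Rexp_Ker | exact: Rexp_colon].
split.
- move=> Lam LamP lam Llam; split.
  + move=> phi phiS I gam; exact: (norm_coeff_Sol LamP Llam phiS).
  + exact: normalize_iso.
  + exact: eval_gen_iso.
- move=> Lam LamP; split; first exact: Sol_neq0P.
  by move=> I; exact: Mw_lexp.
- by rewrite -adm_Sol //; split; exact: adm_lattices_finite.
- split; first by move=> Lam [LamP _]; exact: Mdir_finite_length LamP.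
  by eexists; exact: Mdir_all_length.
split; [exact: Sol_all_has_dim | exact: Mdir_all_mod_length |].
move=> Lam [LamP _] lam Llam c cC; split; first exact: realize_Sol.
exact: (normalize_realize LamP Llam).
Qed.
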